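(* Let $\mathcal{E}$ be a countable directed graph without sinks, $S$ its graph inverse semigroup and $G$ its path groupoid. Then $C^{*}(\mathcal{E})\cong C_{0}^{*}(S)\cong C^{*}(G)$.
   Context: Graph conventions. $\mathcal{E}$ is a directed graph with countable vertex set $V$ and countable edge set $E$; $s(e),r(e)$ are the initial and terminal vertices of an edge $e$. No sinks: every vertex is the source of at least one edge. $V_f$ (resp. $V_\infty$) is the set of vertices emitting finitely (resp. infinitely) many edges. A finite path is $\alpha=e_1\cdots e_k$ with $r(e_i)=s(e_{i+1})$, length $l(\alpha)=k$, $s(\alpha)=s(e_1)$, $r(\alpha)=r(e_k)$; each vertex $v$ is a finite path of length $0$ with $s(v)=r(v)=v$, and $s(\mu)\mu=\mu=\mu r(\mu)$. $Y$ is the set of finite paths, $Z$ the set of infinite paths $z_1z_2\cdots$, and $Y_\infty=\{y\in Y: r(y)\in V_\infty\}$. Graph $C^*$-algebra. A representation of $\mathcal{E}$ on a Hilbert space $\mathfrak{H}$ is a family $\{P_v\}_{v\in V}$ of mutually orthogonal projections and a family $\{S_e\}_{e\in E}$ of partial isometries such that the projections $S_eS_e^*$ are mutually orthogonal and: (i) $S_e^*S_e=P_{r(e)}$ for all $e\in E$; (ii) $P_v=\sum_{s(e)=v}S_eS_e^*$ for all $v\in V_f$; (iii) $P_{s(e)}S_eS_e^*=S_eS_e^*$ for all $e\in E$. $C^*(\mathcal{E})$ is the universal $C^*$-algebra for representations of $\mathcal{E}$. Graph inverse semigroup. $S$ consists of the pairs $(\alpha,\beta)$ of finite paths with $r(\alpha)=r(\beta)$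 together with a zero element $z$, with involution $(\alpha,\beta)^*=(\beta,\alpha)$, $z^*=z$, and product $(\alpha,\alpha'\mu)(\alpha',\beta)=(\alpha,\beta\mu)$, $(\alpha,\alpha')(\alpha'\mu,\beta')=(\alpha\mu,\beta')$, all other products being $z$. A vertex $v$ is identified with $(v,v)$. $C_0^*(S)$ is the (Hausdorff) completion of the convolution $*$-algebra $\ell^1(S)$ in the largest $C^*$-seminorm $\sup_\Pi\|\Pi(\cdot)\|$, where $\Pi$ ranges over the (linear extensions to $\ell^1(S)$ of) non-degenerate $*$-representations of $S$ on Hilbert spaces by bounded operators of norm at most 1 satisfying $\Pi(z)=0$ and $\Pi(v)=\sum_{s(e)=v}\Pi((e,e))$ for all $v\in V_f$. Path groupoid. $X=Y_\infty\cup Z$. $G$ is the set of triples $(\alpha\gamma,\,l(\alpha)-l(\beta),\,\beta\gamma)$ with $\alpha,\beta\in Y$, $\gamma\in X$, $r(\alpha)=r(\beta)=s(\gamma)$; multiplication $(x,m,y)(y,n,w)=(x,m+n,w)$, inverse $(x,m,y)^{-1}=(y,-m,x)$, unit space identified with $X$ via $x\leftrightarrow(x,0,x)$. For $\alpha,\beta\in Y$ with $r(\alpha)=r(\beta)$ let $A'_{\alpha,\beta}=\{(\alpha\gamma,l(\alpha)-l(\beta),\beta\gamma)\in G\}$. A basis for the topology of $G$ is given by the sets $A'_{\alpha,\beta}\setminus\bigcup_{i=1}^nA'_{\alpha\mu_i,\beta\mu_i}$ ($n\ge 0$, $\mu_i\in Y$ with $s(\mu_i)=r(\alpha)$). $G$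 is an r-discrete (étale) locally compact Hausdorff groupoid with counting measures as left Haar system, and $C^*(G)$ is its (full) groupoid $C^*$-algebra. *)

(* Defs.v *)
From HB Require Import structures.
From mathcomp Require Import all_boot all_order all_algebra.
From mathcomp Require Import finmap complex.
From mathcomp Require Import all_classical reals ereal esum topology normedtype.

Set Implicit Arguments.
Unset Strict Implicit.
Unset Printing Implicit Defensive.

Import Order.TTheory GRing.Theory Num.Theory numFieldNormedType.Exports.

Local Open Scope classical_set_scope.
Local Open Scope ring_scope.

Section Operators.
Variable R : realType.

(* Norms of normed modules over R[i] take values in R[i]; [rnorm] is the same
   norm as a real number. *)
Definition rnorm {W : normedModType R[i]} (x : W) : R := complex.Re `|x|.

(* Unconditional summation: convergence along the net of finite subsets. *)
Definition has_sum {I : choiceType} {W : normedModType R[i]}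
    (F : I -> W) (l : W) : Prop :=
  forall eps : R, 0 < eps -> exists A : {fset I}, forall B : {fset I},
    (A `<=` B)%fset -> rnorm (l - \sum_(i <- B) F i) < eps.

(* The sum of a summable family; 0 if the family is not summable. *)
Definition unc_sum {I : choiceType} {W : normedModType R[i]} (F : I -> W) : W :=
  xget 0 [set l | has_sum F l].

(* The inner product is linear in its first argument. *)
Record hilbertType := HilbertType {
  hilbert_sort :> completeNormedModType R[i];
  hdot : {dot hilbert_sort for Num.conj_op};
  hdot_norm : forall x, hdot x x = `|x| ^+ 2 }.
Local Arguments hdot {h}.

Section OnHilbert.
Variable H : hilbertType.
Implicit Types S T : H -> H.

Definition bounded_op T : Prop :=
  linear T /\ exists M : R, forall x, rnorm (T x) <= M * rnorm x.

Definition opnorm T : R := sup [set rnorm (T x) | x in [set x | rnorm x <= 1]].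

Definition adjoint_op S T : Prop := forall x y, hdot (S x) y = hdot x (T y).

Definition projection_op T : Prop :=
  [/\ bounded_op T, adjoint_op T T & forall x, T (T x) = T x].

End OnHilbert.

(* An involutive algebra given by operations that are only meaningful on the
   subset [sa_dom] of an ambient vector space: the function algebras below are
   given on all functions, and [sa_dom] selects the summable functions, or the
   continuous functions of compact support. *)
Record starAlg := StarAlg {
  sa_sort :> lmodType R[i];
  sa_dom : set sa_sort;
  sa_mul : sa_sort -> sa_sort -> sa_sort;
  sa_star : sa_sort -> sa_sort }.

(* Values of representations and homomorphisms outside [sa_dom] are
   irrelevant. *)
Definition star_rep (B : starAlg) (H : hilbertType) (pi : B -> H -> H) : Prop :=
  [/\ forall f, sa_dom f -> bounded_op (pi f),
      forall (c : R[i]) f g x, sa_dom f -> sa_dom g ->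
        pi (c *: f + g) x = c *: pi f x + pi g x,
      forall f g x, sa_dom f -> sa_dom g -> pi (sa_mul f g) x = pi f (pi g x)
    & forall f, sa_dom f -> adjoint_op (pi f) (pi (sa_star f))].

(* The linear span of the vectors T_i x, i in D, x in H, is dense. *)
Definition nondegenerate (I : Type) (H : hilbertType) (D : set I)
    (T : I -> H -> H) : Prop :=
  dense [set y : H | exists n (i : 'I_n -> I) (x : 'I_n -> H),
    (forall k, D (i k)) /\ y = \sum_k T (i k) (x k)].

(* Complex C*-algebras, not necessarily unital. *)
Record cstarAlg := CstarAlg {
  cs_sort :> completeNormedModType R[i];
  cs_mul : cs_sort -> cs_sort -> cs_sort;
  cs_star : cs_sort -> cs_sort;
  cs_mulA : forall a b c, cs_mul a (cs_mul b c) = cs_mul (cs_mul a b) c;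
  cs_mul_linl : forall b, linear (cs_mul^~ b);
  cs_mul_linr : forall a, linear (cs_mul a);
  cs_starK : involutive cs_star;
  cs_star_antilin : forall (c : R[i]) a b,
    cs_star (c *: a + b) = c^* *: cs_star a + cs_star b;
  cs_starM : forall a b, cs_star (cs_mul a b) = cs_mul (cs_star b) (cs_star a);
  cs_normM : forall a b, `|cs_mul a b| <= `|a| * `|b|;
  cs_normC : forall a, `|cs_mul (cs_star a) a| = `|a| ^+ 2 }.

Definition cstar_star (A : cstarAlg) : starAlg :=
  @StarAlg A setT (@cs_mul A) (@cs_star A).

Definition star_hom (B : starAlg) (A : cstarAlg) (h : B -> A) : Prop :=
  [/\ forall (c : R[i]) f g, sa_dom f -> sa_dom g -> h (c *: f + g) = c *: h f + h g,
      forall f g, sa_dom f -> sa_dom g -> h (sa_mul f g) = cs_mul (h f) (h g)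
    & forall f, sa_dom f -> h (sa_star f) = cs_star (h f)].

Definition cstar_iso (A B : cstarAlg) : Prop :=
  exists h : A -> B, star_hom (B := cstar_star A) h /\ bijective h.

(* (A, iota) is the Hausdorff completion of B in the seminorm
     f |-> sup { ||pi f|| : pi in the class reps }. *)
Definition rep_completion (B : starAlg)
    (reps : forall H : hilbertType, (B -> H -> H) -> Prop)
    (A : cstarAlg) (iota : B -> A) : Prop :=
  [/\ star_hom iota,
      dense [set iota f | f in @sa_dom B]
    & forall f, sa_dom f ->
        supremums [set r : R | exists (H : hilbertType) (pi : B -> H -> H),
                     reps H pi /\ r = opnorm (pi f)] (rnorm (iota f))].

(* The norm-closed *-subalgebra generated by D is the whole of A. *)
Definition cstar_generates (A : cstarAlg) (D : set A) : Prop :=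
  forall B : set A, closed B -> D `<=` B -> B 0 ->
    (forall (c : R[i]) a b, B a -> B b -> B (c *: a + b)) ->
    (forall a b, B a -> B b -> B (cs_mul a b)) ->
    (forall a, B a -> B (cs_star a)) ->
  B = setT.

End Operators.

Arguments hdot {R h}.

(* Countable includes finite; loops and multiple edges are allowed. *)
Record digraph := Digraph {
  vert : countType;
  edge : countType;
  src : edge -> vert;
  rng : edge -> vert }.

Section Paths.
Variable E : digraph.

Definition out_edges (v : vert E) : set (edge E) := [set e | src e = v].
Definition Vfin : set (vert E) := [set v | finite_set (out_edges v)].
Definition Vinf : set (vert E) := [set v | infinite_set (out_edges v)].
Definition no_sinks : Prop := forall v, out_edges v !=set0.

Fixpoint is_walk (v : vert E) (es : seq (edge E)) : bool :=
  if es is e :: es' then (src e == v) && is_walk (rng e) es' else true.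

(* A finite path is its initial vertex together with its list of edges; the
   paths of length 0 are thus the vertices. *)
Record fpath := FPath {
  path_raw :> vert E * seq (edge E);
  path_rawP : is_walk path_raw.1 path_raw.2 }.

HB.instance Definition _ := [isSub for path_raw].
HB.instance Definition _ := [Countable of fpath by <:].

Definition psrc (a : fpath) : vert E := a.1.
Definition pedges (a : fpath) : seq (edge E) := a.2.
Definition prng (a : fpath) : vert E := last (psrc a) [seq rng e | e <- pedges a].
Definition plen (a : fpath) : nat := size (pedges a).

Definition pvert (v : vert E) : fpath := @FPath (v, [::]) isT.

Fact pedge_subproof (e : edge E) : is_walk (src e) [:: e].
Proof. by rewrite /= eqxx. Qed.

Definition pedge (e : edge E) : fpath := @FPath (src e, [:: e]) (pedge_subproof e).

(* Concatenation; only used when prng a = psrc m (junk value a otherwise). *)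
Definition pcat (a m : fpath) : fpath := insubd a (psrc a, pedges a ++ pedges m).

(* If the first k edges of a form the path b, then pdrop k a is the path m with
   a = b m. *)
Definition pdrop (k : nat) (a : fpath) : fpath :=
  insubd a (last (psrc a) [seq rng e | e <- take k (pedges a)], drop k (pedges a)).

Definition is_prefix (b a : fpath) : bool :=
  (psrc b == psrc a) && prefix (pedges b) (pedges a).

Lemma is_walk_cat v es es' : is_walk v (es ++ es') =
  is_walk v es && is_walk (last v [seq rng e | e <- es]) es'.
Proof. by elim: es v => //= e es IH v; rewrite IH andbA. Qed.

Lemma pcatE a m : prng a = psrc m ->
  path_raw (pcat a m) = (psrc a, pedges a ++ pedges m).
Proof.
case: a m => [[v es] /= ok] [[w es'] /= ok']; rewrite /pcat /prng /psrc /pedges /=.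
by move=> h; rewrite -[LHS]/(val _) val_insubd /= is_walk_cat ok h ok'.
Qed.

Lemma prng_pcat a m : prng a = psrc m -> prng (pcat a m) = prng m.
Proof.
move=> h; rewrite /prng /psrc /pedges (pcatE h) /= map_cat last_cat.
by move: h; rewrite /prng => ->.
Qed.

Lemma is_prefix_pcat a m : prng a = psrc m -> is_prefix a (pcat a m).
Proof.
by move=> h; rewrite /is_prefix /psrc /pedges (pcatE h) /= eqxx prefix_prefix.
Qed.

Lemma pdrop_pcat a m : prng a = psrc m -> pdrop (plen a) (pcat a m) = m.
Proof.
move=> h; apply: val_inj; rewrite /pdrop.
have -> : psrc (pcat a m) = psrc a by rewrite {1}/psrc pcatE.
have -> : pedges (pcat a m) = pedges a ++ pedges m by rewrite {1}/pedges pcatE.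
rewrite /plen take_size_cat // drop_size_cat // val_insubd /=.
by rewrite -/(prng a) h (path_rawP m) [RHS]surjective_pairing.
Qed.

(* The graph inverse semigroup: None is the zero element z. *)
Definition gis : Type := option {p : fpath * fpath | prng p.1 == prng p.2}.

HB.instance Definition _ := Countable.on gis.

(* The element (a, b); only used when prng a = prng b (and z otherwise). *)
Definition gpair (a b : fpath) : gis := insub (a, b).

Definition gis_star (s : gis) : gis :=
  if s is Some p then gpair (val p).2 (val p).1 else None.

(* (a, b)(c, d) is (a, d m) if b = c m, is (a m, d) if c = b m, and z if neither
   of b, c extends the other. *)
Definition gis_mul (s t : gis) : gis :=
  match s, t with
  | Some p, Some q =>
      let: (a, b) := val p in let: (c, d) := val q in
      if is_prefix c b then gpair a (pcat d (pdrop (plen c) b))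
      else if is_prefix b c then gpair (pcat a (pdrop (plen b) c)) d
      else None
  | _, _ => None
  end.

Lemma gis_mulEl a a' m b : prng a' = psrc m -> prng a = prng m ->
  prng a' = prng b ->
  gis_mul (gpair a (pcat a' m)) (gpair a' b) = gpair a (pcat b m).
Proof.
move=> h1 h2 h3; rewrite /gpair insubT /= => [|_]; first by rewrite prng_pcat ?h2.
rewrite insubT /= => [|_]; first by rewrite h3.
by rewrite is_prefix_pcat // pdrop_pcat.
Qed.

Lemma gis_mulEr a a' m b' : prng a' = psrc m -> prng a = prng a' ->
  prng m = prng b' ->
  gis_mul (gpair a a') (gpair (pcat a' m) b') = gpair (pcat a m) b'.
Proof.
move=> h1 h2 h3; rewrite /gpair insubT /= => [|_]; first by rewrite h2.
rewrite insubT /= => [|_]; first by rewrite prng_pcat ?h3.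
rewrite is_prefix_pcat // pdrop_pcat //; case: ifP => // pf.
have e0 : pedges m = [::].
  case/andP: pf => _ /prefixP[t]; rewrite {2}/pedges (pcatE h1) /=.
  move/(congr1 size); rewrite !size_cat => /eqP.
  rewrite -addnA -{1}[size (pedges a')]addn0 eqn_add2l eq_sym addn_eq0.
  by move=> /andP[/nilP].
have pc x : prng x = psrc m -> pcat x m = x.
  move=> hx; apply: val_inj; rewrite /= pcatE // e0 cats0.
  by rewrite [RHS]surjective_pairing.
have pm : prng m = psrc m by rewrite /prng e0.
have d : pdrop (plen a') a' = m by rewrite -{2}(pc a') ?pdrop_pcat.
by rewrite (pc a') // d (pc a) ?h2 // (pc b') // -h3.
Qed.

End Paths.

Section PathGroupoid.
Variable E : digraph.

(* The path space X consists of the finite paths ending at an infinite emitter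
   and of the infinite paths; see [in_X]. *)
Inductive xpath := XFin of fpath E | XInf of (nat -> edge E).

Definition in_X : set xpath := fun x =>
  match x with
  | XFin y => Vinf (prng y)
  | XInf z => forall n, rng (z n) = src (z n.+1)
  end.

Definition xsrc (x : xpath) : vert E :=
  match x with XFin y => psrc y | XInf z => src (z 0%N) end.

(* Concatenation; only used when prng a = xsrc x. *)
Definition xcat (a : fpath E) (x : xpath) : xpath :=
  match x with
  | XFin y => XFin (pcat a y)
  | XInf z => XInf (fun n => nth (z (n - plen a)%N) (pedges a) n)
  end.

Definition pg_triple : Type := (xpath * int * xpath)%type.

(* The set A'_{a,b}; only used when prng a = prng b. *)
Definition pg_cyl (a b : fpath E) : set pg_triple :=
  [set (xcat a c, (plen a)%:Z - (plen b)%:Z, xcat b c)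
     | c in [set c | in_X c /\ xsrc c = prng a]].

Definition in_pg : set pg_triple := [set t |
  exists a b : fpath E, prng a = prng b /\ pg_cyl a b t].

Record pgroupoid := PGroupoid {
  pg_val :> pg_triple;
  pg_valP : in_pg pg_val }.

HB.instance Definition _ := gen_eqMixin pgroupoid.
HB.instance Definition _ := gen_choiceMixin pgroupoid.

Definition pg_basic : set (set pgroupoid) := [set U |
  exists (a b : fpath E) (ms : seq (fpath E)),
    [/\ prng a = prng b, forall m, m \in ms -> psrc m = prng a
      & U = [set g : pgroupoid | pg_cyl a b g /\
               forall m, m \in ms -> ~ pg_cyl (pcat a m) (pcat b m) g]]].

(* The sets in pg_basic form a basis; the topology they generate is obtained
   here from the factory for subbases, which has no proof obligation. *)
HB.instance Definition _ :=
  isSubBaseTopological.Build pgroupoid pg_basic (@id (set pgroupoid)).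

(* g h = k in the groupoid. *)
Definition pg_prod (g h k : pgroupoid) : Prop :=
  exists x m y n w, [/\ pg_val g = (x, m, y), pg_val h = (y, n, w)
                      & pg_val k = (x, m + n, w)].

Fact pg_inv_subproof (g : pgroupoid) :
  in_pg ((pg_val g).2, - (pg_val g).1.2, (pg_val g).1.1).
Proof.
case: (pg_valP g) => a [b [ab [c [cX cs] <-]]]; exists b, a; split => //.
by exists c; rewrite ?opprB //= -ab.
Qed.

Definition pg_inv (g : pgroupoid) : pgroupoid := PGroupoid (pg_inv_subproof g).

End PathGroupoid.

Section Algebras.
Variables (R : realType) (E : digraph).

(* A representation of the graph; Sa e is the adjoint of S e. *)
Definition graph_rep (H : hilbertType R)
    (P : vert E -> H -> H) (S : edge E -> H -> H) : Prop :=
  exists Sa : edge E -> H -> H,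
  [/\ [/\ forall v, projection_op (P v),
          forall v w x, v <> w -> P v (P w x) = 0,
          forall e, bounded_op (S e) /\ bounded_op (Sa e)
        & forall e, adjoint_op (S e) (Sa e)],
      (forall e, projection_op (Sa e \o S e)) /\
      (forall e f x, e <> f -> S e (Sa e (S f (Sa f x))) = 0),
      forall e x, Sa e (S e x) = P (rng e) x,
      forall v x, Vfin v -> P v x = \sum_(e \in out_edges v) S e (Sa e x)
    & forall e x, P (src e) (S e (Sa e x)) = S e (Sa e x)].

(* A, generated by p and s, is the universal C*-algebra of the graph. As the
   relations are those of a representation on a Hilbert space, (p, s) satisfies
   them in the sense that A is isometrically represented on a Hilbert space so
   that (p, s) becomes a representation of the graph. *)
Definition is_graph_cstar (A : cstarAlg R) : Prop :=
  exists (p : vert E -> A) (s : edge E -> A),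
  [/\ cstar_generates (range p `|` range s),
      exists (H : hilbertType R) (phi : cstar_star A -> H -> H),
        [/\ star_rep phi, forall a, opnorm (phi a) = rnorm a
          & graph_rep (fun v => phi (p v)) (fun e => phi (s e))]
    & forall (H : hilbertType R) (P : vert E -> H -> H) (S : edge E -> H -> H),
        graph_rep P S ->
        exists phi : cstar_star A -> H -> H,
          [/\ star_rep phi, forall v, phi (p v) = P v
            & forall e, phi (s e) = S e]].

(* The convolution algebra l^1(S) of the graph inverse semigroup. *)
Definition gis_l1 : starAlg R :=
  @StarAlg R (gis E -> R[i]^o)
    [set f | summable [set: gis E] (fun s => (rnorm (f s))%:E)]
    (fun f g s => unc_sum (fun tu : gis E * gis E =>
       if gis_mul tu.1 tu.2 == s then f tu.1 * g tu.2 : R[i]^o else 0))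
    (fun f s => (f (gis_star s))^*).

Definition gis_rep (H : hilbertType R) (Pi : gis E -> H -> H) : Prop :=
  [/\ forall s, bounded_op (Pi s) /\ opnorm (Pi s) <= 1,
      forall s t x, Pi (gis_mul s t) x = Pi s (Pi t x),
      forall s, adjoint_op (Pi s) (Pi (gis_star s)),
      nondegenerate setT Pi
    & (forall x, Pi None x = 0) /\
      forall v x, Vfin v -> Pi (gpair (pvert v) (pvert v)) x =
        \sum_(e \in out_edges v) Pi (gpair (pedge e) (pedge e)) x].

Definition gis_l1_rep (H : hilbertType R) (pi : gis_l1 -> H -> H) : Prop :=
  exists Pi : gis E -> H -> H, gis_rep Pi /\
    forall f x, @sa_dom R gis_l1 f -> has_sum (fun s => (f s : R[i]) *: Pi s x) (pi f x).

Definition is_gis_cstar (B : cstarAlg R) : Prop :=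
  exists iota : gis_l1 -> B, rep_completion gis_l1_rep iota.

(* The convolution algebra C_c(G) of the path groupoid, for counting measures. *)
Definition pg_Cc : starAlg R :=
  @StarAlg R (pgroupoid E -> R[i]^o)
    [set f | continuous f /\ compact (closure [set g | f g != 0])]
    (fun f g k => \sum_(p \in [set p : pgroupoid E * pgroupoid E |
                                 pg_prod p.1 p.2 k]) (f p.1 * g p.2 : R[i]^o))
    (fun f g => (f (pg_inv g))^*).

(* G being etale, every *-representation of C_c(G) by bounded operators is
   automatically bounded for the I-norm. *)
Definition pg_Cc_rep (H : hilbertType R) (pi : pg_Cc -> H -> H) : Prop :=
  star_rep pi /\ nondegenerate (@sa_dom R pg_Cc) pi.

Definition is_pg_cstar (C : cstarAlg R) : Prop :=
  exists kappa : pg_Cc -> C, rep_completion pg_Cc_rep kappa.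

End Algebras.

(* Main.v *)
(* The three algebras are characterized by one universal property: each is
   generated by a copy u of the graph inverse semigroup subject to the
   Cuntz-Krieger relation u(v,v) = \sum_(s(e) = v) u(e,e), v in V_f, and carries
   the largest C*-norm, [univ A u].  Such a pair (A, u) exists (direct sum of
   representations) and is unique up to isomorphism.  For the graph algebra
   u(a,b) = S_a S_b^*; for the inverse semigroup u is the image of the point
   masses; for the groupoid u(a,b) is the indicator of the cylinder A'_{a,b}.
   In the groupoid case functions in C_c(G) are uniform limits of combinations
   of cylinder indicators, and for combinations supported in n cylinders the
   sup norm controls, up to the factor n, the norm in every representation of
   either side: a joint eigenvector of the commuting projections u(b,b) selects
   a point of the path space at which the combination takes its eigenvalue, and
   on a bisection M^2 - |f|^2 has a square root in C_c(G). *)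

Require Import Defs.
From HB Require Import structures.
From mathcomp Require Import all_boot all_order all_algebra.
From mathcomp Require Import finmap complex.
From mathcomp Require Import all_classical reals ereal esum topology normedtype sequences.
From mathcomp Require Import zify ring lra.
(* Again, because mathcomp's path.v shadows fpath. *)
Import Defs.

Set Implicit Arguments.
Unset Strict Implicit.
Unset Printing Implicit Defensive.

Import Order.TTheory GRing.Theory Num.Theory numFieldNormedType.Exports.

Local Open Scope classical_set_scope.
Local Open Scope ring_scope.

Local Notation "x %:C" := (real_complex _ x) : ring_scope.

(** * Norms, Hilbert spaces and bounded operators *)

(** Three obstacles shape the proof. Representations live on arbitrary Hilbert spaces, so [univ]
    states their supremum by upper and least upper bounds [rep_le], and the algebra is cut out of
    one direct sum indexed by pairs of a combination and a real number. The supremum admits only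
    nondegenerate representations, while families in other algebras may act degenerately; they are
    first compressed to the closed span of their ranges. For the groupoid, a representation of
    C_c(G) is not given as continuous for any norm on functions, and one function can be written in
    many ways as a combination of cylinder indicators. The sup-norm estimates settle both: with M =
    0 they show that the value of a combination depends only on its function, and with M > 0 that
    uniform limits may be taken. The factor n is harmless, since it multiplies only errors that tend
    to 0, never the norms to be compared. The point behind an eigenvalue exists because the
    Cuntz-Krieger relations hold at exactly those vertices where a path in X may not stop. *)

Section NormBasics.
Variable R : realType.
Implicit Types W : normedModType R[i].

(** Convertible to [rnorm] on [R[i]^o], so facts about normed modules apply to scalars by
    conversion. *)
Definition cabs (c : R[i]) : R := complex.Re `|c|.

Lemma realC_Re (c : R[i]) : 0 <= c -> c = (complex.Re c)%:C.
Proof. by case: c => a b; rewrite lecE /= => /andP[/eqP -> _]. Qed.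

Lemma rnormE W (x : W) : `|x| = (rnorm x)%:C.
Proof. exact: realC_Re. Qed.

Lemma cabsE (c : R[i]) : `|c| = (cabs c)%:C.
Proof. exact: realC_Re. Qed.

Lemma rnorm_ge0 W (x : W) : 0 <= rnorm x.
Proof. by rewrite -ler0c -rnormE. Qed.

Lemma cabs_ge0 c : 0 <= cabs c.
Proof. by rewrite -ler0c -cabsE. Qed.
Hint Resolve rnorm_ge0 cabs_ge0 : core.

Lemma rnormD W (x y : W) : rnorm (x + y) <= rnorm x + rnorm y.
Proof. by rewrite -lecR rmorphD /= -!rnormE ler_normD. Qed.

Lemma rnormZ W c (x : W) : rnorm (c *: x) = cabs c * rnorm x.
Proof. by apply: complexI; rewrite rmorphM /= -cabsE -!rnormE normrZ. Qed.

Lemma rnorm0 W : rnorm (0 : W) = 0.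
Proof. by rewrite /rnorm normr0. Qed.

Lemma rnorm0_eq W (x : W) : rnorm x = 0 -> x = 0.
Proof. by move=> h; apply/eqP; rewrite -normr_eq0 rnormE h. Qed.

Lemma rnormN W (x : W) : rnorm (- x) = rnorm x.
Proof. by rewrite /rnorm normrN. Qed.

Lemma rnormC W (x y : W) : rnorm (x - y) = rnorm (y - x).
Proof. by rewrite /rnorm distrC. Qed.

Lemma rnorm_tri W (y x z : W) : rnorm (x - z) <= rnorm (x - y) + rnorm (y - z).
Proof. by rewrite -{1}(subrK y x) -addrA rnormD. Qed.

Lemma rnormB_ge W (x y : W) : rnorm x - rnorm y <= rnorm (x - y).
Proof. by rewrite lerBlDr -{1}(subrK y x) rnormD. Qed.

Lemma rnorm_lt_eq W (x y : W) : (forall e : R, 0 < e -> rnorm (x - y) < e) -> x = y.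
Proof.
move=> h; apply/eqP; rewrite -subr_eq0; apply/eqP/rnorm0_eq/eqP.
rewrite eq_le rnorm_ge0 andbT; apply/ler_addgt0Pr => e e0.
by rewrite add0r ltW // h.
Qed.

Lemma rnorm_sum W I (r : seq I) (F : I -> W) :
  rnorm (\sum_(i <- r) F i) <= \sum_(i <- r) rnorm (F i).
Proof.
elim/big_rec2: _ => [|i y z _ h]; first by rewrite rnorm0.
by apply: le_trans (rnormD _ _) _; rewrite lerD2l.
Qed.

Lemma cabsM c d : cabs (c * d) = cabs c * cabs d.
Proof. by apply: complexI; rewrite rmorphM /= -!cabsE normrM. Qed.

Lemma cabsD c d : cabs (c + d) <= cabs c + cabs d.
Proof. exact: (@rnormD R[i]^o). Qed.

Lemma cabs0 : cabs 0 = 0.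
Proof. by rewrite /cabs normr0. Qed.

Lemma cabs0_eq c : cabs c = 0 -> c = 0.
Proof. exact: (@rnorm0_eq R[i]^o). Qed.

Lemma cabs1 : cabs 1 = 1.
Proof. by rewrite /cabs normr1. Qed.

Lemma cabsN c : cabs (- c) = cabs c.
Proof. by rewrite /cabs normrN. Qed.

Lemma cabsC c d : cabs (c - d) = cabs (d - c).
Proof. by rewrite /cabs distrC. Qed.

Lemma cabsJ c : cabs c^* = cabs c.
Proof. by rewrite /cabs norm_conjC. Qed.

Lemma cabsR (x : R) : cabs x%:C = `|x|.
Proof. by rewrite /cabs normc_def /= expr0n addr0 sqrtr_sqr. Qed.

Lemma cabs_sum I (r : seq I) (F : I -> R[i]) :
  cabs (\sum_(i <- r) F i) <= \sum_(i <- r) cabs (F i).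
Proof. exact: (@rnorm_sum R[i]^o). Qed.

Lemma cabs_Re c : `|complex.Re c| <= cabs c.
Proof. by rewrite -lecR -cabsE normc_ge_Re. Qed.

Lemma cabs_Im c : `|complex.Im c| <= cabs c.
Proof.
rewrite /cabs normc_def /= -sqrtr_sqr ler_sqrt ?lerDr ?sqr_ge0 //.
by rewrite addr_ge0 ?sqr_ge0.
Qed.

Lemma cabs_le_ReIm c : cabs c <= `|complex.Re c| + `|complex.Im c|.
Proof.
rewrite -[_ + _]ger0_norm ?addr_ge0 // -sqrtr_sqr /cabs normc_def /= ler_sqrt ?sqr_ge0 //.
rewrite sqrrD !real_normK ?num_real // addrAC lerDl mulrn_wge0 // mulr_ge0 //.
Qed.

Lemma cabs2 c : (cabs c ^+ 2)%:C = c * c^*.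
Proof. by rewrite rmorphXn /= -cabsE normCK. Qed.

Definition slim W (x : nat -> W) (l : W) := forall e : R, 0 < e ->
  exists n0, forall n, (n0 <= n)%N -> rnorm (x n - l) < e.

Definition scauchy W (x : nat -> W) := forall e : R, 0 < e ->
  exists n0, forall m n, (n0 <= m)%N -> (n0 <= n)%N -> rnorm (x m - x n) < e.

(** Sequences and real tolerances, so that the scalars and the complete normed modules are covered
    by one notion. *)
Definition seq_complete W := forall x : nat -> W, scauchy x -> exists l, slim x l.

(** A positive element of [R[i]] is real, so balls with complex radii are balls with real radii. *)
Lemma nbhs_rnorm W (x : W) (A : set W) :
  nbhs x A <-> exists2 e : R, 0 < e & forall y, rnorm (y - x) < e -> A y.
Proof.
rewrite -nbhs_ballE; split.
  move=> [e /= e0 h]; exists (complex.Re e).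
    by move: e0; rewrite ltcE => /andP[].
  move=> y hy; apply: h; rewrite -ball_normE /= distrC rnormE (realC_Re (ltW e0)).
  by rewrite ltcR.
move=> [e e0 h]; exists e%:C; first by rewrite /= ltcR.
move=> y; rewrite -ball_normE /= distrC rnormE ltcR; exact: h.
Qed.

Lemma closed_rnorm W (A : set W) : closed A <->
  forall x, (forall e : R, 0 < e -> exists2 y, A y & rnorm (y - x) < e) -> A x.
Proof.
split => h x hx.
  apply: h => B /nbhs_rnorm[e e0 hB]; have [y Ay yx] := hx _ e0.
  by exists y; split => //; exact: hB.
apply: h => e e0; have [|y [Ay By]] := hx [set y | rnorm (y - x) < e].
  by apply/nbhs_rnorm; exists e.
by exists y.
Qed.

Lemma dense_rnorm W (A : set W) : dense A <->
  forall x (e : R), 0 < e -> exists2 y, A y & rnorm (y - x) < e.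
Proof.
split => [h x e e0|h O [x Ox] oO].
  have [||y []] := h [set y | rnorm (y - x) < e].
  - by exists x; rewrite /= subrr rnorm0.
  - rewrite openE => y /= hy; apply/nbhs_rnorm; exists (e - rnorm (y - x)).
      by rewrite subr_gt0.
    by move=> z hz /=; have := rnorm_tri y z x; move: hz; lra.
  - by move=> hy Ay; exists y.
have [] := (nbhs_rnorm x O).1; first by rewrite openE in oO; apply: oO.
move=> e e0 he; have [y Ay yx] := h x e e0.
by exists y; split => //; exact: he.
Qed.

Lemma cts_rnorm (T : topologicalType) W (f : T -> W) : continuous f <->
  forall x (e : R), 0 < e -> nbhs x [set y | rnorm (f y - f x) < e].
Proof.
split => [h x e e0|h x A /nbhs_rnorm[e e0 he]].
  by apply: (h x [set z | rnorm (z - f x) < e]); apply/nbhs_rnorm; exists e.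
by apply: filterS (h x e e0) => y; exact: he.
Qed.

Lemma seq_completeP (W : completeNormedModType R[i]) : seq_complete W.
Proof.
move=> x cx; have : cvg (x @ \oo).
  apply/cauchy_cvgP; apply/cauchyP => e e0.
  have [n0 hn] := cx (complex.Re e) ltac:(by move: e0; rewrite ltcE => /andP[]).
  exists (x n0); exists n0 => // n /= nn.
  rewrite -ball_normE /= rnormE (realC_Re (ltW e0)) ltcR; exact: hn.
move=> /cvg_ex[l hl]; exists l => e e0.
have [] := hl [set y | rnorm (y - l) < e]; first by apply/nbhs_rnorm; exists e.
by move=> n0 _ h; exists n0 => n nn; apply: (h n).
Qed.

(* Mathcomp-analysis provides no completeness instance for [R[i]]. *)
Lemma seq_completeC : seq_complete R[i]^o.
Proof.
move=> x cx.
have cRe (p : R[i] -> R) : (forall a b, p (a - b) = p a - p b) ->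
    (forall c, `|p c| <= cabs c) ->
    exists l, forall e : R, 0 < e -> exists n0, forall n, (n0 <= n)%N -> `|p (x n) - l| < e.
  move=> pB pl; have : cvg (p \o x @ \oo).
    apply/cauchy_cvgP; apply/cauchyP => e e0; have [n0 hn] := cx e e0.
    exists (p (x n0)); exists n0 => // n /= nn.
    by rewrite -ball_normE /= -pB; apply: le_lt_trans (pl _) _; exact: hn.
  move=> /cvg_ex[l /cvgrPdist_lt hl]; exists l => e /hl [n0 _ h].
  by exists n0 => n nn; rewrite distrC; apply: h.
have [|a ha] := cRe _ _ cabs_Re; first by move=> [? ?] [? ?].
have [|b hb] := cRe _ _ cabs_Im; first by move=> [? ?] [? ?].
exists (a +i* b)%C => e e0.
have [n1 h1] := ha (e / 2) (divr_gt0 e0 (ltr0Sn R 1)); have [n2 h2] := hb (e / 2) (divr_gt0 e0 (ltr0Sn R 1)).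
exists (maxn n1 n2) => n; rewrite geq_max => /andP[/h1 + /h2].
have := cabs_le_ReIm (x n - (a +i* b)%C); case: (x n) => c d /=.
rewrite /rnorm /cabs; lra.
Qed.

End NormBasics.

#[global] Hint Extern 0 (is_true (_ <= rnorm _)) => exact: rnorm_ge0 : core.
#[global] Hint Extern 0 (is_true (_ <= cabs _)) => exact: cabs_ge0 : core.

(* A subspace [sb_P] of a vector space, complete for a norm [sb_N] that need
   only be a norm on [sb_P]. *)
Record subBanach (R : realType) := SubBanach {
  sb_V : lmodType R[i];
  sb_P : set sb_V;
  sb_N : sb_V -> R;
  sb_P0 : sb_P 0;
  sb_PL : forall c x y, sb_P x -> sb_P y -> sb_P (c *: x + y);
  sb_ND : forall x y, sb_P x -> sb_P y -> sb_N (x + y) <= sb_N x + sb_N y;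
  sb_NZ : forall c x, sb_P x -> sb_N (c *: x) = cabs c * sb_N x;
  sb_N0 : forall x, sb_P x -> sb_N x = 0 -> x = 0;
  sb_compl : forall u : nat -> sb_V, (forall n, sb_P (u n)) ->
    (forall e : R, 0 < e -> exists n0, forall m n, (n0 <= m)%N -> (n0 <= n)%N ->
       sb_N (u m - u n) < e) ->
    exists2 l, sb_P l & forall e : R, 0 < e -> exists n0, forall n, (n0 <= n)%N ->
       sb_N (u n - l) < e }.

(** * Complete normed modules from complete subspaces *)

Section SubBanachTheory.
Variables (R : realType) (b : subBanach R).

Record sbsort := SB { sbval : sb_V b; sbvalP : sb_P sbval }.

Lemma sbval_inj : injective sbval.
Proof.
by move=> [x xP] [y yP] /= exy; subst y; rewrite (Prop_irrelevance xP yP).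
Qed.

HB.instance Definition _ := gen_eqMixin sbsort.
HB.instance Definition _ := gen_choiceMixin sbsort.

Fact sb_PD (x y : sb_V b) : sb_P x -> sb_P y -> sb_P (x + y).
Proof. by move=> hx hy; rewrite -[x]scale1r; apply: sb_PL. Qed.
Fact sb_PZ c (x : sb_V b) : sb_P x -> sb_P (c *: x).
Proof. by move=> hx; rewrite -[_ *: _]addr0; apply: sb_PL => //; apply: sb_P0. Qed.
Fact sb_PN (x : sb_V b) : sb_P x -> sb_P (- x).
Proof. by rewrite -scaleN1r; apply: sb_PZ. Qed.

Definition sb_zero := SB (sb_P0 b).
Definition sb_add x y := SB (sb_PD (sbvalP x) (sbvalP y)).
Definition sb_opp x := SB (sb_PN (sbvalP x)).
Definition sb_scale c x := SB (sb_PZ c (sbvalP x)).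

Fact sb_addA : associative sb_add.
Proof. by move=> x y z; apply: sbval_inj; apply: addrA. Qed.
Fact sb_addC : commutative sb_add.
Proof. by move=> x y; apply: sbval_inj; apply: addrC. Qed.
Fact sb_add0 : left_id sb_zero sb_add.
Proof. by move=> x; apply: sbval_inj; apply: add0r. Qed.
Fact sb_addN : left_inverse sb_zero sb_opp sb_add.
Proof. by move=> x; apply: sbval_inj; apply: addNr. Qed.

HB.instance Definition _ := GRing.isZmodule.Build sbsort sb_addA sb_addC sb_add0 sb_addN.

Fact sb_scaleA c d x : sb_scale c (sb_scale d x) = sb_scale (c * d) x.
Proof. by apply: sbval_inj; apply: scalerA. Qed.
Fact sb_scale1 : left_id 1 sb_scale.
Proof. by move=> x; apply: sbval_inj; apply: scale1r. Qed.
Fact sb_scaleDr : right_distributive sb_scale +%R.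
Proof. by move=> c x y; apply: sbval_inj; apply: scalerDr. Qed.
Fact sb_scaleDl x : {morph sb_scale^~ x : c d / c + d}.
Proof. by move=> c d; apply: sbval_inj; apply: scalerDl. Qed.

HB.instance Definition _ :=
  GRing.Zmodule_isLmodule.Build R[i] sbsort sb_scaleA sb_scale1 sb_scaleDr sb_scaleDl.

Definition sb_norm (x : sbsort) : R[i] := (sb_N (sbval x))%:C.

Fact sb_normD x y : sb_norm (x + y) <= sb_norm x + sb_norm y.
Proof. by rewrite /sb_norm -rmorphD lecR; apply: sb_ND; apply: sbvalP. Qed.
Fact sb_normZ (c : R[i]) x : sb_norm (c *: x) = `|c| * sb_norm x.
Proof. by rewrite /sb_norm sb_NZ ?rmorphM /= -?cabsE //; apply: sbvalP. Qed.
Fact sb_norm0 x : sb_norm x = 0 -> x = 0.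
Proof. by case/complexI => h; apply/sbval_inj/sb_N0 => //; apply: sbvalP. Qed.

HB.instance Definition _ :=
  Lmodule_isNormed.Build R[i] sbsort sb_normD sb_normZ sb_norm0.

Lemma sb_rnormE (x : sbsort) : rnorm x = sb_N (sbval x).
Proof. by []. Qed.

Lemma sbvalD x y : sbval (x + y) = sbval x + sbval y. Proof. by []. Qed.
Lemma sbvalZ c x : sbval (c *: x) = c *: sbval x. Proof. by []. Qed.

Lemma sb_seq_complete : @seq_complete R sbsort.
Proof.
move=> x cx.
have [||l lP hl] := @sb_compl R b (fun n => sbval (x n)).
- by move=> n; apply: sbvalP.
- by move=> e /cx.
by exists (SB lP) => e /hl.
Qed.

(** Filters reduce to sequences: choose [x n] with F-many points within 1/(n+1) of it. Two members
    of a proper filter meet, which makes [x] Cauchy, and its limit is a limit of F. *)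
Fact sb_cauchy_cvg (F : set_system sbsort) : ProperFilter F -> cauchy F -> cvg F.
Proof.
move=> FF /cauchyP cF.
have ex n : exists x : sbsort, F [set y | rnorm (y - x) < n.+1%:R^-1].
  have /= [|x hx] := cF (n.+1%:R^-1)%:C; first by rewrite ltcR invr_gt0.
  exists x; apply: filterS hx => y; rewrite -ball_normE /= rnormE ltcR.
  by rewrite rnormC.
have {}[x hx] := choice ex.
have inv_small (e : R) : 0 < e -> exists n0, forall n, (n0 <= n)%N -> n.+1%:R^-1 < e :> R.
  move=> e0; exists (Num.truncn e^-1).+1 => n nn.
  rewrite invf_plt ?posrE // (lt_trans (truncnS_gt _)) // ltr_nat ltnS //.
have meet m n : rnorm (x m - x n) < m.+1%:R^-1 + n.+1%:R^-1.
  have [y [/= ym yn]] := filter_ex (filterI (hx m) (hx n)).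
  by apply: le_lt_trans (rnorm_tri y _ _) _; apply: ltrD => //; rewrite rnormC.
have [|l hl] := @sb_seq_complete x.
  move=> e e0; have [n0 hn] := inv_small (e / 2) (divr_gt0 e0 (ltr0Sn R 1)).
  exists n0 => m n /hn hm /hn {}hn.
  by apply: lt_trans (meet m n) _; rewrite [e]splitr ltrD.
apply/cvg_ex; exists l => A /nbhs_rnorm[e e0 he].
have [n0 h0] := inv_small (e / 2) (divr_gt0 e0 (ltr0Sn R 1)).
have [n1 h1] := hl (e / 2) (divr_gt0 e0 (ltr0Sn R 1)).
have := hx (maxn n0 n1); apply: filterS => y /= hy; apply: he.
apply: le_lt_trans (rnorm_tri (x (maxn n0 n1)) _ _) _.
rewrite [e]splitr ltrD // ?h1 ?leq_maxr //; apply: lt_trans hy _.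
by rewrite h0 ?leq_maxl.
Qed.

HB.instance Definition _ := Uniform_isComplete.Build sbsort sb_cauchy_cvg.

Definition sb_banach : completeNormedModType R[i] := sbsort.

End SubBanachTheory.

Section HilbertBasics.
Variables (R : realType) (H : hilbertType R).
Implicit Types (x y : H) (S T : H -> H).

Lemma hdotDl x y z : hdot (x + y) z = hdot x z + hdot y z.
Proof. exact: linearDl. Qed.
Lemma hdotZl c x z : hdot (c *: x) z = c * hdot x z.
Proof. exact: linearZl_LR. Qed.
Lemma hdotC x y : hdot x y = (hdot y x)^*.
Proof. by rewrite hermC /= expr0 mul1r. Qed.
Lemma hdotDr x y z : hdot z (x + y) = hdot z x + hdot z y.
Proof. exact: linearDr. Qed.
Lemma hdotZr c x z : hdot z (c *: x) = c^* * hdot z x.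
Proof. exact: linearZr_LR. Qed.
Lemma hdot0l x : hdot 0 x = 0. Proof. exact: linear0l. Qed.
Lemma hdot0r x : hdot x 0 = 0. Proof. exact: linear0r. Qed.
Lemma hdotNl x y : hdot (- x) y = - hdot x y. Proof. exact: linearNl. Qed.
Lemma hdotNr x y : hdot x (- y) = - hdot x y. Proof. exact: linearNr. Qed.
Lemma hdotBl x y z : hdot (x - y) z = hdot x z - hdot y z.
Proof. by rewrite hdotDl hdotNl. Qed.
Lemma hdotBr x y z : hdot z (x - y) = hdot z x - hdot z y.
Proof. by rewrite hdotDr hdotNr. Qed.
Lemma hdotxx x : hdot x x = (rnorm x ^+ 2)%:C.
Proof. by rewrite hdot_norm rnormE rmorphXn. Qed.

Lemma hdot_ext x y : (forall z, hdot x z = hdot y z) -> x = y.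
Proof.
move=> h; apply/eqP; rewrite -subr_eq0; apply/eqP/rnorm0_eq/eqP.
rewrite -sqrf_eq0; apply/eqP/complexI; rewrite -hdotxx hdotBl h subrr //.
Qed.

Lemma rnorm_pyth x y : hdot x y = 0 -> rnorm (x + y) ^+ 2 = rnorm x ^+ 2 + rnorm y ^+ 2.
Proof.
move=> xy; apply: complexI; rewrite rmorphD /= -!hdotxx hdotDl !hdotDr xy.
by rewrite (hdotC y) xy rmorph0 addr0 add0r.
Qed.

Lemma cauchy_schwarz x y : cabs (hdot x y) <= rnorm x * rnorm y.
Proof.
have [y0|/eqP y0] := eqVneq (rnorm y) 0.
  by rewrite (rnorm0_eq y0) hdot0r cabs0 rnorm0 mulr0.
set a := hdot x y; set Y := rnorm y; set X := rnorm x.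
(* The vector |y|^2 x - <x, y> y is |y|^2 times the part of x orthogonal to y; in this form the
   computation is free of division. *)
have e : (rnorm ((Y ^+ 2)%:C *: x - a *: y) ^+ 2) = Y ^+ 2 * (Y ^+ 2 * X ^+ 2 - cabs a ^+ 2).
  apply: complexI; rewrite -hdotxx !(hdotBl, hdotBr, hdotZl, hdotZr) !hdotxx.
  rewrite (hdotC y x) -/a -/X -/Y (rmorphM _ (Y ^+ 2)) rmorphB (rmorphM _ (Y ^+ 2)) /= cabs2.
  have -> : ((Y ^+ 2)%:C)^* = (Y ^+ 2)%:C :> R[i] by rewrite conj_Creal // complex_real.
  ring.
have Yp : 0 < Y by rewrite lt_def rnorm_ge0 andbT; apply/eqP.
have := sqr_ge0 (rnorm ((Y ^+ 2)%:C *: x - a *: y)).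
rewrite e pmulr_rge0 ?exprn_gt0 // subr_ge0 -exprMn => h.
by rewrite -(@ler_pXn2r _ 2) ?nnegrE ?mulr_ge0 ?rnorm_ge0 ?cabs_ge0 // (mulrC X).
Qed.

Lemma bounded_op0 T : bounded_op T -> T 0 = 0.
Proof. by move=> [lT _]; have := lT (-1) 0 0; rewrite scaler0 addr0 scaleN1r addNr. Qed.
Lemma bounded_opD T x y : bounded_op T -> T (x + y) = T x + T y.
Proof. by move=> [lT _]; have := lT 1 x y; rewrite !scale1r. Qed.
Lemma bounded_opZ T c x : bounded_op T -> T (c *: x) = c *: T x.
Proof. by move=> bT; have := bT.1 c x 0; rewrite (bounded_op0 bT) !addr0. Qed.
Lemma bounded_opN T x : bounded_op T -> T (- x) = - T x.
Proof. by move=> bT; rewrite -scaleN1r bounded_opZ // scaleN1r. Qed.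
Lemma bounded_opB T x y : bounded_op T -> T (x - y) = T x - T y.
Proof. by move=> bT; rewrite bounded_opD // bounded_opN. Qed.

Lemma opnorm_has_sup T : bounded_op T ->
  has_sup [set rnorm (T x) | x in [set x | rnorm x <= 1]].
Proof.
move=> [_ [M hM]]; split; first by exists (rnorm (T 0)), 0; rewrite /= ?rnorm0.
exists `|M| => _ [x /= x1 <-]; apply: le_trans (hM x) _.
have := ler_norm M; have := normr_ge0 M; have := rnorm_ge0 x; nra.
Qed.

Lemma opnorm_ub T x : bounded_op T -> rnorm x <= 1 -> rnorm (T x) <= opnorm T.
Proof.
by move=> bT x1; have := sup_upper_bound (opnorm_has_sup bT); apply; exists x.
Qed.

Lemma opnorm_ge0 T : bounded_op T -> 0 <= opnorm T.
Proof.
move=> bT; apply: (@le_trans _ _ (rnorm (T 0))) => //.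
by apply: opnorm_ub; rewrite ?rnorm0.
Qed.

Lemma opnormP T x : bounded_op T -> rnorm (T x) <= opnorm T * rnorm x.
Proof.
move=> bT; have [x0|/eqP x0] := eqVneq (rnorm x) 0.
  by rewrite (rnorm0_eq x0) bounded_op0 // rnorm0 mulr0.
have xp : 0 < rnorm x by rewrite lt_def rnorm_ge0 andbT; apply/eqP.
rewrite -ler_pdivrMr // mulrC -[_^-1]ger0_norm ?invr_ge0 // -cabsR -rnormZ.
rewrite -bounded_opZ //; apply: opnorm_ub => //.
by rewrite rnormZ cabsR ger0_norm ?invr_ge0 // mulVf //; apply/eqP.
Qed.

Lemma opnorm_le T M : bounded_op T -> 0 <= M ->
  (forall x, rnorm (T x) <= M * rnorm x) -> opnorm T <= M.
Proof.
move=> bT M0 h; apply: ge_sup; first by have [] := opnorm_has_sup bT.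
by move=> _ [x /= x1 <-]; apply: le_trans (h x) _; have := rnorm_ge0 x; nra.
Qed.

Lemma opnorm_eq0 T : bounded_op T -> opnorm T = 0 -> forall x, T x = 0.
Proof.
move=> bT T0 x; apply/rnorm0_eq/eqP; rewrite eq_le rnorm_ge0 andbT.
by have := opnormP x bT; rewrite T0 mul0r.
Qed.

Lemma bounded_op_cst0 : bounded_op (fun _ : H => 0).
Proof.
split; first by move=> c x y; rewrite scaler0 addr0.
by exists 0 => x; rewrite rnorm0 mul0r.
Qed.

Lemma bounded_op_lin c S T : bounded_op S -> bounded_op T ->
  bounded_op (fun x => c *: S x + T x).
Proof.
move=> bS bT; split.
  by move=> d x y; rewrite bS.1 bT.1 !scalerDr !scalerA mulrC -!addrA; congr (_ + _);
    rewrite addrCA.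
exists (cabs c * opnorm S + opnorm T) => x.
apply: le_trans (rnormD _ _) _; rewrite rnormZ mulrDl lerD ?opnormP //.
by rewrite -mulrA ler_wpM2l // opnormP.
Qed.

Lemma bounded_op_comp S T : bounded_op S -> bounded_op T -> bounded_op (fun x => S (T x)).
Proof.
move=> bS bT; split; first by move=> c x y; rewrite bT.1 bS.1.
exists (opnorm S * opnorm T) => x; apply: le_trans (opnormP _ bS) _.
by rewrite -mulrA ler_wpM2l ?opnorm_ge0 // opnormP.
Qed.

Lemma adjoint_sym S T : adjoint_op S T -> adjoint_op T S.
Proof. by move=> h x y; rewrite hdotC -h -hdotC. Qed.

Lemma adjoint_uniq S T T' : adjoint_op S T -> adjoint_op S T' -> T = T'.
Proof.
move=> h h'; apply/funext => x; apply: hdot_ext => y.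
by rewrite hdotC -h h' -hdotC.
Qed.

Lemma adjoint_opnorm S T : bounded_op S -> bounded_op T -> adjoint_op S T ->
  opnorm T <= opnorm S.
Proof.
move=> bS bT a; apply: opnorm_le; rewrite ?opnorm_ge0 // => x.
have [T0|/eqP T0] := eqVneq (rnorm (T x)) 0.
  by rewrite T0 mulr_ge0 ?opnorm_ge0.
have Tp : 0 < rnorm (T x) by rewrite lt_def rnorm_ge0 andbT; apply/eqP.
rewrite -(ler_pM2r Tp) -expr2 -[_ ^+ 2]ger0_norm ?sqr_ge0 // -cabsR -hdotxx -a.
apply: le_trans (cauchy_schwarz _ _) _.
by rewrite mulrAC ler_wpM2r // opnormP.
Qed.

End HilbertBasics.

(** * The C*-algebra of adjointable operators on a Hilbert space *)

Section OperatorAlgebra.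
Variables (R : realType) (H : hilbertType R).
Implicit Types (x y : H) (S T : H -> H).

(** A bounded adjoint is demanded rather than constructed, so completeness has to produce the
    adjoints of limits. *)
Definition adjointable T := bounded_op T /\ exists2 T', bounded_op T' & adjoint_op T T'.

Fact adjointable0 : adjointable 0.
Proof.
split; first exact: bounded_op_cst0.
exists (fun _ => 0); first exact: bounded_op_cst0.
by move=> x y; rewrite hdot0l hdot0r.
Qed.

Fact adjointable_lin c S T : adjointable S -> adjointable T -> adjointable (c *: S + T).
Proof.
move=> [bS [S' bS' aS]] [bT [T' bT' aT]]; split; first exact: bounded_op_lin.
exists (fun x => c^* *: S' x + T' x); first exact: bounded_op_lin.
by move=> x y; rewrite hdotDl hdotDr hdotZl hdotZr aS aT conjCK.
Qed.

Fact op_ND S T : adjointable S -> adjointable T ->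
  opnorm (S + T) <= opnorm S + opnorm T.
Proof.
move=> aS aT; have [bS _] := aS; have [bT _] := aT.
have [bST _] := adjointable_lin 1 aS aT; rewrite scale1r in bST.
apply: opnorm_le; rewrite ?addr_ge0 ?opnorm_ge0 // => x.
by apply: le_trans (rnormD _ _) _; rewrite mulrDl lerD // opnormP.
Qed.

Fact op_NZ c T : adjointable T -> opnorm (c *: T) = cabs c * opnorm T.
Proof.
move=> aT; have [bT _] := aT.
have bZ d S : adjointable S -> bounded_op (d *: S).
  by move=> aS; have [] := adjointable_lin d aS adjointable0; rewrite addr0.
have le d S : adjointable S -> opnorm (d *: S) <= cabs d * opnorm S.
  move=> aS; apply: opnorm_le; first exact: bZ.
    by rewrite mulr_ge0 ?opnorm_ge0 //; case: aS.
  by move=> x; rewrite rnormZ -mulrA ler_wpM2l // opnormP //; case: aS.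
apply/eqP; rewrite eq_le le //=.
have [->|/eqP c0] := eqVneq c 0; first by rewrite cabs0 mul0r opnorm_ge0 //; apply: bZ.
have cp : 0 < cabs c by rewrite lt_def cabs_ge0 andbT; apply/eqP => /cabs0_eq.
have cc : cabs c^-1 = (cabs c)^-1.
  apply: (mulfI (lt0r_neq0 cp)); rewrite [RHS]mulfV ?lt0r_neq0 // -cabsM.
  by rewrite mulfV ?cabs1 //; apply/eqP.
(* The converse inequality is [le] for the scalar c^-1 and the operator c T. *)
rewrite -ler_pdivlMl // -cc; have := le c^-1 (c *: T).
rewrite scalerA mulVf ?scale1r; last exact/eqP.
by apply; have := adjointable_lin c aT adjointable0; rewrite addr0.
Qed.

Fact op_N0 T : adjointable T -> opnorm T = 0 -> T = 0.
Proof. by move=> [bT _] T0; apply/funext => x; apply: opnorm_eq0. Qed.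

Lemma opnorm_pointwise_limit (u : nat -> H -> H) T :
  (forall n, bounded_op (u n)) ->
  (forall x, slim (u^~ x) (T x)) -> forall e n0 x,
  (forall m n, (n0 <= m)%N -> (n0 <= n)%N -> forall x, rnorm (u m x - u n x) <= e * rnorm x) ->
  forall n, (n0 <= n)%N -> rnorm (u n x - T x) <= e * rnorm x.
Proof.
move=> bu lu e n0 x hu n nn; apply/ler_addgt0Pr => d /(lu x)[n1 h1].
apply: le_trans (rnorm_tri (u (maxn n0 n1) x) _ _) _.
by rewrite lerD ?hu ?leq_maxl // ltW // h1 // leq_maxr.
Qed.

Lemma slim_unique (W : normedModType R[i]) (u : nat -> W) l l' :
  slim u l -> slim u l' -> l = l'.
Proof.
move=> h h'; apply: rnorm_lt_eq => e e0.
have [n0 h0] := h _ (divr_gt0 e0 (ltr0Sn R 1)).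
have [n1 h1] := h' _ (divr_gt0 e0 (ltr0Sn R 1)).
apply: le_lt_trans (rnorm_tri (u (maxn n0 n1)) _ _) _.
by rewrite [e]splitr ltrD // ?h1 ?leq_maxr // rnormC h0 // leq_maxl.
Qed.

Lemma slim_lin (W : normedModType R[i]) (u v : nat -> W) c l l' :
  slim u l -> slim v l' -> slim (fun n => c *: u n + v n) (c *: l + l').
Proof.
move=> h h' e e0; have cp : 0 < cabs c + 1 by rewrite ltr_wpDl.
have [n0 h0] := h (e / 2 / (cabs c + 1)) ltac:(by rewrite !divr_gt0).
have [n1 h1] := h' _ (divr_gt0 e0 (ltr0Sn R 1)).
exists (maxn n0 n1) => n; rewrite geq_max => /andP[/h0 {}h0 /h1 {}h1].
rewrite opprD addrACA -scalerBr; apply: le_lt_trans (rnormD _ _) _.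
rewrite [e]splitr ltr_leD // ?(ltW h1) // rnormZ.
move: h0; rewrite ltr_pdivlMr //; have := rnorm_ge0 (u n - l); nra.
Qed.

(** The adjoints of a Cauchy sequence are again Cauchy, because passing to the adjoint does not
    increase the norm. Both sequences converge pointwise, and the limits are adjoint to each
    other. *)
Fact op_complete (u : nat -> H -> H) : (forall n, adjointable (u n)) ->
  (forall e : R, 0 < e -> exists n0, forall m n, (n0 <= m)%N -> (n0 <= n)%N ->
     opnorm (u m - u n) < e) ->
  exists2 l, adjointable l & forall e : R, 0 < e -> exists n0, forall n, (n0 <= n)%N ->
     opnorm (u n - l) < e.
Proof.
move=> au cu.
have bu n := (au n).1.
have [v /all_and2[bv av]] : {v : nat -> H -> H &
    forall n, bounded_op (v n) /\ adjoint_op (u n) (v n)}.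
  apply: (@choice _ _ (fun n T => bounded_op T /\ adjoint_op (u n) T)) => n.
    by have [_ [T bT aT]] := au n; exists T.
have bB S T : bounded_op S -> bounded_op T -> bounded_op (S - T).
  move=> bS bT; have := bounded_op_lin (-1) bT bS.
  by congr (bounded_op _); apply/funext => x; rewrite scaleN1r addrC.
have cau (e : R) : 0 < e -> exists n0, forall m n, (n0 <= m)%N -> (n0 <= n)%N ->
    forall x, rnorm (u m x - u n x) <= e * rnorm x /\ rnorm (v m x - v n x) <= e * rnorm x.
  move=> /cu[n0 h0]; exists n0 => m n hm hn x.
  have hle := ltW (h0 m n hm hn).
  have b1 := bB _ _ (bu m) (bu n); have b2 := bB _ _ (bv m) (bv n).
  split; first by apply: le_trans (opnormP x b1) _; rewrite ler_wpM2r.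
  apply: le_trans (opnormP x b2) _; rewrite ler_wpM2r //.
  apply: le_trans (adjoint_opnorm b1 b2 _) hle => y z /=.
  by rewrite hdotBl hdotBr !av.
have ptw (w : nat -> H -> H) : (forall n, bounded_op (w n)) ->
    (forall e : R, 0 < e -> exists n0, forall m n, (n0 <= m)%N -> (n0 <= n)%N ->
       forall x, rnorm (w m x - w n x) <= e * rnorm x) ->
    exists2 T, bounded_op T & forall x, slim (w^~ x) (T x).
  move=> bw hw.
  have [T hT] : {T : H -> H & forall x, slim (w^~ x) (T x)}.
    apply: (@choice _ _ (fun x l => slim (w^~ x) l)) => x; apply: (@seq_completeP R H) => e e0.
    have xp : 0 < rnorm x + 1 by rewrite ltr_wpDl.
    have [n0 h0] := hw (e / (rnorm x + 1)) ltac:(by rewrite divr_gt0).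
    exists n0 => m n hm hn; apply: le_lt_trans (h0 m n hm hn x) _.
    by rewrite mulrAC ltr_pdivrMr // ltr_pM2l // ltrDl.
  exists T => //; split.
    move=> c x y; apply: slim_unique (hT _) _.
    have := slim_lin c (hT x) (hT y); congr slim.
    by apply/funext => n; rewrite (bw n).1.
  have [n0 h0] := hw 1 ltr01; exists (1 + opnorm (w n0)) => x.
  have := opnorm_pointwise_limit bw hT x h0 (leqnn n0).
  have := rnorm_tri (w n0 x) (T x) 0; rewrite !subr0 rnormC.
  have := opnormP x (bw n0); lra.
have [e /cau[n0 h0]|T bT hT] := ptw u bu.
  by exists n0 => m n hm hn x; have [] := h0 m n hm hn x.
have [e /cau[n0 h0]|T' bT' hT'] := ptw v bv.
  by exists n0 => m n hm hn x; have [] := h0 m n hm hn x.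
have aT : adjoint_op T T'.
  move=> x y; apply: (@rnorm_lt_eq R R[i]^o) => e e0.
  have xp : 0 < rnorm x + 1 by rewrite ltr_wpDl.
  have yp : 0 < rnorm y + 1 by rewrite ltr_wpDl.
  have [n0 h0] := hT x (e / 2 / (rnorm y + 1)) ltac:(by rewrite !divr_gt0).
  have [n1 h1] := hT' y (e / 2 / (rnorm x + 1)) ltac:(by rewrite !divr_gt0).
  set n := maxn n0 n1.
  have := h0 n (leq_maxl _ _); have := h1 n (leq_maxr _ _).
  rewrite !ltr_pdivlMr // => b1 b2.
  apply: le_lt_trans (rnorm_tri (hdot (u n x) y) _ _) _.
  rewrite [X in _ + rnorm (X - _)]av -hdotBl -hdotBr.
  have c1 : rnorm (hdot (T x - u n x) y : R[i]^o) <= _ := cauchy_schwarz _ _.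
  have c2 : rnorm (hdot x (v n y - T' y) : R[i]^o) <= _ := cauchy_schwarz _ _.
  move: b1 b2 c1 c2; rewrite [rnorm (T x - _)]rnormC.
  have := rnorm_ge0 (u n x - T x); have := rnorm_ge0 (v n y - T' y); nra.
have adT : adjointable T by split => //; exists T'.
exists T => // e e0; have [n0 h0] := cau (e / 2) (divr_gt0 e0 (ltr0Sn R 1)).
exists n0 => n nn; apply: (@le_lt_trans _ _ (e / 2)); last by lra.
apply: opnorm_le; first exact: bB.
  by rewrite ltW // divr_gt0.
move=> x; apply: (opnorm_pointwise_limit (n0 := n0) bu hT) => // m k hm hk z.
by have [] := h0 m k hm hk z.
Qed.

Definition op_subBanach : subBanach R :=
  @SubBanach R (H -> H) adjointable (@opnorm R H)
    adjointable0 adjointable_lin op_ND op_NZ op_N0 op_complete.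

Definition opsort := sb_banach op_subBanach.
Implicit Types a b : opsort.

Definition opval a : H -> H := sbval a.

Lemma opval_bounded a : bounded_op (opval a). Proof. by case: (sbvalP a). Qed.

Fact op_mulP a b : adjointable (fun x => opval a (opval b x)).
Proof.
have [ba [a' ba' aa]] := sbvalP a; have [bb [b' bb' ab]] := sbvalP b.
split; first exact: bounded_op_comp.
exists (fun x => b' (a' x)); first exact: bounded_op_comp.
by move=> x y; rewrite aa ab.
Qed.

Definition opmul a b : opsort := @SB R op_subBanach _ (op_mulP a b).

Fact op_adj_ex a : exists T, bounded_op T /\ adjoint_op (opval a) T.
Proof. by have [_ [T bT aT]] := sbvalP a; exists T. Qed.

Fact op_starP a : adjointable (projT1 (cid (op_adj_ex a))).
Proof.
case: cid => T [bT aT] /=; split => //; exists (opval a); first exact: opval_bounded.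
exact: adjoint_sym.
Qed.

Definition opstar a : opsort := @SB R op_subBanach _ (op_starP a).

Lemma opval_adj a : adjoint_op (opval a) (opval (opstar a)).
Proof. by rewrite /opstar /opval /=; case: cid => T []. Qed.

Lemma opval_inj : injective opval. Proof. exact: sbval_inj. Qed.
Lemma opvalM a b x : opval (opmul a b) x = opval a (opval b x). Proof. by []. Qed.
Lemma opvalD a b x : opval (a + b) x = opval a x + opval b x. Proof. by []. Qed.
Lemma opvalZ c a x : opval (c *: a) x = c *: opval a x. Proof. by []. Qed.
Lemma opvalN a x : opval (- a) x = - opval a x. Proof. by []. Qed.
Lemma opval_norm a : opnorm (opval a) = rnorm a. Proof. by []. Qed.

Lemma opval_ext a b : (forall x, opval a x = opval b x) -> a = b.
Proof. by move=> h; apply/opval_inj/funext. Qed.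

Lemma opval_star_eq a b : adjoint_op (opval a) (opval b) -> opstar a = b.
Proof. by move=> h; apply/opval_inj/(adjoint_uniq (opval_adj a)). Qed.

Lemma op_rnormP a x : rnorm (opval a x) <= rnorm a * rnorm x.
Proof. exact/opnormP/opval_bounded. Qed.

Lemma op_rnorm_le a M : 0 <= M -> (forall x, rnorm (opval a x) <= M * rnorm x) ->
  rnorm a <= M.
Proof. exact/opnorm_le/opval_bounded. Qed.

Lemma op_rnorm_star a : rnorm (opstar a) = rnorm a.
Proof.
have ba := opval_bounded a; have bs := opval_bounded (opstar a).
have aa := opval_adj a.
by apply/eqP; rewrite eq_le !adjoint_opnorm //; apply: adjoint_sym.
Qed.

Fact opmulA a b c : opmul a (opmul b c) = opmul (opmul a b) c.
Proof. exact: opval_ext. Qed.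
Fact opmul_linl b : linear (opmul^~ b).
Proof. by move=> c x y; apply: opval_ext. Qed.
Fact opmul_linr a : linear (opmul a).
Proof. by move=> c x y; apply: opval_ext => z; apply: (opval_bounded a).1. Qed.
Fact opstarK : involutive opstar.
Proof. by move=> a; apply/opval_star_eq/adjoint_sym/opval_adj. Qed.
Fact opstar_antilin (c : R[i]) a b : opstar (c *: a + b) = c^* *: opstar a + opstar b.
Proof.
apply: opval_star_eq => x y.
by rewrite !opvalD !opvalZ hdotDl hdotDr hdotZl hdotZr !opval_adj conjCK.
Qed.
Fact opstarM a b : opstar (opmul a b) = opmul (opstar b) (opstar a).
Proof. by apply: opval_star_eq => x y; rewrite !opvalM !opval_adj. Qed.
Lemma op_rnormM a b : rnorm (opmul a b) <= rnorm a * rnorm b.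
Proof.
apply: op_rnorm_le; rewrite ?mulr_ge0 // => x; rewrite opvalM.
by apply: le_trans (op_rnormP _ _) _; rewrite -mulrA ler_wpM2l // op_rnormP.
Qed.
Fact op_normM a b : `|opmul a b| <= `|a| * `|b|.
Proof. by rewrite !rnormE -rmorphM /= lecR op_rnormM. Qed.
(** For the lower bound, |a x|^2 = <a* a x, x> <= |a* a| |x|^2 bounds the norm of a by the square
    root of |a* a|. *)
Fact op_normC a : `|opmul (opstar a) a| = `|a| ^+ 2.
Proof.
rewrite !rnormE -rmorphXn /=; congr (_%:C); apply/eqP; rewrite eq_le; apply/andP; split.
  by apply: le_trans (op_rnormM _ _) _; rewrite op_rnorm_star expr2.
have n0 := rnorm_ge0 (opmul (opstar a) a).
rewrite -[leRHS]sqr_sqrtr // ler_pXn2r ?nnegrE ?sqrtr_ge0 //.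
apply: op_rnorm_le => [|x]; first exact: sqrtr_ge0.
rewrite -(@ler_pXn2r _ 2) ?nnegrE ?mulr_ge0 ?sqrtr_ge0 // exprMn sqr_sqrtr //.
rewrite -[leLHS]ger0_norm ?sqr_ge0 // -cabsR -hdotxx opval_adj -opvalM.
by apply: le_trans (cauchy_schwarz _ _) _; rewrite mulrC expr2 mulrA ler_wpM2r // op_rnormP.
Qed.

Definition opalg : cstarAlg R :=
  @CstarAlg R opsort opmul opstar opmulA opmul_linl opmul_linr opstarK opstar_antilin
    opstarM op_normM op_normC.

End OperatorAlgebra.

(** * Unconditional sums *)

Section HasSum.
Variables (R : realType) (I : choiceType).
Implicit Types (W : normedModType R[i]) (A B : {fset I}).

Lemma sum_fsetD (V : zmodType) A B (F : I -> V) : (A `<=` B)%fset ->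
  \sum_(i <- B) F i = \sum_(i <- A) F i + \sum_(i <- (B `\` A)%fset) F i.
Proof.
move=> AB; rewrite (big_fsetID _ (mem A)) /=; congr (_ + _); apply: eq_fbigl => i.
  by rewrite !inE /=; have [iA|] := boolP (i \in A); rewrite ?andbT ?andbF ?(fsubsetP AB).
by rewrite !inE /= andbC.
Qed.

Lemma has_sum_lim W (F : I -> W) l : has_sum F l <-> forall e : R, 0 < e ->
  exists A, forall B, (A `<=` B)%fset -> rnorm (\sum_(i <- B) F i - l) < e.
Proof.
split=> h e /h[A hA]; exists A => B /hA; first by rewrite rnormC.
by rewrite rnormC.
Qed.

Lemma has_sum_unique W (F : I -> W) l m : has_sum F l -> has_sum F m -> l = m.
Proof.
move=> hl hm; apply: rnorm_lt_eq => e e0.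
have [A hA] := hl _ (divr_gt0 e0 (ltr0Sn R 1)).
have [B hB] := hm _ (divr_gt0 e0 (ltr0Sn R 1)).
apply: le_lt_trans (rnorm_tri (\sum_(i <- (A `|` B)%fset) F i) _ _) _.
by rewrite [e]splitr ltrD // ?hA ?fsubsetUl // rnormC hB // fsubsetUr.
Qed.

Lemma unc_sumP W (F : I -> W) l : has_sum F l -> unc_sum F = l.
Proof.
move=> hl; rewrite /unc_sum; case: xgetP => [m _ hm|h]; first exact: has_sum_unique hm hl.
by case: (h l).
Qed.

Lemma has_sum_lin W (F G : I -> W) c l m : has_sum F l -> has_sum G m ->
  has_sum (fun i => c *: F i + G i) (c *: l + m).
Proof.
move=> hl hm e e0; have cp : 0 < cabs c + 1 by rewrite ltr_wpDl.
have [A hA] := hl (e / 2 / (cabs c + 1)) ltac:(by rewrite !divr_gt0).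
have [B hB] := hm _ (divr_gt0 e0 (ltr0Sn R 1)).
exists (A `|` B)%fset => C; rewrite fsubUset => /andP[/hA {}hA /hB {}hB].
rewrite big_split /= -scaler_sumr opprD addrACA -scalerBr.
apply: le_lt_trans (rnormD _ _) _; rewrite [e]splitr ltr_leD // ?(ltW hB) // rnormZ.
by move: hA; rewrite ltr_pdivlMr //; have := rnorm_ge0 (l - \sum_(i <- C) F i); nra.
Qed.

(** Additivity is assumed instead of linearity because conjugation and [cs_star] are among the maps
    to which this is applied. *)
Lemma has_sum_map (W W' : normedModType R[i]) (T : W -> W') M (F : I -> W) l :
  (forall x y, T (x - y) = T x - T y) -> (forall x, rnorm (T x) <= M * rnorm x) ->
  has_sum F l -> has_sum (fun i => T (F i)) (T l).
Proof.
move=> TB bT hl e e0; have Mp : 0 < `|M| + 1 by rewrite ltr_wpDl.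
have [A hA] := hl (e / (`|M| + 1)) ltac:(by rewrite !divr_gt0).
have T0 : T 0 = 0 by have := TB 0 0; rewrite !subrr.
have TD x y : T (x + y) = T x + T y.
  have := TB (x + y) y; rewrite addrK => ->; by rewrite subrK.
exists A => B /hA; rewrite -(big_morph T TD T0) -TB ltr_pdivlMr //.
apply: le_lt_trans; apply: le_trans (bT _) _; rewrite mulrC ler_wpM2l //.
by rewrite (le_trans (ler_norm _)) // lerDl.
Qed.

Lemma has_sum_le W (F : I -> W) l M : has_sum F l ->
  (forall B, rnorm (\sum_(i <- B) F i) <= M) -> rnorm l <= M.
Proof.
move=> hl hM; apply/ler_addgt0Pr => e /hl[A hA].
have := hA A (fsubset_refl _); have := hM A; have := rnormB_ge l (\sum_(i <- A) F i); lra.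
Qed.

Lemma has_sum_fin W (F : I -> W) A : (forall i, i \notin A -> F i = 0) ->
  has_sum F (\sum_(i <- A) F i).
Proof.
move=> h e e0; exists A => B AB; rewrite -(big_fset_incl _ AB) ?subrr ?rnorm0 //.
by move=> i _; exact: h.
Qed.

Definition abs_bounded W (F : I -> W) M := forall B, \sum_(i <- B) rnorm (F i) <= M.

Lemma sum_fset_le (f : I -> R) A B : (forall i, 0 <= f i) -> (A `<=` B)%fset ->
  \sum_(i <- A) f i <= \sum_(i <- B) f i.
Proof. by move=> f0 AB; rewrite (sum_fsetD _ AB) lerDl sumr_ge0. Qed.

(** A finite set whose sum is within e of the supremum leaves less than e to every finite set
    disjoint from it. *)
Lemma abs_bounded_tail (f : I -> R) (M e : R) : (forall i, 0 <= f i) ->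
  (forall B, \sum_(i <- B) f i <= M) -> 0 < e ->
  exists A, forall B, [disjoint A & B]%fset -> \sum_(i <- B) f i < e.
Proof.
move=> f0 hM e0; pose S := [set \sum_(i <- B) f i | B in [set: {fset I}]].
have hS : has_sup S.
  by split; [exists (\sum_(i <- fset0) f i), fset0|exists M => _ [B _ <-]].
have [_ [A _ <-] hA] := sup_adherent e0 hS; exists A => B dAB.
have AB : (A `<=` A `|` B)%fset by rewrite fsubsetUl.
have := sup_upper_bound hS; move/(_ (\sum_(i <- (A `|` B)%fset) f i)) => h.
have {h} := h ltac:(by exists (A `|` B)%fset); rewrite (sum_fsetD _ AB).
have -> : ((A `|` B) `\` A = B)%fset.
  by rewrite fsetDUl fsetDv fset0U; apply/fsetDidPl; rewrite fdisjoint_sym.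
move: hA; lra.
Qed.

Lemma fdisjointDr A B : [disjoint A & B `\` A]%fset.
Proof. by apply/fdisjointP => i iA; rewrite inE iA. Qed.

(** Finite sets [A n] with tails below 1/(n+1) give a Cauchy sequence of partial sums: the sums over
    A m and A n are compared through the sum over the union. *)
Lemma has_sum_abs W (F : I -> W) M : seq_complete W -> abs_bounded F M ->
  exists l, has_sum F l.
Proof.
move=> cW hM.
have tail (e : R) : 0 < e -> exists A, forall B, (A `<=` B)%fset ->
    rnorm (\sum_(i <- B) F i - \sum_(i <- A) F i) < e.
  move=> e0; have [A hA] := @abs_bounded_tail (fun i => rnorm (F i)) M e (fun=> rnorm_ge0 _) hM e0.
  exists A => B AB; rewrite (sum_fsetD _ AB) addrAC subrr add0r.
  by apply: le_lt_trans (rnorm_sum _ _) _; apply/hA/fdisjointDr.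
have inv_small (e : R) : 0 < e -> exists n0, forall n, (n0 <= n)%N -> n.+1%:R^-1 < e :> R.
  move=> e0; exists (Num.truncn e^-1).+1 => n nn.
  rewrite invf_plt ?posrE // (lt_trans (truncnS_gt _)) // ltr_nat ltnS //.
have [A hA] := choice (fun n : nat => tail n.+1%:R^-1 ltac:(by rewrite invr_gt0)).
have meet m n : rnorm (\sum_(i <- A m) F i - \sum_(i <- A n) F i) < m.+1%:R^-1 + n.+1%:R^-1.
  apply: le_lt_trans (rnorm_tri (\sum_(i <- (A m `|` A n)%fset) F i) _ _) _.
  by rewrite ltrD ?hA ?fsubsetUr // rnormC hA ?fsubsetUl.
have [|l hl] := cW (fun n => \sum_(i <- A n) F i).
  move=> e e0; have [n0 h0] := inv_small _ (divr_gt0 e0 (ltr0Sn R 1)).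
  exists n0 => m n hm hn; apply: lt_trans (meet m n) _.
  by rewrite [e]splitr ltrD // h0.
exists l; apply/has_sum_lim => e e0.
have [n0 h0] := inv_small _ (divr_gt0 e0 (ltr0Sn R 1)).
have [n1 h1] := hl _ (divr_gt0 e0 (ltr0Sn R 1)).
exists (A (maxn n0 n1)) => B AB.
apply: le_lt_trans (rnorm_tri (\sum_(i <- A (maxn n0 n1)) F i) _ _) _.
rewrite [e]splitr ltrD // ?h1 ?leq_maxr //.
by apply: lt_trans (hA _ _ AB) (h0 _ _); rewrite leq_maxl.
Qed.

Lemma has_sum_ext W (F G : I -> W) l : F =1 G -> has_sum F l -> has_sum G l.
Proof. by move=> /funext ->. Qed.

Lemma has_sum_sup (f : I -> R) (M : R) : (forall i, 0 <= f i) ->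
  (forall B, \sum_(i <- B) f i <= M) ->
  has_sum (fun i => (f i)%:C : R[i]^o)
    (sup [set \sum_(i <- B) f i | B in [set: {fset I}]])%:C.
Proof.
move=> f0 hM; set S := [set _ | _ in _].
have hS : has_sup S.
  by split; [exists (\sum_(i <- fset0) f i), fset0|exists M => _ [B _ <-]].
move=> e e0; have [_ [A _ <-] hA] := sup_adherent e0 hS; exists A => B AB.
have := sup_upper_bound hS; move/(_ (\sum_(i <- B) f i)) => h.
have {h} := h ltac:(by exists B).
have := sum_fset_le f0 AB; rewrite -raddf_sum /= -raddfB /= [rnorm _]cabsR => h1 h2.
by rewrite ger0_norm; move: hA; lra.
Qed.

End HasSum.

Section MkHilbert.
Variables (R : realType) (W : completeNormedModType R[i]) (d : W -> W -> R[i]).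
Hypothesis dl : forall c x y z, d (c *: x + y) z = c * d x z + d y z.
Hypothesis dC : forall x y, d x y = (d y x)^*.
Hypothesis dn : forall x, d x x = `|x| ^+ 2.

(** A named copy of [d], to which the bilinear, hermitian and dot product structures can be
    attached. *)
Definition mkdot (x y : W) : R[i] := d x y.

Fact mkdot_bilin : bilinear_for
  (GRing.Scale.Law.clone _ _ ( *%R ) _) (GRing.Scale.Law.clone _ _ (Num.conj \; *%R) _) mkdot.
Proof.
split=> [z c x y|x c y z] /=; first exact: dl.
rewrite /mkdot dC dl rmorphD rmorphM; congr (_ + _); last by rewrite [RHS]dC.
by congr (_ * _); rewrite [RHS]dC.
Qed.
HB.instance Definition _ :=
  bilinear_isBilinear.Build R[i] W W R[i] _ _ mkdot mkdot_bilin.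
Fact mkdot_herm x y : mkdot x y = (-1) ^+ false * Num.conj (mkdot y x).
Proof. by rewrite expr0 mul1r; exact: dC. Qed.
HB.instance Definition _ :=
  isHermitianSesquilinear.Build R[i] W false Num.conj mkdot mkdot_herm.
Fact mkdot_pos x : x != 0 -> 0 < mkdot x x.
Proof. by move=> x0; rewrite /mkdot dn exprn_gt0 // normr_gt0. Qed.
HB.instance Definition _ := isDotProduct.Build R[i] W mkdot mkdot_pos.

Definition mkHilbert : hilbertType R := @HilbertType R W mkdot dn.

End MkHilbert.

(** * Closed subspaces and direct sums *)

Section ClosedSub.
Variables (R : realType) (W : completeNormedModType R[i]) (D : set W).
Hypothesis D0 : D 0.
Hypothesis DL : forall (c : R[i]) x y, D x -> D y -> D (c *: x + y).
Hypothesis Dcl : forall x, (forall e : R, 0 < e -> exists2 y, D y & rnorm (y - x) < e) -> D x.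

Fact closed_sub_complete (u : nat -> W) : (forall n, D (u n)) ->
  (forall e : R, 0 < e -> exists n0, forall m n, (n0 <= m)%N -> (n0 <= n)%N ->
     rnorm (u m - u n) < e) ->
  exists2 l, D l & forall e : R, 0 < e -> exists n0, forall n, (n0 <= n)%N ->
     rnorm (u n - l) < e.
Proof.
move=> Du cu; have [l hl] := seq_completeP cu; exists l => //.
by apply: Dcl => e /hl[n0 h0]; exists (u n0) => //; apply: h0.
Qed.

Definition closed_sub : subBanach R :=
  @SubBanach R W D (@rnorm R W) D0 DL (fun x y _ _ => rnormD x y)
    (fun c x _ => rnormZ c x) (fun x _ => @rnorm0_eq R W x) closed_sub_complete.

End ClosedSub.

Section SubHilbert.
Variables (R : realType) (H : hilbertType R) (D : set H).
Hypothesis D0 : D 0.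
Hypothesis DL : forall (c : R[i]) x y, D x -> D y -> D (c *: x + y).
Hypothesis Dcl : forall x, (forall e : R, 0 < e -> exists2 y, D y & rnorm (y - x) < e) -> D x.

Let W := sb_banach (closed_sub D0 DL Dcl).
Let dot (x y : W) : R[i] := hdot (sbval x : H) (sbval y : H).

Fact subhilbert_lin c (x y z : W) : dot (c *: x + y) z = c * dot x z + dot y z.
Proof. by rewrite /dot sbvalD sbvalZ hdotDl hdotZl. Qed.
Fact subhilbert_herm x y : dot x y = (dot y x)^*.
Proof. exact: hdotC. Qed.
Fact subhilbert_norm x : dot x x = `|x| ^+ 2.
Proof. by rewrite /dot hdotxx rnormE rmorphXn. Qed.

Definition subHilbert : hilbertType R :=
  mkHilbert subhilbert_lin subhilbert_herm subhilbert_norm.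

Definition subval (x : subHilbert) : H := sbval (x : W).

Lemma subvalP x : D (subval x). Proof. exact: (sbvalP (x : W)). Qed.
Definition insubH x (Dx : D x) : subHilbert := @SB R (closed_sub D0 DL Dcl) x Dx.
Lemma insubHK x (Dx : D x) : subval (insubH Dx) = x. Proof. by []. Qed.
Lemma subval_inj : injective subval. Proof. exact: sbval_inj. Qed.
Lemma subvalD x y : subval (x + y) = subval x + subval y. Proof. by []. Qed.
Lemma subvalZ c x : subval (c *: x) = c *: subval x. Proof. by []. Qed.
Lemma subvalB x y : subval (x - y) = subval x - subval y. Proof. by []. Qed.
Lemma subval_sum J (r : seq J) (F : J -> subHilbert) :
  subval (\sum_(i <- r) F i) = \sum_(i <- r) subval (F i).
Proof. by apply: (big_morph subval). Qed.
Lemma subval_norm x : rnorm (subval x) = rnorm x. Proof. by []. Qed.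
Lemma subval_dot x y : hdot (subval x) (subval y) = hdot x y. Proof. by []. Qed.

Variable T : H -> H.
Hypothesis bT : bounded_op T.
Hypothesis DT : forall x, D x -> D (T x).

Definition subop (x : subHilbert) : subHilbert := insubH (DT (subvalP x)).

Lemma subop_bounded : bounded_op subop.
Proof.
split; first by move=> c x y; apply: subval_inj; apply: bT.1.
by exists (opnorm T) => x; apply: (opnormP (subval x) bT).
Qed.

Lemma subop_opnorm : opnorm subop <= opnorm T.
Proof.
apply: opnorm_le; [exact: subop_bounded|exact: opnorm_ge0|move=> x].
exact: (opnormP (subval x) bT).
Qed.

End SubHilbert.

Section DirectSum.
Variables (R : realType) (I : choiceType) (H : I -> hilbertType R).

Definition dprod : Type := forall i, H i.
HB.instance Definition _ := gen_eqMixin dprod.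
HB.instance Definition _ := gen_choiceMixin dprod.

Definition dprod_zero : dprod := fun i => 0.
Definition dprod_add (x y : dprod) : dprod := fun i => x i + y i.
Definition dprod_opp (x : dprod) : dprod := fun i => - x i.
Definition dprod_scale (c : R[i]) (x : dprod) : dprod := fun i => c *: x i.

Fact dprod_addA : associative dprod_add.
Proof. by move=> x y z; apply/functional_extensionality_dep => i; apply: addrA. Qed.
Fact dprod_addC : commutative dprod_add.
Proof. by move=> x y; apply/functional_extensionality_dep => i; apply: addrC. Qed.
Fact dprod_add0 : left_id dprod_zero dprod_add.
Proof. by move=> x; apply/functional_extensionality_dep => i; apply: add0r. Qed.
Fact dprod_addN : left_inverse dprod_zero dprod_opp dprod_add.
Proof. by move=> x; apply/functional_extensionality_dep => i; apply: addNr. Qed.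

HB.instance Definition _ :=
  GRing.isZmodule.Build dprod dprod_addA dprod_addC dprod_add0 dprod_addN.

Fact dprod_scaleA c d x : dprod_scale c (dprod_scale d x) = dprod_scale (c * d) x.
Proof. by apply/functional_extensionality_dep => i; apply: scalerA. Qed.
Fact dprod_scale1 : left_id 1 dprod_scale.
Proof. by move=> x; apply/functional_extensionality_dep => i; apply: scale1r. Qed.
Fact dprod_scaleDr : right_distributive dprod_scale +%R.
Proof. by move=> c x y; apply/functional_extensionality_dep => i; apply: scalerDr. Qed.
Fact dprod_scaleDl x : {morph dprod_scale^~ x : c d / c + d}.
Proof. by move=> c d; apply/functional_extensionality_dep => i; apply: scalerDl. Qed.

HB.instance Definition _ := GRing.Zmodule_isLmodule.Build R[i] dprod
  dprod_scaleA dprod_scale1 dprod_scaleDr dprod_scaleDl.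

Implicit Types (x y z : dprod) (B : {fset I}).

Lemma dprodZ c x i : (c *: x) i = c *: x i. Proof. by []. Qed.
Lemma dprodB x y i : (x - y) i = x i - y i. Proof. by []. Qed.

Definition l2bound x (M : R) := forall B, \sum_(i <- B) rnorm (x i) ^+ 2 <= M.
Definition l2 : set dprod := [set x | exists M, l2bound x M].
Definition l2sq x : R := sup [set \sum_(i <- B) rnorm (x i) ^+ 2 | B in [set: {fset I}]].
Definition l2norm x : R := Num.sqrt (l2sq x).

Fact l2_hassup x : l2 x -> has_sup [set \sum_(i <- B) rnorm (x i) ^+ 2 | B in [set: {fset I}]].
Proof.
move=> [M hM]; split; first by exists (\sum_(i <- fset0) rnorm (x i) ^+ 2), fset0.
by exists M => _ [B _ <-].
Qed.

Fact l2sq_ub x B : l2 x -> \sum_(i <- B) rnorm (x i) ^+ 2 <= l2sq x.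
Proof. by move=> /l2_hassup/sup_upper_bound; apply; exists B. Qed.

Fact l2sq_le x M : l2bound x M -> l2sq x <= M.
Proof.
move=> hM; apply: ge_sup; first by exists (\sum_(i <- fset0) rnorm (x i) ^+ 2), fset0.
by move=> _ [B _ <-].
Qed.

Fact l2sq_ge0 x : l2 x -> 0 <= l2sq x.
Proof. by move=> /(l2sq_ub fset0); rewrite big_seq_fset0. Qed.

Fact l2norm_sq x : l2 x -> l2norm x ^+ 2 = l2sq x.
Proof. by move=> /l2sq_ge0 h; rewrite sqr_sqrtr. Qed.

Fact l2norm_ge0 x : 0 <= l2norm x.
Proof. exact: sqrtr_ge0. Qed.

Fact l2norm_le x M : 0 <= M -> l2bound x (M ^+ 2) -> l2norm x <= M.
Proof.
move=> M0 /l2sq_le h; rewrite -[M]ger0_norm // -sqrtr_sqr ler_wsqrtr //.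
Qed.

Fact l2norm_coord x i : l2 x -> rnorm (x i) <= l2norm x.
Proof.
move=> lx; rewrite -(@ler_pXn2r _ 2) ?nnegrE ?l2norm_ge0 // l2norm_sq //.
by have := l2sq_ub [fset i]%fset lx; rewrite big_seq_fset1.
Qed.

Fact l2_0 : l2 0.
Proof. by exists 0 => B; rewrite big1 // => i _; rewrite rnorm0 expr0n. Qed.

(** Coordinatewise, the right side exceeds (a + b)^2 by (t a - s b)^2 / (s t). The free weights s, t
    are what makes the triangle inequality come out sharp later. *)
Fact l2_boundD x y (s t : R) : l2 x -> l2 y -> 0 < s -> 0 < t ->
  l2bound (x + y) ((1 + t / s) * l2sq x + (1 + s / t) * l2sq y).
Proof.
move=> lx ly s0 t0 B.
have h i : rnorm ((x + y) i) ^+ 2 <=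
    (1 + t / s) * rnorm (x i) ^+ 2 + (1 + s / t) * rnorm (y i) ^+ 2.
  apply: (@le_trans _ _ ((rnorm (x i) + rnorm (y i)) ^+ 2)).
    by rewrite ler_pXn2r ?nnegrE ?addr_ge0 ?rnorm_ge0 // rnormD.
  rewrite -subr_ge0; set a := rnorm _; set b := rnorm _.
  have -> : (1 + t / s) * a ^+ 2 + (1 + s / t) * b ^+ 2 - (a + b) ^+ 2 =
     (t * a - s * b) ^+ 2 / (s * t) by field; rewrite !lt0r_neq0.
  by rewrite mulr_ge0 ?sqr_ge0 // invr_ge0 mulr_ge0 ?ltW.
apply: (le_trans (ler_sum _ (fun i _ => h i))).
rewrite big_split /= -!mulr_sumr lerD // ler_wpM2l ?l2sq_ub //.
  by rewrite addr_ge0 // divr_ge0 // ltW.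
by rewrite addr_ge0 // divr_ge0 // ltW.
Qed.

Fact l2_D x y : l2 x -> l2 y -> l2 (x + y).
Proof. by move=> lx ly; eexists; apply: (l2_boundD lx ly ltr01 ltr01). Qed.

Fact l2_Zbound c x M : l2bound x M -> l2bound (c *: x) (cabs c ^+ 2 * M).
Proof.
move=> hM B; under eq_bigr do rewrite dprodZ rnormZ exprMn.
by rewrite -mulr_sumr ler_wpM2l // sqr_ge0.
Qed.

Fact l2_Z c x : l2 x -> l2 (c *: x).
Proof. by move=> [M hM]; eexists; apply: l2_Zbound hM. Qed.

Fact l2_lin c x y : l2 x -> l2 y -> l2 (c *: x + y).
Proof. by move=> lx ly; apply: l2_D => //; apply: l2_Z. Qed.

Fact l2_N0 x : l2 x -> l2norm x = 0 -> x = 0.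
Proof.
move=> lx x0; apply/functional_extensionality_dep => i; apply/rnorm0_eq/eqP.
by rewrite eq_le rnorm_ge0 andbT -x0 l2norm_coord.
Qed.

Fact l2_ND x y : l2 x -> l2 y -> l2norm (x + y) <= l2norm x + l2norm y.
Proof.
move=> lx ly.
have [x0|/eqP x0] := eqVneq (l2norm x) 0.
  by rewrite x0 (l2_N0 lx x0) !add0r.
have [y0|/eqP y0] := eqVneq (l2norm y) 0.
  by rewrite y0 (l2_N0 ly y0) !addr0.
have xp : 0 < l2norm x by rewrite lt_def l2norm_ge0 andbT; apply/eqP.
have yp : 0 < l2norm y by rewrite lt_def l2norm_ge0 andbT; apply/eqP.
apply: l2norm_le; first by rewrite addr_ge0 ?l2norm_ge0.
(* With s = |x| and t = |y| the bound is exactly (|x| + |y|)^2. *)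
have := l2_boundD lx ly xp yp; rewrite -!l2norm_sq //; congr l2bound.
by field; apply/andP; split; apply/eqP.
Qed.

Fact l2_NZ c x : l2 x -> l2norm (c *: x) = cabs c * l2norm x.
Proof.
have le d z : l2 z -> l2norm (d *: z) <= cabs d * l2norm z.
  move=> lz; apply: l2norm_le; first by rewrite mulr_ge0 ?l2norm_ge0.
  by rewrite exprMn l2norm_sq //; apply: l2_Zbound => B; apply: l2sq_ub.
move=> lx; apply/eqP; rewrite eq_le le //=.
have [->|/eqP c0] := eqVneq c 0; first by rewrite cabs0 mul0r l2norm_ge0.
have cp : 0 < cabs c by rewrite lt_def cabs_ge0 andbT; apply/eqP => /cabs0_eq.
have cc : cabs c^-1 = (cabs c)^-1.
  apply: (mulfI (lt0r_neq0 cp)); rewrite [RHS]mulfV ?lt0r_neq0 // -cabsM.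
  by rewrite mulfV ?cabs1 //; apply/eqP.
rewrite -ler_pdivlMl // -cc; have := le c^-1 (c *: x).
rewrite scalerA mulVf ?scale1r; last exact/eqP.
by apply; apply: l2_Z.
Qed.

Fact l2_compl (u : nat -> dprod) : (forall n, l2 (u n)) ->
  (forall e : R, 0 < e -> exists n0, forall m n, (n0 <= m)%N -> (n0 <= n)%N ->
     l2norm (u m - u n) < e) ->
  exists2 l, l2 l & forall e : R, 0 < e -> exists n0, forall n, (n0 <= n)%N ->
     l2norm (u n - l) < e.
Proof.
move=> lu cu.
have lB x y : l2 x -> l2 y -> l2 (x - y).
  by move=> lx ly; apply: l2_D => //; rewrite -scaleN1r; apply: l2_Z.
have ex i : exists l, slim (fun n => u n i) l.
  apply: (@seq_completeP R (H i)) => e /cu[n0 h0]; exists n0 => m n hm hn.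
  apply: le_lt_trans (h0 m n hm hn); rewrite -dprodB l2norm_coord //; exact: lB.
have hl i := projT2 (cid (ex i)); set l : dprod := fun i => projT1 (cid (ex i)).
have key (e : R) n0 : 0 < e -> (forall m n, (n0 <= m)%N -> (n0 <= n)%N ->
     l2norm (u m - u n) < e) -> forall n, (n0 <= n)%N -> l2bound (u n - l) (e ^+ 2).
  move=> e0 h0 n hn B; apply/ler_addgt0Pr => d d0.
  (* On the finite set B only finitely many coordinates have to be near their limits, so the bound
     for u n - u m passes to u n - l at a cost of d. *)
  have lim : exists n1, forall m, (n1 <= m)%N ->
      \sum_(i <- B) rnorm ((u n - l) i) ^+ 2 <=
      \sum_(i <- B) rnorm ((u n - u m) i) ^+ 2 + d.
    elim: (enum_fset B) d d0 => [|i s IH] d d0.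
      by exists 0%N => m _; rewrite !big_nil add0r ltW.
    have [n1 h1] := IH _ (divr_gt0 d0 (ltr0Sn R 1)).
    set a := rnorm ((u n - l) i).
    have ap : 0 < 2 * a + 1 by have := rnorm_ge0 ((u n - l) i); rewrite -/a; lra.
    (* Below, a <= b + c; if b < a then a^2 - b^2 <= c (2 a), which this tolerance for c keeps below
       d / 2. *)
    have [n2 h2] := hl i (d / 2 / (2 * a + 1)) ltac:(by rewrite !divr_gt0).
    exists (maxn n1 n2) => m; rewrite geq_max => /andP[/h1 {}h1 /h2 {}h2].
    rewrite !big_cons; move: h1 h2; rewrite ltr_pdivlMr //.
    have := rnorm_tri (u m i) (u n i) (l i).
    rewrite -!dprodB -/a; set b := rnorm ((u n - u m) i); set c := rnorm _.
    have a0 : 0 <= a := rnorm_ge0 _.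
    have b0 : 0 <= b := rnorm_ge0 _.
    have c0 : 0 <= c := rnorm_ge0 _.
    move=> tri; set s1 := \sum_(i0 <- s) _; set s2 := \sum_(i0 <- s) _.
    move=> h1 h2; have : a ^+ 2 <= b ^+ 2 + d / 2; last by lra.
    have [ab|ab] := leP a b; first by nra.
    have : a ^+ 2 - b ^+ 2 <= c * (2 * a) by nra.
    nra.
  have [n1 h1] := lim; apply: le_trans (h1 (maxn n0 n1) (leq_maxr _ _)) _.
  rewrite lerD2r; have lum := lB _ _ (lu n) (lu (maxn n0 n1)).
  apply: le_trans (l2sq_ub _ lum) _; rewrite -l2norm_sq //.
  by rewrite ler_pXn2r ?nnegrE ?l2norm_ge0 ?ltW // h0 // leq_maxl.
exists l.
  have [n0 h0] := cu 1 ltr01; have hb := key 1 n0 ltr01 h0 n0 (leqnn _).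
  have -> : l = u n0 - (u n0 - l) by rewrite opprB addrC subrK.
  by apply: lB => //; exists (1 ^+ 2).
move=> e e0; have [n0 h0] := cu _ (divr_gt0 e0 (ltr0Sn R 1)).
exists n0 => n hn; apply: (@le_lt_trans _ _ (e / 2)); last by lra.
by apply: l2norm_le; [rewrite ltW // divr_gt0|apply: key h0 n hn; rewrite divr_gt0].
Qed.

Definition l2_subBanach : subBanach R :=
  @SubBanach R dprod l2 l2norm l2_0 l2_lin l2_ND l2_NZ l2_N0 l2_compl.

Let W := sb_banach l2_subBanach.
Let dot (x y : W) : R[i] := unc_sum (fun i => hdot (sbval x i) (sbval y i) : R[i]^o).

Fact dsum_dot_sum (x y : W) :
  has_sum (fun i => hdot (sbval x i) (sbval y i) : R[i]^o) (dot x y).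
Proof.
have [l hl] : exists l, has_sum (fun i => hdot (sbval x i) (sbval y i) : R[i]^o) l.
  apply: (@has_sum_abs _ _ _ _ (l2sq (sbval x) + l2sq (sbval y))); first exact: seq_completeC.
  move=> B; have := l2sq_ub B (sbvalP x); have := l2sq_ub B (sbvalP y).
  move=> hy hx; apply: le_trans (lerD hx hy); rewrite -big_split /= ler_sum // => i _.
  apply: le_trans (cauchy_schwarz _ _) _.
  by have := rnorm_ge0 (sbval x i); have := rnorm_ge0 (sbval y i); nra.
by rewrite /dot (unc_sumP hl).
Qed.

Fact dsum_lin c (x y z : W) : dot (c *: x + y) z = c * dot x z + dot y z.
Proof.
apply: (@unc_sumP R I R[i]^o); have := has_sum_lin c (dsum_dot_sum x z) (dsum_dot_sum y z).
by apply: has_sum_ext => i; rewrite sbvalD sbvalZ hdotDl hdotZl.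
Qed.
Fact dsum_herm (x y : W) : dot x y = (dot y x)^*.
Proof.
apply: (@unc_sumP R I R[i]^o).
have := @has_sum_map _ _ R[i]^o R[i]^o Num.conj 1 _ _ _ _ (dsum_dot_sum y x).
move=> h; apply: has_sum_ext (h _ _) => [i|c d|c]; first by rewrite -hdotC.
  exact: rmorphB.
by rewrite mul1r [leLHS]cabsJ.
Qed.
Fact dsum_norm (x : W) : dot x x = `|x| ^+ 2.
Proof.
rewrite rnormE -rmorphXn sb_rnormE /= l2norm_sq; last by apply: (sbvalP x).
apply: (@unc_sumP R I R[i]^o).
have h1 i : 0 <= rnorm (sbval x i) ^+ 2 by apply: sqr_ge0.
have h2 B : \sum_(i <- B) rnorm (sbval x i) ^+ 2 <= l2sq (sbval x).
  exact: l2sq_ub (sbvalP x).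
by apply: has_sum_ext (has_sum_sup h1 h2) => i; rewrite hdotxx.
Qed.

Definition dsum : hilbertType R := mkHilbert dsum_lin dsum_herm dsum_norm.

Definition dsval (x : dsum) : forall i, H i := sbval (x : W).

Lemma dsval_inj : injective dsval. Proof. exact: sbval_inj. Qed.
Lemma dsvalD (x y : dsum) i : dsval (x + y) i = dsval x i + dsval y i. Proof. by []. Qed.
Lemma dsvalZ c (x : dsum) i : dsval (c *: x) i = c *: dsval x i. Proof. by []. Qed.
Lemma dsvalB (x y : dsum) i : dsval (x - y) i = dsval x i - dsval y i. Proof. by []. Qed.
Lemma dsval_sum J (r : seq J) (F : J -> dsum) i :
  dsval (\sum_(j <- r) F j) i = \sum_(j <- r) dsval (F j) i.
Proof. by elim: r => [|j r IH]; rewrite ?big_nil // !big_cons dsvalD IH. Qed.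
Lemma dsval_dot (x y : dsum) : has_sum (fun i => hdot (dsval x i) (dsval y i) : R[i]^o) (hdot x y).
Proof. exact: dsum_dot_sum. Qed.
Lemma dsval_ext (x y : dsum) : (forall i, dsval x i = dsval y i) -> x = y.
Proof. by move=> h; apply/dsval_inj/functional_extensionality_dep. Qed.
Lemma dsval_norm (x : dsum) : rnorm x = l2norm (dsval x). Proof. by []. Qed.
Lemma dsval_l2 (x : dsum) : l2 (dsval x). Proof. exact: (sbvalP (x : W)). Qed.
Definition mkds (x : dprod) (lx : l2 x) : dsum := @SB R l2_subBanach x lx.
Lemma mkdsE (x : dprod) (lx : l2 x) i : dsval (@mkds x lx) i = x i. Proof. by []. Qed.

Variables (T : forall i, H i -> H i) (M : R).
Hypothesis bT : forall i, bounded_op (@T i).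
Hypothesis M0 : 0 <= M.
Hypothesis TM : forall i, opnorm (@T i) <= M.

Fact dsop_bound (x : dsum) : l2bound (fun i => T (dsval x i)) ((M * rnorm x) ^+ 2).
Proof.
move=> B; rewrite exprMn dsval_norm l2norm_sq; last exact: dsval_l2.
have h i : rnorm (T (dsval x i)) ^+ 2 <= M ^+ 2 * rnorm (dsval x i) ^+ 2.
  rewrite -exprMn ler_pXn2r ?nnegrE ?mulr_ge0 ?rnorm_ge0 //.
  by apply: le_trans (opnormP _ (bT i)) _; rewrite ler_wpM2r.
apply: (le_trans (ler_sum _ (fun i _ => h i))).
by rewrite -mulr_sumr ler_wpM2l ?sqr_ge0 // l2sq_ub //; apply: dsval_l2.
Qed.

Definition dsop (x : dsum) : dsum := mkds (ex_intro _ _ (dsop_bound x)).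

Lemma dsopE (x : dsum) i : dsval (dsop x) i = T (dsval x i). Proof. by []. Qed.

Lemma dsop_le (x : dsum) : rnorm (dsop x) <= M * rnorm x.
Proof. by apply: l2norm_le; [rewrite mulr_ge0|apply: dsop_bound]. Qed.

Lemma dsop_bounded : bounded_op dsop.
Proof.
split; first by move=> c x y; apply: dsval_ext => i; rewrite dsopE dsvalD dsvalZ; apply: (bT i).1.
by exists M; apply: dsop_le.
Qed.

End DirectSum.

(** * C*-algebras generated by the inverse semigroup *)

Section SubCstar.
Variables (R : realType) (A : cstarAlg R) (D : set A).
Hypothesis D0 : D 0.
Hypothesis DL : forall (c : R[i]) x y, D x -> D y -> D (c *: x + y).
Hypothesis Dcl : forall x, (forall e : R, 0 < e -> exists2 y, D y & rnorm (y - x) < e) -> D x.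
Hypothesis DM : forall x y, D x -> D y -> D (cs_mul x y).
Hypothesis DS : forall x, D x -> D (cs_star x).

Let S := sb_banach (closed_sub D0 DL Dcl).

Definition scs_mul (x y : S) : S := @SB R (closed_sub D0 DL Dcl) _ (DM (sbvalP x) (sbvalP y)).
Definition scs_star (x : S) : S := @SB R (closed_sub D0 DL Dcl) _ (DS (sbvalP x)).

Fact scs_mulA a b c : scs_mul a (scs_mul b c) = scs_mul (scs_mul a b) c.
Proof. by apply: sbval_inj; apply: cs_mulA. Qed.
Fact scs_linl b : linear (scs_mul^~ b).
Proof. by move=> c x y; apply: sbval_inj; apply: cs_mul_linl. Qed.
Fact scs_linr a : linear (scs_mul a).
Proof. by move=> c x y; apply: sbval_inj; apply: cs_mul_linr. Qed.
Fact scs_starK : involutive scs_star.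
Proof. by move=> x; apply: sbval_inj; apply: cs_starK. Qed.
Fact scs_antilin (c : R[i]) a b : scs_star (c *: a + b) = c^* *: scs_star a + scs_star b.
Proof. by apply: sbval_inj; apply: cs_star_antilin. Qed.
Fact scs_starM a b : scs_star (scs_mul a b) = scs_mul (scs_star b) (scs_star a).
Proof. by apply: sbval_inj; apply: cs_starM. Qed.
Fact scs_normM a b : `|scs_mul a b| <= `|a| * `|b|.
Proof. by have := cs_normM (sbval a : A) (sbval b : A); rewrite !rnormE. Qed.
Fact scs_normC a : `|scs_mul (scs_star a) a| = `|a| ^+ 2.
Proof. by have := cs_normC (sbval a : A); rewrite !rnormE. Qed.

Definition subCstar : cstarAlg R := @CstarAlg R S scs_mul scs_star scs_mulA scs_linl
  scs_linr scs_starK scs_antilin scs_starM scs_normM scs_normC.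

Definition scval (x : subCstar) : A := sbval (x : S).
Definition mksc (x : A) (Dx : D x) : subCstar := @SB R (closed_sub D0 DL Dcl) x Dx.
Lemma scval_inj : injective scval. Proof. exact: sbval_inj. Qed.
Lemma scvalD x y : scval (x + y) = scval x + scval y. Proof. by []. Qed.
Lemma scvalZ c x : scval (c *: x) = c *: scval x. Proof. by []. Qed.
Lemma scvalB x y : scval (x - y) = scval x - scval y. Proof. by []. Qed.
Lemma scval_norm x : rnorm (scval x) = rnorm x. Proof. by []. Qed.
Lemma scvalP x : D (scval x). Proof. exact: (sbvalP (x : S)). Qed.
End SubCstar.

Section CstarBasics.
Variables (R : realType) (A : cstarAlg R).
Implicit Types a b c : A.

Lemma cs_mulDl a b c : cs_mul (a + b) c = cs_mul a c + cs_mul b c.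
Proof. by have := cs_mul_linl c 1 a b; rewrite !scale1r. Qed.
Lemma cs_mulDr a b c : cs_mul c (a + b) = cs_mul c a + cs_mul c b.
Proof. by have := cs_mul_linr c 1 a b; rewrite !scale1r. Qed.
Lemma cs_mul0l a : cs_mul 0 a = 0.
Proof. by have := cs_mul_linl a (-1) 0 0; rewrite scaler0 addr0 scaleN1r addNr. Qed.
Lemma cs_mul0r a : cs_mul a 0 = 0.
Proof. by have := cs_mul_linr a (-1) 0 0; rewrite scaler0 addr0 scaleN1r addNr. Qed.
Lemma cs_mulZl k a b : cs_mul (k *: a) b = k *: cs_mul a b.
Proof. by have := cs_mul_linl b k a 0; rewrite cs_mul0l !addr0. Qed.
Lemma cs_mulZr k a b : cs_mul a (k *: b) = k *: cs_mul a b.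
Proof. by have := cs_mul_linr a k b 0; rewrite cs_mul0r !addr0. Qed.
Lemma cs_mulNl a b : cs_mul (- a) b = - cs_mul a b.
Proof. by rewrite -scaleN1r cs_mulZl scaleN1r. Qed.
Lemma cs_mulNr a b : cs_mul a (- b) = - cs_mul a b.
Proof. by rewrite -scaleN1r cs_mulZr scaleN1r. Qed.
Lemma cs_mulBl a b c : cs_mul (a - b) c = cs_mul a c - cs_mul b c.
Proof. by rewrite cs_mulDl cs_mulNl. Qed.
Lemma cs_mulBr a b c : cs_mul c (a - b) = cs_mul c a - cs_mul c b.
Proof. by rewrite cs_mulDr cs_mulNr. Qed.
Lemma cs_starD a b : cs_star (a + b) = cs_star a + cs_star b.
Proof. by have := cs_star_antilin 1 a b; rewrite rmorph1 !scale1r. Qed.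
Lemma cs_star0 : cs_star (0 : A) = 0.
Proof.
by have := cs_star_antilin (-1) 0 (0 : A); rewrite scaler0 addr0 rmorphN1 scaleN1r addNr.
Qed.
Lemma cs_starZ k a : cs_star (k *: a) = k^* *: cs_star a.
Proof. by have := cs_star_antilin k a 0; rewrite cs_star0 !addr0. Qed.
Lemma cs_starN a : cs_star (- a) = - cs_star a.
Proof. by rewrite -scaleN1r cs_starZ rmorphN1 scaleN1r. Qed.
Lemma cs_starB a b : cs_star (a - b) = cs_star a - cs_star b.
Proof. by rewrite cs_starD cs_starN. Qed.
Lemma cs_mul_suml I (r : seq I) (F : I -> A) b :
  cs_mul (\sum_(i <- r) F i) b = \sum_(i <- r) cs_mul (F i) b.
Proof.
by apply: (big_morph (fun x => cs_mul x b)) => [x y|]; rewrite ?cs_mulDl ?cs_mul0l.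
Qed.
Lemma cs_mul_sumr I (r : seq I) (F : I -> A) b :
  cs_mul b (\sum_(i <- r) F i) = \sum_(i <- r) cs_mul b (F i).
Proof.
by apply: (big_morph (fun x => cs_mul b x)) => [x y|]; rewrite ?cs_mulDr ?cs_mul0r.
Qed.
Lemma cs_rnormM a b : rnorm (cs_mul a b) <= rnorm a * rnorm b.
Proof. by have := cs_normM a b; rewrite !rnormE -rmorphM lecR. Qed.
Lemma cs_rnormC a : rnorm (cs_mul (cs_star a) a) = rnorm a ^+ 2.
Proof. by apply: complexI; rewrite rmorphXn /= -!rnormE cs_normC. Qed.
Lemma cs_rnorm_star a : rnorm (cs_star a) = rnorm a.
Proof.
have le b : rnorm b <= rnorm (cs_star b).
  have [->|/eqP b0] := eqVneq (rnorm b) 0; first exact: rnorm_ge0.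
  have bp : 0 < rnorm b by rewrite lt_def rnorm_ge0 andbT; apply/eqP.
  by rewrite -(ler_pM2r bp) -expr2 -cs_rnormC cs_rnormM.
by apply/eqP; rewrite eq_le le -{2}(cs_starK a) le.
Qed.

End CstarBasics.

(* [P e w] reads "w is an approximation of precision e". *)
Lemma approx_limit (R : realType) (W : normedModType R[i]) (P : R -> W -> Prop) (K : R) :
  seq_complete W -> 0 <= K ->
  (forall e : R, 0 < e -> exists w, P e w) ->
  (forall (d e : R) w w', 0 < d -> 0 < e -> P d w -> P e w' -> rnorm (w - w') <= K * (d + e)) ->
  exists l, forall (e : R) w, 0 < e -> P e w -> rnorm (w - l) <= K * e.
Proof.
move=> cW K0 ex hP.
have ip n : 0 < n.+1%:R^-1 :> R by rewrite invr_gt0.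
have inv_small (e : R) : 0 < e -> exists n0, forall n, (n0 <= n)%N -> K * n.+1%:R^-1 < e :> R.
  move=> e0; have Kp : 0 < K + 1 by rewrite ltr_wpDl.
  exists (Num.truncn (e / (K + 1))^-1).+1 => n nn.
  have : n.+1%:R^-1 < e / (K + 1).
    by rewrite invf_plt ?posrE ?divr_gt0 // (lt_trans (truncnS_gt _)) // ltr_nat ltnS.
  rewrite ltr_pdivlMr //; have := ip n; set t := _^-1; nra.
have [w hw] := choice (fun n : nat => ex n.+1%:R^-1 (ip n)).
have [|l hl] := cW w.
  move=> e e0; have [n0 h0] := inv_small _ (divr_gt0 e0 (ltr0Sn R 1)).
  exists n0 => m n hm hn; apply: (le_lt_trans (hP _ _ _ _ (ip _) (ip _) (hw m) (hw n))).
  by rewrite mulrDr [e]splitr ltrD // h0.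
exists l => e v e0 hv; apply/ler_addgt0Pr => d d0.
have [n0 h0] := inv_small _ (divr_gt0 d0 (ltr0Sn R 1)).
have [n1 h1] := hl _ (divr_gt0 d0 (ltr0Sn R 1)).
set n := maxn n0 n1.
have := h0 n (leq_maxl _ _); have := h1 n (leq_maxr _ _).
have := hP _ _ _ _ e0 (ip _) hv (hw n); have := rnorm_tri (w n) v l.
set t := _^-1; rewrite mulrDr; lra.
Qed.

Section Families.
Variables (R : realType) (E : digraph).

(** Formal linear combinations, repetitions allowed. One list can be evaluated by [lin] in every
    algebra, so that norms in different algebras can be compared. *)
Definition comb := seq (R[i] * gis E).
Implicit Types (cs ds : comb) (s t : gis E).

Definition lin (V : lmodType R[i]) (u : gis E -> V) cs : V := \sum_(p <- cs) p.1 *: u p.2.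
Definition comb_scale (c : R[i]) cs : comb := [seq (c * p.1, p.2) | p <- cs].
Definition comb_mul cs ds : comb := [seq (p.1 * q.1, gis_mul p.2 q.2) | p <- cs, q <- ds].
Definition comb_star cs : comb := [seq (p.1^*, gis_star p.2) | p <- cs].

Section LinLmod.
Variables (V : lmodType R[i]) (u : gis E -> V).
Lemma lin_nil : lin u [::] = 0. Proof. exact: big_nil. Qed.
Lemma lin_cons p cs : lin u (p :: cs) = p.1 *: u p.2 + lin u cs. Proof. exact: big_cons. Qed.
Lemma lin_cat cs ds : lin u (cs ++ ds) = lin u cs + lin u ds. Proof. exact: big_cat. Qed.
Lemma lin_scale c cs : lin u (comb_scale c cs) = c *: lin u cs.
Proof. by rewrite /lin big_map scaler_sumr; apply: eq_bigr => p _; rewrite scalerA. Qed.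
Lemma lin_sub cs ds : lin u (cs ++ comb_scale (-1) ds) = lin u cs - lin u ds.
Proof. by rewrite lin_cat lin_scale scaleN1r. Qed.
Lemma lin1 s : lin u [:: (1, s)] = u s.
Proof. by rewrite lin_cons lin_nil addr0 scale1r. Qed.
End LinLmod.

Lemma lin_map (V V' : lmodType R[i]) (h : V -> V') (u : gis E -> V) cs :
  (forall c x y, h (c *: x + y) = c *: h x + h y) -> h 0 = 0 ->
  h (lin u cs) = lin (h \o u) cs.
Proof.
move=> hl h0; elim: cs => [|p cs IH]; first by rewrite !lin_nil.
by rewrite !lin_cons hl IH.
Qed.

Lemma lin_fctE (V : lmodType R[i]) T (u : gis E -> T -> V) cs x :
  lin u cs x = \sum_(p <- cs) p.1 *: u p.2 x.
Proof.
by elim: cs => [|p cs IH]; rewrite ?lin_nil ?big_nil // lin_cons big_cons -IH.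
Qed.

Section GisFamily.
Variables (D : cstarAlg R) (u : gis E -> D).

(** The algebraic part of [gis_rep], in an abstract C*-algebra. The norm bound follows
    ([family_norm]), and [family_rep_le] deals with degeneracy. *)
Definition gis_family : Prop :=
  [/\ forall s t, u (gis_mul s t) = cs_mul (u s) (u t),
      forall s, u (gis_star s) = cs_star (u s),
      u None = 0
    & forall v, Vfin v -> u (gpair (pvert v) (pvert v)) =
        \sum_(e <- fset_set (out_edges v)) u (gpair (pedge e) (pedge e))].

Hypothesis fu : gis_family.

Lemma lin_mul cs ds : lin u (comb_mul cs ds) = cs_mul (lin u cs) (lin u ds).
Proof.
have [uM _ _ _] := fu; elim: cs => [|p cs IH]; first by rewrite !lin_nil cs_mul0l.
rewrite /comb_mul /= lin_cat lin_cons cs_mulDl -IH; congr (_ + _).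
elim: ds {IH} => [|q ds IH]; first by rewrite !lin_nil cs_mul0r.
rewrite /= !lin_cons IH cs_mulDr uM; congr (_ + _).
by rewrite cs_mulZl cs_mulZr scalerA.
Qed.

Lemma lin_star cs : lin u (comb_star cs) = cs_star (lin u cs).
Proof.
have [_ uS _ _] := fu; elim: cs => [|p cs IH]; first by rewrite !lin_nil cs_star0.
by rewrite /= !lin_cons IH uS cs_star_antilin.
Qed.

End GisFamily.

Section RepFamily.
Variables (H : hilbertType R).

Lemma fsbig_fset (V : nmodType) (v : vert E) (F : edge E -> V) : Vfin v ->
  \sum_(e \in out_edges v) F e = \sum_(e <- fset_set (out_edges v)) F e.
Proof. by move=> fv; rewrite fsbig_finite. Qed.

Lemma opval_sum I (r : seq I) (F : I -> opalg H) x :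
  opval (\sum_(i <- r) F i) x = \sum_(i <- r) opval (F i) x.
Proof. by elim: r => [|j r IH]; rewrite ?big_nil // !big_cons opvalD IH. Qed.

Lemma opval_lin (u : gis E -> opalg H) cs : opval (lin u cs) = lin (fun s => opval (u s)) cs.
Proof. by apply/funext => x; rewrite lin_fctE /lin opval_sum. Qed.

Lemma gis_rep_family (Pi : gis E -> H -> H) : gis_rep Pi ->
  exists2 u : gis E -> opalg H, gis_family u & forall s, opval (u s) = Pi s.
Proof.
move=> [PB PM PS _ [P0 PF]].
have ad s : adjointable (Pi s).
  by split; [have [] := PB s|exists (Pi (gis_star s)); [have [] := PB (gis_star s)|exact: PS]].
pose u s : opalg H := @SB R (op_subBanach H) _ (ad s).
exists u => //; split.
- by move=> s t; apply: opval_ext => x; apply: PM.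
- by move=> s; apply/esym/opval_star_eq; apply: PS.
- by apply: opval_ext => x; apply: P0.
- by move=> v fv; apply: opval_ext => x; rewrite opval_sum -fsbig_fset //; apply: PF.
Qed.

(** The element p = a* a is a self-adjoint idempotent, so |p|^2 = |p| and |p| <= 1, while |a|^2 =
    |p|. *)
Lemma partial_isom_norm (D : cstarAlg R) (a : D) :
  cs_mul (cs_mul (cs_star a) a) (cs_mul (cs_star a) a) = cs_mul (cs_star a) a -> rnorm a <= 1.
Proof.
set p := cs_mul (cs_star a) a => pp.
have pS : cs_star p = p by rewrite /p cs_starM cs_starK.
have : rnorm p ^+ 2 = rnorm p by rewrite -cs_rnormC pS pp.
move=> p2; have pa := cs_rnormC a; rewrite -/p in pa; rewrite leNgt; apply/negP => a1.
have : 1 < rnorm p by rewrite pa; nra.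
by nra.
Qed.

End RepFamily.
End Families.

(** * Combinatorics of paths and of the semigroup product *)

Section PathLemmas.
Variable E : digraph.
Implicit Types (a b c d m : fpath E) (v : vert E) (e : edge E) (s t : gis E).

Lemma path_ext a b : psrc a = psrc b -> pedges a = pedges b -> a = b.
Proof.
move=> h1 h2; apply: val_inj; rewrite /= [LHS]surjective_pairing [RHS]surjective_pairing.
by move: h1 h2; rewrite /psrc /pedges => -> ->.
Qed.

Lemma pwalk a : is_walk (psrc a) (pedges a). Proof. exact: path_rawP. Qed.

Lemma psrc_pcat a m : prng a = psrc m -> psrc (pcat a m) = psrc a.
Proof. by move=> h; rewrite {1}/psrc pcatE. Qed.
Lemma pedges_pcat a m : prng a = psrc m -> pedges (pcat a m) = pedges a ++ pedges m.
Proof. by move=> h; rewrite {1}/pedges pcatE. Qed.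
Lemma plen_pcat a m : prng a = psrc m -> plen (pcat a m) = (plen a + plen m)%N.
Proof. by move=> h; rewrite /plen pedges_pcat // size_cat. Qed.

Lemma prng_pvert v : prng (pvert v) = v. Proof. by []. Qed.
Lemma psrc_pedge e : psrc (pedge e) = src e. Proof. by []. Qed.

Lemma pcat_vert a v : prng a = v -> pcat a (pvert v) = a.
Proof.
by move=> <-; apply: path_ext; rewrite ?psrc_pcat ?pedges_pcat //= cats0.
Qed.

Lemma vert_pcat m v : psrc m = v -> pcat (pvert v) m = m.
Proof. by move=> <-; apply: path_ext; rewrite ?psrc_pcat ?pedges_pcat. Qed.

Lemma pcatA a b c : prng a = psrc b -> prng b = psrc c ->
  pcat a (pcat b c) = pcat (pcat a b) c.
Proof.
move=> h1 h2; have h3 : prng a = psrc (pcat b c) by rewrite psrc_pcat.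
have h4 : prng (pcat a b) = psrc c by rewrite prng_pcat.
by apply: path_ext; rewrite ?psrc_pcat ?pedges_pcat // catA.
Qed.

Lemma pcat_inj a m m' : prng a = psrc m -> prng a = psrc m' -> pcat a m = pcat a m' -> m = m'.
Proof. by move=> h h' e; rewrite -(pdrop_pcat h) e pdrop_pcat. Qed.

Lemma plen0 a : plen a = 0%N -> a = pvert (psrc a).
Proof. by move=> /size0nil h; apply: path_ext. Qed.

Lemma prefixP_cat a b : reflect (exists2 m, prng a = psrc m & b = pcat a m) (is_prefix a b).
Proof.
apply: (iffP idP) => [/andP[/eqP sab /prefixP[r er]]|[m h ->]]; last exact: is_prefix_pcat.
have wr : is_walk (prng a) r.
  have := pwalk b; rewrite er is_walk_cat -sab => /andP[_]; exact.
pose m : fpath E := @FPath E (prng a, r) wr; exists m => //.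
by apply: path_ext; rewrite ?psrc_pcat ?pedges_pcat.
Qed.

Lemma is_prefix_refl a : is_prefix a a.
Proof. by rewrite /is_prefix eqxx prefix_refl. Qed.

Lemma is_prefix_len a b : is_prefix a b -> (plen a <= plen b)%N.
Proof. by move=> /prefixP_cat[m h ->]; rewrite plen_pcat // leq_addr. Qed.

Lemma is_prefix_lenlt a b : is_prefix a b -> a <> b -> (plen a < plen b)%N.
Proof.
move=> /prefixP_cat[m h ->] n; rewrite plen_pcat // -addn1 leq_add2l lt0n.
by apply/eqP => /plen0 em; apply: n; rewrite em pcat_vert // h em.
Qed.

Lemma is_prefix_eq a b : is_prefix a b -> plen a = plen b -> a = b.
Proof.
move=> p l; apply/eqP/negPn/negP => /eqP n.
by have := is_prefix_lenlt p n; rewrite l ltnn.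
Qed.

Lemma is_prefix_total a b c : is_prefix a c -> is_prefix b c ->
  (plen a <= plen b)%N -> is_prefix a b.
Proof.
rewrite /is_prefix => /andP[/eqP -> pa] /andP[/eqP -> pb] l; rewrite eqxx /=.
move: pa pb; rewrite !prefixE -/(plen a) -/(plen b) => /eqP pa /eqP pb.
by apply/eqP; rewrite -pb take_takel.
Qed.

Lemma gpair_val a b (h : prng a = prng b) :
  gpair a b = Some (exist (fun p : fpath E * fpath E => prng p.1 == prng p.2) (a, b) (introT eqP h)).
Proof. by rewrite /gpair insubT /= ?h // => p; congr (Some (exist _ _ _)); apply: bool_irrelevance. Qed.

(** A case view in which the nonzero elements appear as [gpair a b] and the subtype proof stays
    hidden. *)
Variant gis_spec : gis E -> Prop :=
| GisZero : gis_spec None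
| GisPair a b : prng a = prng b -> gis_spec (gpair a b).

Lemma gisP s : gis_spec s.
Proof.
case: s => [[[a b] h]|]; last by constructor.
have := h; move=> /eqP /= h'; rewrite (_ : Some _ = gpair a b); first by constructor.
by rewrite (gpair_val h'); congr (Some (exist _ _ _)); apply: bool_irrelevance.
Qed.

Lemma gpair_inj a b c d : prng a = prng b -> prng c = prng d ->
  gpair a b = gpair c d -> a = c /\ b = d.
Proof. by move=> h h'; rewrite (gpair_val h) (gpair_val h') => -[]. Qed.

Lemma gpair_neq0 a b : prng a = prng b -> gpair a b <> None.
Proof. by move=> h; rewrite (gpair_val h). Qed.

Lemma gis_star_pair a b : prng a = prng b -> gis_star (gpair a b) = gpair b a.
Proof. by move=> h; rewrite (gpair_val h). Qed.

Lemma gis_starK : involutive (@gis_star E).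
Proof. by move=> s; case: (gisP s) => // a b h; rewrite (gis_star_pair h) gis_star_pair. Qed.

Lemma gis_muls0 s : gis_mul s None = None. Proof. by case: s. Qed.

Lemma gis_mul_disj a b c d : prng a = prng b -> prng c = prng d ->
  ~~ is_prefix c b -> ~~ is_prefix b c -> gis_mul (gpair a b) (gpair c d) = None.
Proof.
by move=> h h'; rewrite (gpair_val h) (gpair_val h') /= => /negbTE -> /negbTE ->.
Qed.

Lemma gis_mul_mid a b d : prng a = prng b -> prng b = prng d ->
  gis_mul (gpair a b) (gpair b d) = gpair a d.
Proof.
move=> h h'; have := @gis_mulEl E a b (pvert (prng b)) d.
by rewrite !pcat_vert ?h' //; apply; rewrite ?h.
Qed.

Lemma gis_inv_idem s : gis_mul (gis_mul (gis_star s) s) (gis_mul (gis_star s) s) =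
  gis_mul (gis_star s) s.
Proof. by case: (gisP s) => // a b h; rewrite gis_star_pair // !gis_mul_mid ?h. Qed.

Lemma gis_starM s t : gis_star (gis_mul s t) = gis_mul (gis_star t) (gis_star s).
Proof.
case: (gisP s) => [|a b h]; first by rewrite gis_muls0.
case: (gisP t) => [|c d k]; first by rewrite gis_muls0.
rewrite (gis_star_pair h) (gis_star_pair k).
have [/prefixP_cat[m hm eb]|nc] := boolP (is_prefix c b).
  subst b; rewrite prng_pcat // in h; have dm : prng d = psrc m by rewrite -k.
  rewrite (gis_mulEl hm h k) (gis_mulEr hm (esym k) (esym h)).
  by rewrite gis_star_pair // prng_pcat.
have [/prefixP_cat[m hm ec]|nb] := boolP (is_prefix b c).
  subst c; rewrite prng_pcat // in k; have am : prng a = psrc m by rewrite h.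
  rewrite (gis_mulEr hm h k) (gis_mulEl hm (esym k) (esym h)).
  by rewrite gis_star_pair // prng_pcat.
by rewrite !gis_mul_disj.
Qed.

End PathLemmas.

(** * Spans of ranges and nondegeneracy *)

Section Nondegenerate.
Variables (R : realType) (I : Type) (H : hilbertType R) (D : set I) (T : I -> H -> H).

(** Inductive form of the span in [nondegenerate]. Once the T i are linear it is closed under
    scalars, which move into the vectors. *)
Inductive nspan : H -> Prop :=
| nspan0 : nspan 0
| nspanD i x y : D i -> nspan y -> nspan (T i x + y).

Lemma nspan_add x y : nspan x -> nspan y -> nspan (x + y).
Proof.
by elim=> [|i z w Di _ IH] hy; [rewrite add0r|rewrite -addrA; apply: nspanD => //; apply: IH].
Qed.

Lemma nspan1 i x : D i -> nspan (T i x).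
Proof. by move=> Di; rewrite -[T i x]addr0; apply: nspanD => //; apply: nspan0. Qed.

Lemma nspan_scale (c : R[i]) y : (forall i, D i -> bounded_op (T i)) ->
  nspan y -> nspan (c *: y).
Proof.
move=> bT; elim=> [|i z w Di _ IH]; first by rewrite scaler0; apply: nspan0.
by rewrite scalerDr -bounded_opZ; [apply: nspanD|apply: bT].
Qed.

Lemma nspanP y : nspan y <-> exists n (i : 'I_n -> I) (x : 'I_n -> H),
  (forall k, D (i k)) /\ y = \sum_k T (i k) (x k).
Proof.
split=> [|[n [i [x [Di ->]]]]].
  elim=> [|j z w Dj _ [n [i [x [Di ->]]]]].
    by exists 0%N, (fun k : 'I_0 => match k with Ordinal _ h => False_rect _ (Bool.diff_false_true h) end), (fun=> 0); rewrite big_ord0; split=> // -[].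
  exists n.+1, (fun k => if unlift ord0 k is Some l then i l else j),
    (fun k => if unlift ord0 k is Some l then x l else z); split.
    by move=> k; case: unliftP.
  rewrite big_ord_recl unlift_none; congr (_ + _).
  by apply: eq_bigr => k _; rewrite liftK.
by elim/big_ind: _ => //= [|a b|k _]; [exact: nspan0|exact: nspan_add|exact: nspan1].
Qed.

Lemma nondegP : nondegenerate D T <->
  forall y (e : R), 0 < e -> exists2 z, nspan z & rnorm (z - y) < e.
Proof.
rewrite /nondegenerate dense_rnorm; split=> h y e e0.
  by have [z /nspanP hz] := h y e e0; exists z.
by have [z /nspanP hz] := h y e e0; exists z.
Qed.

Definition ncl : set H := [set y | forall e : R, 0 < e -> exists2 z, nspan z & rnorm (z - y) < e].

Lemma nspan_ncl y : nspan y -> ncl y.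
Proof. by move=> hy e e0; exists y; rewrite ?subrr ?rnorm0. Qed.

Lemma ncl_closed x : (forall e : R, 0 < e -> exists2 y, ncl y & rnorm (y - x) < e) -> ncl x.
Proof.
move=> h e e0; have [y hy yx] := h _ (divr_gt0 e0 (ltr0Sn R 1)).
have [z hz zy] := hy _ (divr_gt0 e0 (ltr0Sn R 1)); exists z => //.
by apply: le_lt_trans (rnorm_tri y _ _) _; rewrite [e]splitr ltrD.
Qed.

Lemma ncl_lin (c : R[i]) x y : (forall i, D i -> bounded_op (T i)) ->
  ncl x -> ncl y -> ncl (c *: x + y).
Proof.
move=> bT hx hy e e0; have cp : 0 < cabs c + 1 by rewrite ltr_wpDl.
have [z hz zx] := hx (e / 2 / (cabs c + 1)) ltac:(by rewrite !divr_gt0).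
have [w hw wy] := hy _ (divr_gt0 e0 (ltr0Sn R 1)).
exists (c *: z + w); first by apply: nspan_add => //; apply: nspan_scale.
rewrite opprD addrACA -scalerBr; apply: le_lt_trans (rnormD _ _) _.
rewrite [e]splitr ltr_leD // ?(ltW wy) // rnormZ.
by move: zx; rewrite ltr_pdivlMr //; have := rnorm_ge0 (z - x); nra.
Qed.

End Nondegenerate.

Section Universal.
Variables (R : realType) (E : digraph).
Local Notation comb := (comb R E).
Implicit Types (cs ds : comb) (s t : gis E).

Lemma gis_star_mulK s : gis_mul s (gis_mul (gis_star s) s) = s.
Proof. by case: (gisP s) => // a b h; rewrite gis_star_pair // !gis_mul_mid ?h. Qed.

Lemma family_norm (D : cstarAlg R) (u : gis E -> D) s : gis_family u -> rnorm (u s) <= 1.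
Proof.
move=> [uM uS _ _]; apply: partial_isom_norm.
by rewrite -uS -!uM gis_inv_idem.
Qed.

Definition rep_le cs (M : R) : Prop :=
  forall (H : hilbertType R) (Pi : gis E -> H -> H), gis_rep Pi -> opnorm (lin Pi cs) <= M.

(* Representations restrict to the closed span of their ranges, so degenerate
   families obey the bounds valid for all nondegenerate ones. *)
Lemma family_rep_le (H : hilbertType R) (w : gis E -> opalg H) cs M :
  gis_family w -> rep_le cs M -> rnorm (lin w cs) <= M.
Proof.
move=> fw hM; have [wM wS w0 wF] := fw.
pose T s := opval (w s).
have bT s : bounded_op (T s) by exact: opval_bounded.
pose D := ncl setT T.
have D0 : D 0 by apply/nspan_ncl/nspan0.
have DL (c : R[i]) x y : D x -> D y -> D (c *: x + y) by apply: ncl_lin.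
have Dcl := @ncl_closed R _ H setT T.
have DT s x : D (T s x) by apply/nspan_ncl/nspan1.
pose H' := subHilbert D0 DL Dcl.
pose Pi s : H' -> H' := subop (fun x _ => DT s x).
have PiE s x : subval (Pi s x) = T s (subval x) by [].
have bPi s : bounded_op (Pi s) by exact: subop_bounded.
have repPi : gis_rep Pi.
  split.
  - move=> s; split => //.
    have h : opnorm (T s) <= 1 := family_norm s fw.
    by apply: le_trans h; apply: subop_opnorm; exact: bT.
  - by move=> s t x; apply: subval_inj; rewrite !PiE /T wM.
  - by move=> s x y; rewrite -!subval_dot !PiE /T wS; exact: opval_adj.
  - apply/nondegP => y e e0; have [z hz zy] := subvalP y e e0.
    suff [z' hz' ez] : exists2 z', nspan setT Pi z' & subval z' = z.
      by exists z' => //; rewrite -subval_norm subvalB ez.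
    elim: hz => [|s x z1 _ _ [z' hz' ez]]; first by exists 0 => //; apply: nspan0.
    (* The vector x need not lie in D, but T s x = T s (T (s* s) x), and T (s* s) x does. *)
    exists (Pi s (insubH D0 DL Dcl (DT (gis_mul (gis_star s) s) x)) + z').
      exact: nspanD.
    by rewrite subvalD PiE insubHK ez /T -[in RHS](gis_star_mulK s) (wM s).
  - split=> [x|v x fv]; first by apply: subval_inj; rewrite PiE /T w0.
    apply: subval_inj; rewrite PiE /T wF // opval_sum fsbig_fset // subval_sum.
    by apply: eq_bigr => e _; rewrite PiE.
have linPi x : subval (lin Pi cs x) = opval (lin w cs) (subval x).
  rewrite opval_lin !lin_fctE subval_sum; apply: eq_bigr => p _.
  by rewrite subvalZ.
have bl : bounded_op (lin Pi cs).
  elim: (cs) => [|p ps IH]; first by rewrite lin_nil; exact: bounded_op_cst0.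
  by rewrite lin_cons; apply: bounded_op_lin.
have M0 : 0 <= M by apply: le_trans (hM _ _ repPi); apply: opnorm_ge0.
set a := lin w cs.
(* The range of a* lies in D, where the bound M applies: |a a* x| <= M |a* x| <= M |a| |x|. Then
   |a|^2 = |a a*| gives |a| <= M. *)
have aD x : D (opval (cs_star a) x).
  rewrite -lin_star // opval_lin lin_fctE; apply: nspan_ncl.
  elim: comb_star => [|p ps IH]; first by rewrite big_nil; exact: nspan0.
  rewrite big_cons -bounded_opZ; last exact: opval_bounded.
  exact: (@nspanD _ _ _ setT T p.2 (p.1 *: x)).
have h : rnorm (cs_mul a (cs_star a)) <= M * rnorm a.
  apply: op_rnorm_le; first by rewrite mulr_ge0.
  move=> x; rewrite opvalM -[opval (cs_star a) x](insubHK D0 DL Dcl (aD x)) -linPi.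
  rewrite subval_norm; apply: le_trans (opnormP _ bl) _.
  rewrite -mulrA ler_pM ?opnorm_ge0 // ?(hM _ _ repPi) // -subval_norm insubHK.
  by rewrite -(cs_rnorm_star a) op_rnormP.
have := cs_rnormC (cs_star a); rewrite cs_starK cs_rnorm_star => e.
have := rnorm_ge0 a; move: h; rewrite e; have [->|] := eqVneq (rnorm a) 0; first by [].
move=> n h p; have ap : 0 < rnorm a by rewrite lt_def n.
by rewrite -(ler_pM2r ap) -expr2.
Qed.

End Universal.

(** * The universal property and uniqueness *)

Section UnivDef.
Variables (R : realType) (E : digraph).
Local Notation comb := (comb R E).
Implicit Types (cs ds : comb) (s t : gis E).

(** The last two clauses say that the norm of [lin u cs] is the least upper bound of its norms in
    all nondegenerate representations, without forming that supremum. *)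
Definition univ (A : cstarAlg R) (u : gis E -> A) : Prop :=
  [/\ gis_family u,
      forall a (e : R), 0 < e -> exists cs, rnorm (lin u cs - a) < e,
      forall cs, rep_le cs (rnorm (lin u cs))
    & forall cs M, rep_le cs M -> rnorm (lin u cs) <= M].

Lemma star_hom0 (A D : cstarAlg R) (h : A -> D) : star_hom (B := cstar_star A) h -> h 0 = 0.
Proof.
case=> hl _ _; have := hl (-1) 0 0 Logic.I Logic.I.
by rewrite scaler0 addr0 scaleN1r addNr.
Qed.

Section Extension.
Variables (A D : cstarAlg R) (u : gis E -> A) (w : gis E -> D).
Hypothesis uu : univ u.
Hypothesis fw : gis_family w.
Hypothesis wu : forall cs, rnorm (lin w cs) <= rnorm (lin u cs).

(** The graph of the extension by continuity: combinations near a go to combinations near d. The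
    factor 2 is slack; every factor from 1 upwards defines the same d. *)
Let close a d := forall (e : R) cs, 0 < e -> rnorm (lin u cs - a) < e -> rnorm (lin w cs - d) <= 2 * e.

Let close_ex a : exists d, close a d.
Proof.
have [_ den _ _] := uu.
have [|||d hd] := @approx_limit R D
  (fun e x => exists2 cs, rnorm (lin u cs - a) < e & x = lin w cs) 2 (@seq_completeP R D) => //.
- by move=> e /(den a)[cs hcs]; exists (lin w cs), cs.
- move=> d e _ _ d0 e0 [cs hcs ->] [ds hds ->]; rewrite -lin_sub.
  apply: le_trans (wu _) _; rewrite lin_sub.
  have := rnorm_tri a (lin u cs) (lin u ds); rewrite [rnorm (a - _)]rnormC; lra.
by exists d => e cs e0 he; apply: hd => //; exists cs.
Qed.

Let h a := projT1 (cid (close_ex a)).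
Let hP a : close a (h a). Proof. exact: projT2 (cid (close_ex a)). Qed.

(** One approximation for each e identifies the value, whatever the constant K. Each algebraic law
    of the extension is checked in this way. *)
Let close_eq a d' (K : R) : 0 <= K ->
  (forall e : R, 0 < e -> exists2 cs, rnorm (lin u cs - a) < e & rnorm (lin w cs - d') <= K * e) ->
  h a = d'.
Proof.
move=> K0 ex; have cd := @hP a; apply: rnorm_lt_eq => e e0; have Kp : 0 < K + 3 by lra.
have ep : 0 < e / (K + 3) by rewrite divr_gt0.
have [cs h1 h2] := ex _ ep; have h3 := cd _ _ ep h1.
apply: le_lt_trans (rnorm_tri (lin w cs) _ _) _; rewrite rnormC.
have e1 : e = (K + 3) * (e / (K + 3)) by rewrite mulrC divfK ?lt0r_neq0.
rewrite [X in _ < X]e1; move: h1 h2 h3; set x := e / _; move: (ep); rewrite -/x; nra.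
Qed.

(** By [wu], the assignment [lin u cs] to [lin w cs] is well defined and contractive, and its domain
    is dense by [univ]. *)
Lemma extend_family : exists k : A -> D,
  [/\ star_hom (B := cstar_star A) k, forall s, k (u s) = w s
    & forall a, rnorm (k a) <= rnorm a].
Proof.
have [fu den _ _] := uu.
exists h; split; first split.
- move=> c a b _ _; have cp : 0 <= 2 * cabs c + 2 by have := cabs_ge0 c; lra.
  apply: (close_eq cp) => e e0.
  have k0 : 0 < cabs c + 1 by have := cabs_ge0 c; lra.
  have ep : 0 < e / (cabs c + 1) by rewrite divr_gt0.
  have e1 : e = (cabs c + 1) * (e / (cabs c + 1)) by rewrite mulrC divfK ?lt0r_neq0.
  have [cs h1] := den a _ ep; have [ds h2] := den b _ ep.
  have h3 := hP ep h1; have h4 := hP ep h2.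
  exists (comb_scale c cs ++ ds); rewrite lin_cat lin_scale opprD addrACA -scalerBr.
    apply: le_lt_trans (rnormD _ _) _; rewrite rnormZ [X in _ < X]e1.
    move: h1 h2 ep; set x := e / _; have := cabs_ge0 c; nra.
  apply: le_trans (rnormD _ _) _; rewrite rnormZ [X in _ <= _ * X]e1.
  move: h3 h4 ep; set x := e / _; have := cabs_ge0 c; nra.
(* This K exceeds the coefficients of d in the product estimates in A and in D; as d <= 1, quadratic
   terms in d are absorbed as well. *)
- move=> a b _ _; set K := 2 * (rnorm a + rnorm b + rnorm (h a) + rnorm (h b) + 3).
  have na := rnorm_ge0 a; have nb := rnorm_ge0 b.
  have nha := rnorm_ge0 (h a); have nhb := rnorm_ge0 (h b).
  have K0 : 0 <= K by rewrite /K; lra.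
  apply: (close_eq K0) => e e0.
  have [d [d0 d1 de]] : exists d, [/\ 0 < d, d <= 1 & K * d <= e].
    exists (Num.min 1 (e / (K + 1))); split; first by rewrite lt_min ltr01 divr_gt0 ?ltr_wpDl.
      by rewrite ge_min lexx.
    apply: (@le_trans _ _ (K * (e / (K + 1)))); first by rewrite ler_wpM2l // ge_min lexx orbT.
    by rewrite mulrA ler_pdivrMr ?ltr_wpDl // mulrC ler_wpM2l ?ltW // ltrDl.
  have [cs h1] := den a _ d0; have [ds h2] := den b _ d0.
  have h3 := hP d0 h1; have h4 := hP d0 h2.
  have est (C : cstarAlg R) (x y x' y' : C) : cs_mul x y - cs_mul x' y' =
      cs_mul (x - x') y + cs_mul x' (y - y').
    by rewrite cs_mulBl cs_mulBr addrA subrK.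
  exists (comb_mul cs ds); rewrite lin_mul // est.
    apply: le_lt_trans (rnormD _ _) _.
    have e1 := cs_rnormM (lin u cs - a) (lin u ds).
    have e2 := cs_rnormM a (lin u ds - b).
    have e3 := rnorm_tri b (lin u ds) 0; rewrite !subr0 in e3.
    have := rnorm_ge0 (lin u cs - a); have := rnorm_ge0 (lin u ds - b).
    have := rnorm_ge0 (lin u ds).
    move=> p1 p2 p3; have f1 : rnorm (lin u cs - a) * rnorm (lin u ds) <= d * (rnorm b + 1) by nra.
    have f2 : rnorm a * rnorm (lin u ds - b) <= rnorm a * d by nra.
    by apply: le_lt_trans (lerD e1 e2) _; move: de; rewrite /K; nra.
  apply: le_trans (rnormD _ _) _.
  have e1 := cs_rnormM (lin w cs - h a) (lin w ds).
  have e2 := cs_rnormM (h a) (lin w ds - h b).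
  have e3 := rnorm_tri (h b) (lin w ds) 0; rewrite !subr0 in e3.
  have := rnorm_ge0 (lin w cs - h a); have := rnorm_ge0 (lin w ds - h b).
  have := rnorm_ge0 (lin w ds).
  move=> p1 p2 p3.
  have f1 : rnorm (lin w cs - h a) * rnorm (lin w ds) <= 2 * d * (rnorm (h b) + 2) by nra.
  have f2 : rnorm (h a) * rnorm (lin w ds - h b) <= rnorm (h a) * (2 * d) by nra.
  apply: le_trans (lerD e1 e2) _; apply: le_trans (_ : e <= _); last first.
    by rewrite /K; nra.
  by move: de; rewrite /K; nra.
- move=> a _; apply: (close_eq (K := 2)) => // e e0.
  have [cs h1] := den a _ e0; exists (comb_star cs); rewrite lin_star // -cs_starB cs_rnorm_star //.
  exact: hP h1.
- move=> s; apply: (close_eq (K := 0)) => // e e0.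
  by exists [:: (1, s)]; rewrite !lin1 subrr rnorm0 // mul0r.
- move=> a; apply/ler_addgt0Pr => e e0; have ep : 0 < e / 3 by rewrite divr_gt0.
  have [cs h1] := den a _ ep; have h2 := hP ep h1; have h3 := wu cs.
  have := rnormB_ge (h a) (lin w cs); rewrite rnormC.
  have := rnormB_ge (lin u cs) a; lra.
Qed.

End Extension.

Lemma univ_le (A B : cstarAlg R) (u : gis E -> A) (w : gis E -> B) cs :
  univ u -> univ w -> rnorm (lin w cs) <= rnorm (lin u cs).
Proof. by move=> [_ _ h _] [_ _ _ h']; apply: h'; apply: h. Qed.

(** The contractive comparison maps in the two directions compose to maps that fix all combinations,
    and these are dense. *)
Lemma univ_iso (A B : cstarAlg R) (u : gis E -> A) (w : gis E -> B) :
  univ u -> univ w -> cstar_iso A B.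
Proof.
move=> uu uw.
have [fu _ _ _] := uu; have [fw _ _ _] := uw.
have [h [hh hu hn]] := extend_family uu fw (fun cs => univ_le cs uu uw).
have [k [kh kw kn]] := extend_family uw fu (fun cs => univ_le cs uw uu).
exists h; split => //.
have inv (A' B' : cstarAlg R) (u' : gis E -> A') (w' : gis E -> B') (f : A' -> B') (g : B' -> A') :
    univ u' -> star_hom (B := cstar_star A') f -> star_hom (B := cstar_star B') g ->
    (forall a, rnorm (f a) <= rnorm a) -> (forall b, rnorm (g b) <= rnorm b) ->
    (forall s, f (u' s) = w' s) -> (forall s, g (w' s) = u' s) -> cancel f g.
  move=> [_ den _ _] fh gh fn gn fu' gw a; apply: rnorm_lt_eq => e e0.
  have ep : 0 < e / 2 by rewrite divr_gt0.
  have [cs h1] := den a _ ep.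
  have [fl _ _] := fh; have [gl _ _] := gh.
  have fB x y : f (x - y) = f x - f y.
    by have := fl (-1) y x Logic.I Logic.I; rewrite !scaleN1r addrC => ->; rewrite addrC.
  have gB x y : g (x - y) = g x - g y.
    by have := gl (-1) y x Logic.I Logic.I; rewrite !scaleN1r addrC => ->; rewrite addrC.
  have fc : g (f (lin u' cs)) = lin u' cs.
    rewrite (lin_map (h := f)) ?(star_hom0 fh) // => [|c x y]; last exact: fl.
    rewrite (lin_map (h := g)) ?(star_hom0 gh) // => [|c x y]; last exact: gl.
    by congr lin; apply/funext => s /=; rewrite fu' gw.
  have h2 : rnorm (g (f a) - lin u' cs) < e / 2.
    rewrite -fc -gB -fB; apply: le_lt_trans (gn _) _; apply: le_lt_trans (fn _) _.
    by rewrite rnormC.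
  by apply: le_lt_trans (rnorm_tri (lin u' cs) _ _) _; rewrite [e]splitr ltrD.
by exists k; [apply: inv hu kw|apply: inv kw hu].
Qed.

End UnivDef.

Arguments dsval : simpl never.

(** * Existence of the universal algebra *)

Section Existence.
Variables (R : realType) (E : digraph).
Local Notation comb := (comb R E).
Implicit Types (cs ds : comb) (s t : gis E).

Section FamilyClosure.
Variables (A : cstarAlg R) (w : gis E -> A).
Hypothesis fw : gis_family w.

(** Combinations are closed under products and adjoints already, so their closure is the C*-algebra
    generated by the family. *)
Definition fcl : set A := [set a | forall e : R, 0 < e -> exists cs, rnorm (lin w cs - a) < e].

Lemma fcl_lin cs : fcl (lin w cs).
Proof. by move=> e e0; exists cs; rewrite subrr rnorm0. Qed.

Lemma fcl0 : fcl 0.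
Proof. by rewrite -(lin_nil w); exact: fcl_lin. Qed.

Lemma fcl_closed x : (forall e : R, 0 < e -> exists2 y, fcl y & rnorm (y - x) < e) -> fcl x.
Proof.
move=> h e e0; have ep := divr_gt0 e0 (ltr0Sn R 1).
have [y hy yx] := h _ ep; have [cs hcs] := hy _ ep; exists cs.
by apply: le_lt_trans (rnorm_tri y _ _) _; rewrite [e]splitr ltrD.
Qed.

Lemma fclL (c : R[i]) x y : fcl x -> fcl y -> fcl (c *: x + y).
Proof.
move=> hx hy e e0; have cp : 0 < cabs c + 1 by rewrite ltr_wpDl.
have [cs hc] := hx (e / 2 / (cabs c + 1)) ltac:(by rewrite !divr_gt0).
have [ds hd] := hy _ (divr_gt0 e0 (ltr0Sn R 1)).
exists (comb_scale c cs ++ ds); rewrite lin_cat lin_scale opprD addrACA -scalerBr.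
apply: le_lt_trans (rnormD _ _) _.
rewrite [e]splitr ltr_leD // ?(ltW hd) // rnormZ.
by move: hc; rewrite ltr_pdivlMr //; have := rnorm_ge0 (lin w cs - x); nra.
Qed.

Lemma fclS x : fcl x -> fcl (cs_star x).
Proof.
move=> hx e /hx[cs hcs]; exists (comb_star cs).
by rewrite lin_star // -cs_starB cs_rnorm_star.
Qed.

Lemma fclM x y : fcl x -> fcl y -> fcl (cs_mul x y).
Proof.
have DMl cs z : fcl z -> fcl (cs_mul (lin w cs) z).
  move=> hz; apply: fcl_closed => e e0; have p : 0 < rnorm (lin w cs) + 1 by rewrite ltr_wpDl.
  have [ds hds] := hz _ (divr_gt0 e0 p).
  exists (lin w (comb_mul cs ds)); first exact: fcl_lin.
  rewrite lin_mul // -cs_mulBr.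
  apply: le_lt_trans (cs_rnormM _ _) _; move: hds; rewrite ltr_pdivlMr //.
  by have := rnorm_ge0 (lin w ds - z); nra.
move=> hx hy; apply: fcl_closed => e e0; have p : 0 < rnorm y + 1 by rewrite ltr_wpDl.
have [cs hcs] := hx _ (divr_gt0 e0 p).
exists (cs_mul (lin w cs) y); first exact: DMl.
rewrite -cs_mulBl; apply: le_lt_trans (cs_rnormM _ _) _; move: hcs; rewrite ltr_pdivlMr //.
by have := rnorm_ge0 (lin w cs - x); nra.
Qed.

End FamilyClosure.

Lemma lin_bounded (H : hilbertType R) (Pi : gis E -> H -> H) cs :
  (forall s, bounded_op (Pi s)) -> bounded_op (lin Pi cs).
Proof.
move=> bP; elim: cs => [|p cs IH]; first by rewrite lin_nil; exact: bounded_op_cst0.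
by rewrite lin_cons; apply: bounded_op_lin.
Qed.

(** Cuts the representations down to an index type over which a direct sum can be formed: one
    witness for each combination and each real number that its norm can reach. *)
Let good (i : comb * R) := exists (H : hilbertType R) (Pi : gis E -> H -> H),
  gis_rep Pi /\ i.2 <= opnorm (lin Pi i.1).

Let I := {i : comb * R | `[< good i >]}.

Let rep_ex (i : I) : good (sval i).
Proof. by apply/asboolP; exact: (svalP i). Qed.

Let H i : hilbertType R := projT1 (cid (rep_ex i)).
Let Pi_ex i : exists Pi : gis E -> H i -> H i, gis_rep Pi /\ (sval i).2 <= opnorm (lin Pi (sval i).1).
Proof. exact: projT2 (cid (rep_ex i)). Qed.
Let Pi i : gis E -> H i -> H i := projT1 (cid (Pi_ex i)).
Arguments Pi : clear implicits.
Let repPi i : gis_rep (Pi i).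
Proof. exact: (projT2 (cid (Pi_ex i))).1. Qed.
Let Pi_norm i : (sval i).2 <= opnorm (lin (Pi i) (sval i).1).
Proof. exact: (projT2 (cid (Pi_ex i))).2. Qed.

Let bPi s i : bounded_op (Pi i s).
Proof. by have [/(_ s)[]] := repPi i. Qed.
Let Pi_le1 s i : opnorm (Pi i s) <= 1.
Proof. by have [/(_ s)[]] := repPi i. Qed.

Let H0 := dsum H.
Let Pi0 s : H0 -> H0 := dsop (bPi s) ler01 (Pi_le1 s).

Let Pi0E s x i : dsval (Pi0 s x) i = Pi i s (dsval x i).
Proof. by []. Qed.

(** The inclusion of a summand. The coordinates have dependent types, which forces the transport
    along i = j; proof irrelevance removes it again at j = i. *)
Fact single_l2 i (x : H i) :
  @l2 R _ H (fun j => if pselect (i = j) is left h then ecast j (H j) h x else 0).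
Proof.
exists (rnorm x ^+ 2) => B; rewrite (big_fsetID _ (pred1 i)) /=.
rewrite [X in _ + X]big1_seq ?addr0 => [|j].
  apply: (@le_trans _ _ (\sum_(j <- [fset i]%fset)
      rnorm (if pselect (i = j) is left h then ecast j (H j) h x else 0) ^+ 2)).
    apply: sum_fset_le => [j|]; first exact: sqr_ge0.
    by apply/fsubsetP => j; rewrite !inE /= => /andP[_].
  rewrite big_seq_fset1; case: pselect => // h.
  by rewrite (Prop_irrelevance h erefl).
rewrite !inE => /andP[_ /andP[_ ji]]; have {}ji : j <> i by apply/eqP.
case: pselect => [h|_]; last by rewrite rnorm0 expr0n.
by case: ji.
Qed.

Let single i (x : H i) : H0 := mkds (single_l2 x).

Let single_eq i (x : H i) : dsval (single x) i = x.
Proof. by rewrite mkdsE; case: pselect => // h; rewrite (Prop_irrelevance h erefl). Qed.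

Let single_neq i j (x : H i) : i <> j -> dsval (single x) j = 0.
Proof. by rewrite mkdsE; case: pselect. Qed.

Let single_norm i (x : H i) : rnorm (single x) = rnorm x.
Proof.
apply/eqP; rewrite eq_le; apply/andP; split; last first.
  by rewrite -{1}(single_eq x); apply/l2norm_coord/dsval_l2.
suff hb : l2bound (dsval (single x)) (rnorm x ^+ 2) by apply: l2norm_le hb.
move=> B; rewrite (big_fsetID _ (pred1 i)) /=.
rewrite [X in _ + X]big1_seq ?addr0 => [|j].
  apply: (@le_trans _ _ (\sum_(j <- [fset i]%fset) rnorm (dsval (single x) j) ^+ 2)).
    apply: sum_fset_le => [j|]; first exact: sqr_ge0.
    by apply/fsubsetP => j; rewrite !inE /= => /andP[_].
  by rewrite big_seq_fset1 single_eq.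
rewrite !inE => /andP[_ /andP[_ ji]]; have {}ji : j <> i by apply/eqP.
by rewrite (single_neq x (nesym ji)) rnorm0 expr0n.
Qed.

Let singleB i (x y : H i) : single (x - y) = single x - single y.
Proof.
apply: dsval_ext => j; rewrite dsvalB; have [h|h] := pselect (i = j).
  by subst j; rewrite !single_eq.
by rewrite !single_neq // subrr.
Qed.

Let Pi0_single s i (x : H i) : Pi0 s (single x) = single (Pi i s x).
Proof.
apply: dsval_ext => j; rewrite Pi0E; have [h|h] := pselect (i = j).
  by subst j; rewrite !single_eq.
by rewrite !single_neq // (bounded_op0 (bPi s j)).
Qed.

Let Pi0_bounded s : bounded_op (Pi0 s).
Proof. exact: dsop_bounded. Qed.

Let single_ncl i (x : H i) : ncl setT Pi0 (single x).
Proof.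
have [_ _ _ /nondegP nd _] := repPi i; move=> e e0.
have [z hz zx] := nd x e e0; exists (single z).
  elim: hz => [|s y w _ _ IH].
    have -> : single (0 : H i) = 0 by rewrite -(subrr (0 : H i)) singleB subrr.
    exact: nspan0.
  have -> : single (Pi i s y + w) = Pi0 s (single y) + single w.
    rewrite Pi0_single; apply/eqP; rewrite -subr_eq -singleB addrK //.
  exact: nspanD.
by rewrite -singleB single_norm.
Qed.

Let Pi0_nondeg : nondegenerate setT Pi0.
Proof.
apply/nondegP; move=> y; apply: ncl_closed => e e0.
have [M hM] := dsval_l2 y.
(* Outside A the squared norm of y is below (e / 2)^2, so y is approximated by a finite sum of
   coordinate vectors, and each of these through the nondegeneracy of its own summand. *)
have [A hA] := @abs_bounded_tail R _ (fun i => rnorm (dsval y i) ^+ 2) M ((e / 2) ^+ 2)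
  (fun=> sqr_ge0 _) hM ltac:(by rewrite exprn_gt0 // divr_gt0).
exists (\sum_(i <- A) single (dsval y i)).
  elim: (enum_fset A) => [|i r IH]; first by rewrite big_nil; apply/nspan_ncl/nspan0.
  rewrite big_cons -[single _]scale1r; apply: ncl_lin.
  - by move=> s _; exact: Pi0_bounded.
  - exact: single_ncl.
  - exact: IH.
rewrite rnormC; apply: (@le_lt_trans _ _ (e / 2)); last by lra.
set d := y - _.
suff hb : l2bound (dsval d) ((e / 2) ^+ 2) by apply: l2norm_le hb; rewrite ltW // divr_gt0.
have cf j : dsval d j =
    if j \in A then 0 else dsval y j.
  rewrite /d dsvalB dsval_sum; case: ifPn => jA.
    rewrite (big_fsetD1 j) //= single_eq big1_seq ?addr0 ?subrr // => i.
    by rewrite !inE /= => /andP[/eqP ij _]; rewrite single_neq.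
  rewrite big1_seq ?subr0 // => i /andP[_ iA]; rewrite single_neq // => ij.
  by move: jA; rewrite -ij iA.
move=> B; rewrite (big_fsetID _ (mem A)) /= big1_seq ?add0r => [|j].
  set B' := [fset x in B | _]%fset.
  have -> : \sum_(i <- B') rnorm (dsval d i) ^+ 2 =
      \sum_(i <- B') rnorm (dsval y i) ^+ 2.
    apply: eq_big_seq => i; rewrite !inE /= => /andP[_ iA].
    by rewrite cf (negbTE iA).
  apply/ltW/hA/fdisjointP => i iA; rewrite !inE /= iA andbF //.
by rewrite !inE /= => /andP[_ jA]; rewrite cf jA rnorm0 expr0n.
Qed.

Let repPi0 : gis_rep Pi0.
Proof.
split => //.
- move=> s; split => //; apply: opnorm_le => // x; exact: dsop_le.
- move=> s t x; apply: dsval_ext => i; rewrite !Pi0E.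
  by have [_ h _ _ _] := repPi i; apply: h.
- move=> s x y; apply: (@has_sum_unique _ _ R[i]^o _ _ _ (dsval_dot _ _)).
  apply: has_sum_ext (dsval_dot _ _) => i; rewrite !Pi0E.
  by have [_ _ h _ _] := repPi i; rewrite -h.
split=> [x|v x fv]; apply: dsval_ext => i.
  by rewrite Pi0E; have [_ _ _ _ [h _]] := repPi i; rewrite h.
rewrite Pi0E fsbig_fset // dsval_sum; have [_ _ _ _ [_ h]] := repPi i.
by rewrite h // fsbig_fset.
Qed.

Let lin_single cs i (x : H i) : lin Pi0 cs (single x) = single (lin (Pi i) cs x).
Proof.
apply: dsval_ext => j; rewrite !lin_fctE dsval_sum.
have [h|h] := pselect (i = j).
  by subst j; rewrite single_eq; apply: eq_bigr => p _; rewrite dsvalZ Pi0_single single_eq.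
by rewrite single_neq // big1 // => p _; rewrite dsvalZ Pi0_single single_neq // scaler0.
Qed.

Let Pi0_max cs : rep_le cs (opnorm (lin Pi0 cs)).
Proof.
move=> K rho rrho.
(* The summand for the pair of cs and the norm that rho itself attains is already large enough. *)
have g : `[< good (cs, opnorm (lin rho cs)) >] by apply/asboolP; exists K, rho.
pose i : I := exist (fun i => `[< good i >]) _ g.
apply: le_trans (Pi_norm i) _ => /=.
have b0 : bounded_op (lin Pi0 cs) by exact: lin_bounded.
apply: opnorm_le; [exact: lin_bounded|exact: opnorm_ge0|move=> x].
by rewrite -single_norm -lin_single -(single_norm x); apply: opnormP.
Qed.

(** The closed span of the family in the operators on [H0]. Its inclusion is recorded as well, since
    [is_graph_cstar] asks for an isometric representation. *)
Theorem univ_exists : exists (A : cstarAlg R) (u : gis E -> A), univ u /\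
  exists (H : hilbertType R) (phi : cstar_star A -> H -> H),
    star_rep phi /\ forall a, opnorm (phi a) = rnorm a.
Proof.
have [w fw wE] := gis_rep_family repPi0.
pose A := subCstar (fcl0 w) (@fclL _ w) (@fcl_closed _ w) (fclM fw) (fclS fw).
have Dw s : fcl w (w s) by rewrite -(lin1 w); exact: fcl_lin.
pose u s : A := mksc (fcl0 w) (@fclL _ w) (@fcl_closed _ w) (fclM fw) (fclS fw) (Dw s).
have uE s : scval (u s) = w s by [].
have scsum J (r : seq J) (F : J -> A) : scval (\sum_(j <- r) F j) = \sum_(j <- r) scval (F j).
  by elim: r => [|j r IH]; rewrite ?big_nil // !big_cons scvalD IH.
have luE cs : scval (lin u cs) = lin w cs.
  by rewrite /lin scsum; apply: eq_bigr => p _; rewrite scvalZ.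
have nE cs : rnorm (lin u cs) = opnorm (lin Pi0 cs).
  rewrite -scval_norm luE -opval_norm opval_lin; congr (opnorm (lin _ cs)).
  exact/funext.
have [wM wS w0 wF] := fw.
exists A, u; split.
  split.
  - split.
    + by move=> s t; apply: scval_inj; rewrite uE wM.
    + by move=> s; apply: scval_inj; rewrite uE wS.
    + by apply: scval_inj; rewrite uE w0.
    + by move=> v fv; apply: scval_inj; rewrite uE wF // scsum.
  - move=> a e e0; have [cs hcs] := scvalP a e e0; exists cs.
    by rewrite -scval_norm scvalB luE.
  - by move=> cs; rewrite nE; exact: Pi0_max.
  - by move=> cs M h; rewrite nE; apply: h.
exists H0, (fun a => opval (scval (a : A))); split; first split.
- by move=> f _; exact: opval_bounded.
- by move=> c f g x _ _; rewrite scvalD scvalZ opvalD opvalZ.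
- move=> f g x _ _.
  have e : scval (sa_mul f g) = cs_mul (scval (f : A)) (scval (g : A)) := erefl.
  by rewrite e.
- by move=> f _; exact: opval_adj.
by move=> a; rewrite opval_norm -scval_norm.
Qed.

End Existence.

(** * The convolution algebra of the inverse semigroup *)

Section HasSumMore.
Variables (R : realType).

Lemma has_sum_reindex (I : choiceType) (W : normedModType R[i]) (F : I -> W) (h : I -> I) l :
  involutive h -> has_sum F l -> has_sum (F \o h) l.
Proof.
move=> hK hl e /hl[A hA]; exists [fset h i | i in A]%fset => B AB.
have hI : injective h by exact: inv_inj.
have -> : \sum_(i <- B) (F \o h) i = \sum_(i <- [fset h i | i in B]%fset) F i.
  by rewrite big_imfset //= => i j _ _; exact: hI.
apply: hA; apply/fsubsetP => i iA; apply/imfsetP; exists (h i); last by rewrite hK.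
by apply: (fsubsetP AB); apply/imfsetP; exists i.
Qed.

(** Regrouping along the fibres of h. The case of semigroup multiplication turns a double sum into a
    convolution. *)
Lemma has_sum_fiber (I J : choiceType) (W : normedModType R[i]) (F : J -> W) (h : J -> I) l (M : R)
    (G : I -> W) :
  abs_bounded F M -> has_sum F l ->
  (forall i, has_sum (fun j => if h j == i then F j else 0) (G i)) ->
  has_sum G l.
Proof.
move=> bF hl hG e e0; have ep : 0 < e / 2 by rewrite divr_gt0.
have [A hA] := @abs_bounded_tail R J (fun j => rnorm (F j)) M (e / 2) (fun=> rnorm_ge0 _) bF ep.
exists [fset h j | j in A]%fset => B AB.
have hB : has_sum (fun j => if h j \in B then F j else 0) (\sum_(i <- B) G i).
  elim/finSet_rect: B {AB} => B IH.
  have [->|[i iB]] := fset_0Vmem B.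
    rewrite big_seq_fset0 => d d0; exists fset0 => C _.
    by rewrite big1 ?subrr ?rnorm0 // => j _; rewrite in_fset0.
  rewrite (big_fsetD1 i) //=.
  have := has_sum_lin 1 (hG i) (IH _ (fproperD1 iB)); rewrite scale1r.
  apply: has_sum_ext => j; rewrite scale1r !inE.
  by case: eqP => [->|_] /=; rewrite ?iB ?addr0 ?add0r.
have := has_sum_lin (-1) hB hl; rewrite scaleN1r addrC => hd.
apply: (@le_lt_trans _ _ (e / 2)); last by lra.
apply: (has_sum_le hd) => C; apply: le_trans (rnorm_sum _ _) _.
(* Terms with j in A have [h j] in B and cancel; what remains is a tail. *)
rewrite (big_fsetID _ (mem A)) /= big1_seq ?add0r => [|j].
  apply: le_trans (_ : \sum_(j <- [fset x in C | x \notin A]%fset) rnorm (F j) <= _).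
    apply: ler_sum => j _; case: ifP => _; rewrite scaleN1r ?addNr ?rnorm0 //.
    by rewrite oppr0 add0r.
  by apply/ltW/hA/fdisjointP => j jA; rewrite !inE /= jA andbF.
rewrite !inE /= => /andP[_ jA]; rewrite (fsubsetP AB) ?scaleN1r ?addNr ?rnorm0 //.
by apply/imfsetP; exists j.
Qed.

(** The set B lies in the product of its two projections, over which the sum factors. *)
Lemma sum_fset_pair (I J : choiceType) (f : I -> R) (g : J -> R) (M N : R) (B : {fset I * J}) :
  (forall i, 0 <= f i) -> (forall j, 0 <= g j) ->
  (forall A : {fset I}, \sum_(i <- A) f i <= M) ->
  (forall A : {fset J}, \sum_(j <- A) g j <= N) ->
  \sum_(p <- B) f p.1 * g p.2 <= M * N.
Proof.
move=> f0 g0 fM gN; set A1 := [fset p.1 | p in B]%fset; set A2 := [fset p.2 | p in B]%fset.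
have fg0 (p : I * J) : 0 <= f p.1 * g p.2 by rewrite mulr_ge0.
pose K : choiceType := (I * J)%type.
have sub : (B `<=` [fset ((i, j) : K) | i in A1, j in A2])%fset.
  apply/fsubsetP => -[i j] ijB; apply/imfset2P; exists i; first by apply/imfsetP; exists (i, j).
  by exists j => //; apply/imfsetP; exists (i, j).
apply: le_trans (@sum_fset_le R _ (fun p : I * J => f p.1 * g p.2) _ _ fg0 sub) _.
rewrite big_imfset2 /=; last by move=> [i j] [i' j'] _ _ /= [-> ->].
under eq_bigr do rewrite -mulr_sumr.
rewrite -mulr_suml; have a1 := fM A1; have a2 := gN A2.
by apply: ler_pM => //; apply: sumr_ge0.
Qed.

(** The family of products is absolutely bounded and so has some sum l. Rectangles that contain a
    given finite set of pairs identify l with the product of the sums. *)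
Lemma has_sum_prod (I J : choiceType) (A : cstarAlg R) (F : I -> A) (G : J -> A) a b (M N : R) :
  abs_bounded F M -> abs_bounded G N -> has_sum F a -> has_sum G b ->
  has_sum (fun p : I * J => cs_mul (F p.1) (G p.2)) (cs_mul a b).
Proof.
move=> bF bG ha hb.
have bFG : abs_bounded (fun p : I * J => cs_mul (F p.1) (G p.2)) (M * N).
  move=> B.
  have hp : \sum_(p <- B) rnorm (F p.1) * rnorm (G p.2) <= M * N.
    exact: (@sum_fset_pair I J (fun i => rnorm (F i)) (fun j => rnorm (G j)) M N B
      (fun=> rnorm_ge0 _) (fun=> rnorm_ge0 _) bF bG).
  apply: le_trans hp.
  by apply: ler_sum => p _; exact: cs_rnormM.
have [l hl] := has_sum_abs (@seq_completeP R A) bFG.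
suff -> : cs_mul a b = l by [].
apply: rnorm_lt_eq => e e0.
pose K := rnorm a + rnorm b + 1.
have Kp : 0 < K by rewrite /K; have := rnorm_ge0 a; have := rnorm_ge0 b; lra.
have [d [d0 d1 de]] : exists d, [/\ 0 < d, d <= 1 & K * d <= e / 2].
  exists (Num.min 1 (e / 2 / K)); split; first by rewrite lt_min ltr01 !divr_gt0.
    by rewrite ge_min lexx.
  by rewrite mulrC -ler_pdivlMr // ge_min lexx orbT.
have [A0 hA] := hl _ (divr_gt0 e0 (ltr0Sn R 1)).
have [A1 h1] := ha _ d0; have [A2 h2] := hb _ d0.
set B1 := (A1 `|` [fset p.1 | p in A0])%fset; set B2 := (A2 `|` [fset p.2 | p in A0])%fset.
have {}h1 := h1 B1 (fsubsetUl _ _); have {}h2 := h2 B2 (fsubsetUl _ _).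
pose K' : choiceType := (I * J)%type.
have := hA ([fset ((i, j) : K') | i in B1, j in B2])%fset.
rewrite big_imfset2 /=; last by move=> [i j] [i' j'] _ _ /= [-> ->].
under eq_bigr do rewrite -cs_mul_sumr.
rewrite -cs_mul_suml; set x := \sum_(i <- B1) _; set y := \sum_(j <- B2) _ => h3.
apply: le_lt_trans (rnorm_tri (cs_mul x y) _ _) _.
have {}h3 : rnorm (cs_mul x y - l) < e / 2.
  rewrite rnormC; apply: h3; apply/fsubsetP => -[i j] ijA; apply/imfset2P; exists i.
    by rewrite inE; apply/orP; right; apply/imfsetP; exists (i, j).
  by exists j => //; rewrite inE; apply/orP; right; apply/imfsetP; exists (i, j).
rewrite [e]splitr ler_ltD //.
have -> : cs_mul a b - cs_mul x y = cs_mul a (b - y) + cs_mul (a - x) y.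
  by rewrite cs_mulBr cs_mulBl addrA subrK.
apply: le_trans (rnormD _ _) _; apply: le_trans (lerD (cs_rnormM _ _) (cs_rnormM _ _)) _.
have := rnorm_tri b y 0; have := rnorm_tri y b 0; rewrite !subr0 [rnorm (y - b)]rnormC.
rewrite -/x -/y in h1 h2; move: h1 h2 de; rewrite /K.
have := rnorm_ge0 a; have := rnorm_ge0 b; have := rnorm_ge0 (a - x); have := rnorm_ge0 (b - y).
have := rnorm_ge0 y; set ax := rnorm (a - x); set bY := rnorm (b - y).
move=> y0 by0 ax0 b0 a0 h1' h2' de t1 t2.
have f1 : rnorm a * bY <= rnorm a * d by rewrite ler_wpM2l // ltW.
have f2 : ax * rnorm y <= d * (rnorm b + 1) by nra.
nra.
Qed.

End HasSumMore.

Section GisL1.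
Variables (R : realType) (E : digraph).
Local Notation comb := (comb R E).
Local Notation L1 := (gis_l1 R E).
Implicit Types (cs ds : comb) (s t : gis E) (f g : L1).

Definition l1bound (f : L1) (M : R) := forall B : {fset gis E}, \sum_(s <- B) cabs (f s) <= M.

Lemma l1P f : sa_dom f <-> exists M, l1bound f M.
Proof.
have ge0 (s : gis E) : (0 <= `| (cabs (f s))%:E |)%E by [].
have absE (s : gis E) : (`| (cabs (f s))%:E |)%E = (cabs (f s))%:E by rewrite gee0_abs ?lee_fin.
rewrite /= /summable; split.
  move=> h; have fn : (\esum_(s in [set: gis E]) `| (cabs (f s))%:E |)%E \is a fin_num.
    by rewrite ge0_fin_numE // esum_ge0.
  exists (fine (\esum_(s in [set: gis E]) `| (cabs (f s))%:E |)%E) => B.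
  rewrite -lee_fin fineK //; apply: esum_ge; exists [set` B].
    by split => //; exact: finite_fset.
  rewrite fsbig_finite ?set_fsetK; last exact: finite_fset.
  by rewrite -sumEFin; apply: lee_sum => s _; rewrite absE.
move=> [M hM]; apply: (@le_lt_trans _ _ M%:E); last exact: ltry.
apply: ge_ereal_sup => _ [X [finX _] <-]; rewrite fsbig_finite //.
under eq_bigr do rewrite absE.
by rewrite sumEFin lee_fin.
Qed.

Lemma l1_lin (c : R[i]) f g M N : l1bound f M -> l1bound g N ->
  l1bound (c *: f + g) (cabs c * M + N).
Proof.
move=> hf hg B.
apply: (@le_trans _ _ (\sum_(s <- B) (cabs c * cabs (f s) + cabs (g s)))).
  by apply: ler_sum => s _; apply: le_trans (cabsD _ _) _; rewrite cabsM.
by rewrite big_split /= -mulr_sumr lerD // ler_wpM2l.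
Qed.

Lemma l1_dom_lin (c : R[i]) f g : sa_dom f -> sa_dom g -> sa_dom (c *: f + g).
Proof. by move=> /l1P[M hM] /l1P[N hN]; apply/l1P; eexists; apply: l1_lin hM hN. Qed.

Definition gdelta t : L1 := fun s => (s == t)%:R.

Lemma l1_delta t : l1bound (gdelta t) 1.
Proof.
move=> B; apply: (@le_trans _ _ (\sum_(s <- [fset t]%fset) cabs (gdelta t s))).
  rewrite (big_fsetID _ (pred1 t)) /= [X in _ + X]big1_seq ?addr0 => [|s].
    by apply: sum_fset_le => //; apply/fsubsetP => s; rewrite !inE /= => /andP[].
  by rewrite !inE /= => /andP[_ /negbTE]; rewrite /gdelta => ->; rewrite cabs0.
by rewrite big_seq_fset1 /gdelta eqxx cabs1.
Qed.

Lemma delta_dom t : sa_dom (gdelta t).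
Proof. by apply/l1P; exists 1; exact: l1_delta. Qed.

Lemma lin_delta_dom cs : sa_dom (lin gdelta cs).
Proof.
elim: cs => [|p cs IH]; last by rewrite lin_cons; apply: l1_dom_lin => //; exact: delta_dom.
by apply/l1P; exists 0 => B; rewrite lin_nil big1 // => s _; rewrite cabs0.
Qed.

Definition restr f (B : {fset gis E}) : comb := [seq (f s, s) | s <- B].

Lemma lin_restr (V : lmodType R[i]) (u : gis E -> V) f B :
  lin u (restr f B) = \sum_(s <- B) f s *: u s.
Proof. by rewrite /lin big_map. Qed.

Lemma restr_delta f B s : lin gdelta (restr f B) s = if s \in B then f s else 0.
Proof.
rewrite lin_restr (_ : _ s = \sum_(t <- B) f t * gdelta t s); last first.
  by elim: (enum_fset B) => [|t r IH]; rewrite ?big_nil // !big_cons -IH.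
case: ifPn => sB.
  rewrite (big_fsetD1 s) //= /gdelta eqxx mulr1 big1_seq ?addr0 // => t.
  by move=> /andP[_]; rewrite !inE eq_sym => /andP[/negbTE -> _]; rewrite mulr0.
rewrite big1_seq // => t /andP[_ tB]; rewrite /gdelta; case: eqP => [e|_]; last by rewrite mulr0.
by rewrite -e in tB; rewrite tB in sB.
Qed.

Lemma l1_tail f (e : R) : sa_dom f -> 0 < e ->
  exists B0 : {fset gis E}, forall B : {fset gis E}, (B0 `<=` B)%fset ->
    l1bound (f - lin gdelta (restr f B)) e.
Proof.
move=> /l1P[M hM] e0; have [A hA] := abs_bounded_tail (fun s => cabs_ge0 (f s)) hM e0.
exists A => B AB C; rewrite (big_fsetID _ (mem B)) /= big1_seq ?add0r => [|s].
  apply: le_trans (_ : \sum_(s <- [fset x in C | x \notin B]%fset) cabs (f s) <= _).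
    apply: ler_sum => s _; rewrite [X in cabs X](_ : _ = f s - lin gdelta (restr f B) s) //.
    by rewrite restr_delta; case: ifP => _; rewrite ?subrr ?cabs0 // subr0.
  by apply/ltW/hA/fdisjointP => s sA; rewrite !inE /= (fsubsetP AB) ?andbF.
rewrite !inE /= => /andP[_ sB].
rewrite [X in cabs X](_ : _ = f s - lin gdelta (restr f B) s) //.
by rewrite restr_delta sB subrr cabs0.
Qed.

Section Apply.
Variables (W : normedModType R[i]) (u : gis E -> W) (K : R).
Hypothesis cW : seq_complete W.
Hypothesis K0 : 0 <= K.
Hypothesis uK : forall s, rnorm (u s) <= K.

Lemma l1_abs f M : l1bound f M -> abs_bounded (fun s => (f s : R[i]) *: u s) (M * K).
Proof.
move=> hM B; apply: (@le_trans _ _ (\sum_(s <- B) cabs (f s) * K)).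
  by apply: ler_sum => s _; rewrite rnormZ ler_wpM2l.
by rewrite -mulr_suml ler_wpM2r.
Qed.

Lemma l1_apply f : sa_dom f -> exists l, has_sum (fun s => (f s : R[i]) *: u s) l.
Proof. by move=> /l1P[M hM]; apply: has_sum_abs cW (l1_abs hM). Qed.

Lemma l1_apply_le f M l : l1bound f M -> has_sum (fun s => (f s : R[i]) *: u s) l ->
  rnorm l <= M * K.
Proof.
move=> hM hl; apply: (has_sum_le hl) => B.
by apply: le_trans (rnorm_sum _ _) _; apply: l1_abs.
Qed.

Lemma l1_apply_delta t : has_sum (fun s => (gdelta t s : R[i]) *: u s) (u t).
Proof.
have := @has_sum_fin _ _ _ (fun s => (gdelta t s : R[i]) *: u s) [fset t]%fset.
rewrite big_seq_fset1 /gdelta eqxx scale1r; apply => s.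
by rewrite inE => /negbTE ->; rewrite scale0r.
Qed.

Lemma l1_apply_lin (c : R[i]) f g l m : has_sum (fun s => (f s : R[i]) *: u s) l ->
  has_sum (fun s => (g s : R[i]) *: u s) m ->
  has_sum (fun s => ((c *: f + g) s : R[i]) *: u s) (c *: l + m).
Proof.
move=> hl hm; apply: has_sum_ext (has_sum_lin c hl hm) => s.
rewrite [(c *: f + g) s](_ : _ = c * f s + g s) //.
by rewrite scalerDl scalerA.
Qed.

Lemma l1_apply_comb cs : has_sum (fun s => (lin gdelta cs s : R[i]) *: u s) (lin u cs).
Proof.
elim: cs => [|p cs IH]; last by rewrite !lin_cons; apply: l1_apply_lin => //; exact: l1_apply_delta.
rewrite !lin_nil; have h := @has_sum_fin R _ W (fun s => ((0 : L1) s : R[i]) *: u s) fset0.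
by rewrite big_seq_fset0 in h; apply: h => s _; rewrite scale0r.
Qed.

End Apply.

Section Rep.
Variables (H : hilbertType R) (Pi : gis E -> H -> H) (pi : L1 -> H -> H).
Hypothesis rPi : gis_rep Pi.
Hypothesis hpi : forall f x, sa_dom f -> has_sum (fun s => (f s : R[i]) *: Pi s x) (pi f x).

Let Pi_le x s : rnorm (Pi s x) <= rnorm x.
Proof.
have [/(_ s)[b l] _ _ _ _] := rPi; apply: le_trans (opnormP _ b) _.
by rewrite -[leRHS]mul1r ler_wpM2r.
Qed.

Lemma l1_rep_comb cs x : pi (lin gdelta cs) x = lin Pi cs x.
Proof.
apply: has_sum_unique (hpi _ (lin_delta_dom cs)) _.
have := l1_apply_comb (fun s => Pi s x) cs; congr has_sum.
by rewrite lin_fctE.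
Qed.

Lemma l1_rep_bounded f : sa_dom f -> bounded_op (pi f).
Proof.
move=> df; have /l1P[M hM] := df; have [bP _ _ _ _] := rPi; split.
  move=> c x y; apply: has_sum_unique (hpi _ df) _.
  apply: has_sum_ext (has_sum_lin c (hpi x df) (hpi y df)) => s.
  by rewrite (bP s).1.1 scalerDr !scalerA mulrC.
exists M => x; exact: (l1_apply_le (rnorm_ge0 x) (Pi_le x) hM (hpi x df)).
Qed.

Lemma l1_rep_lin (c : R[i]) f g x : sa_dom f -> sa_dom g -> pi (c *: f + g) x = c *: pi f x + pi g x.
Proof.
move=> df dg; apply: has_sum_unique (hpi _ (l1_dom_lin c df dg)) _.
by apply: l1_apply_lin; apply: hpi.
Qed.

Lemma l1_rep_le f M : sa_dom f -> l1bound f M -> opnorm (pi f) <= M.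
Proof.
move=> df hM; apply: opnorm_le; [exact: l1_rep_bounded| |move=> x].
  by have := hM fset0; rewrite big_seq_fset0.
exact: (l1_apply_le (rnorm_ge0 x) (Pi_le x) hM (hpi x df)).
Qed.

(** The l^1 norm dominates every representation, so f and a combination at l^1 distance M have
    operator norms that differ by at most M. *)
Lemma l1_rep_near f cs M : sa_dom f -> l1bound (f - lin gdelta cs) M ->
  opnorm (pi f) <= opnorm (lin Pi cs) + M /\ opnorm (lin Pi cs) <= opnorm (pi f) + M.
Proof.
move=> df hM; have dc := lin_delta_dom cs.
have bP s : bounded_op (Pi s) by have [/(_ s)[]] := rPi.
have bl : bounded_op (lin Pi cs) by exact: lin_bounded.
have bp := l1_rep_bounded df.
have dd : sa_dom (f - lin gdelta cs) by apply/l1P; exists M.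
have M0 : 0 <= M by have := hM fset0; rewrite big_seq_fset0.
have e x : pi f x = lin Pi cs x + pi (f - lin gdelta cs) x.
  have -> : f - lin gdelta cs = -1 *: lin gdelta cs + f by rewrite scaleN1r addrC.
  by rewrite l1_rep_lin // l1_rep_comb scaleN1r addrA subrr add0r.
have le x : rnorm (pi (f - lin gdelta cs) x) <= M * rnorm x.
  apply: le_trans (opnormP x (l1_rep_bounded dd)) _.
  by rewrite ler_wpM2r // l1_rep_le.
split; apply: opnorm_le => //; rewrite ?addr_ge0 ?opnorm_ge0 // => x.
  by rewrite e mulrDl; apply: le_trans (rnormD _ _) _; rewrite lerD // opnormP.
have -> : lin Pi cs x = pi f x - pi (f - lin gdelta cs) x by rewrite e addrK.
by rewrite mulrDl; apply: le_trans (rnormD _ _) _; rewrite rnormN lerD // opnormP.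
Qed.

End Rep.

Lemma l1_rep_ex (H : hilbertType R) (Pi : gis E -> H -> H) : gis_rep Pi ->
  exists pi : L1 -> H -> H, forall f x, sa_dom f ->
    has_sum (fun s => (f s : R[i]) *: Pi s x) (pi f x).
Proof.
move=> rPi; exists (fun f x => unc_sum (fun s => (f s : R[i]) *: Pi s x)) => f x df.
have Pi_le s : rnorm (Pi s x) <= rnorm x.
  have [/(_ s)[b l] _ _ _ _] := rPi; apply: le_trans (opnormP _ b) _.
  by rewrite -[leRHS]mul1r ler_wpM2r.
have [l hl] := l1_apply (@seq_completeP R H) (rnorm_ge0 x) Pi_le df.
by rewrite (unc_sumP hl).
Qed.

Lemma gis_cstar_univ (B : cstarAlg R) : is_gis_cstar E B -> exists u : gis E -> B, univ u.
Proof.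
move=> [iota [[il iM iS] den sup]]; pose u s := iota (gdelta s).
have lu cs : lin u cs = iota (lin gdelta cs).
  elim: cs => [|p cs IH]; last by rewrite !lin_cons IH il //; [exact: delta_dom|exact: lin_delta_dom].
  have d0 := lin_delta_dom [::]; rewrite lin_nil in d0.
  by rewrite !lin_nil; have := il (-1) _ _ d0 d0; rewrite scaler0 addr0 scaleN1r addNr.
have up cs : rep_le cs (rnorm (lin u cs)).
  move=> H Pi rPi; have [pi hpi] := l1_rep_ex rPi.
  rewrite lu; have [ub _] := sup _ (lin_delta_dom cs); apply: ub.
  exists H, pi; split; first by exists Pi.
  by congr opnorm; apply/funext => x; rewrite (l1_rep_comb hpi).
have lo cs M : rep_le cs M -> rnorm (lin u cs) <= M.
  move=> h; rewrite lu; have [_] := sup _ (lin_delta_dom cs); apply.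
  move=> _ [H [pi [[Pi [rPi hpi]] ->]]].
  have -> : pi (lin gdelta cs) = lin Pi cs by apply/funext => x; apply: l1_rep_comb hpi _ _.
  exact: h.
(* An element killed by every representation has seminorm 0. This yields the two relations that fail
   for point masses in l^1(S): z = 0 and the Cuntz-Krieger relation. *)
have zero cs : (forall (H : hilbertType R) (Pi : gis E -> H -> H), gis_rep Pi ->
    forall x, lin Pi cs x = 0) -> lin u cs = 0.
  move=> h; apply/rnorm0_eq/eqP; rewrite eq_le rnorm_ge0 andbT; apply: lo => H Pi rPi.
  apply: opnorm_le => // [|x]; last by rewrite (h _ _ rPi) rnorm0 mul0r.
  by apply: lin_bounded => s; have [/(_ s)[]] := rPi.
have deltaM s t : gdelta (gis_mul s t) = sa_mul (gdelta s) (gdelta t).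
  apply/funext => r; apply/esym/unc_sumP.
  have := @has_sum_fin R _ R[i]^o (fun tu : gis E * gis E =>
       if gis_mul tu.1 tu.2 == r then gdelta s tu.1 * gdelta t tu.2 : R[i]^o else 0) [fset (s, t)]%fset.
  rewrite big_seq_fset1 /gdelta !eqxx mulr1 (eq_sym r).
  have -> : (if gis_mul s t == r then 1 else 0) = (gis_mul s t == r)%:R :> R[i] by case: eqP.
  apply=> -[a b]; rewrite inE xpair_eqE negb_and /= => /orP[] /negbTE ->;
    by rewrite ?mul0r ?mulr0 if_same.
exists u; split => //.
- split.
  + by move=> s t; rewrite /u deltaM iM //; exact: delta_dom.
  + move=> s; rewrite /u -iS; last exact: delta_dom.
    congr iota; apply/funext => t /=; rewrite /gdelta conjC_nat.
    by congr (_%:R); rewrite -(inj_eq (inv_inj (@gis_starK E))) gis_starK.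
  + rewrite -(lin1 u); apply: zero => H Pi [_ _ _ _ [h _]] x.
    by rewrite lin1.
  + move=> v fv; pose cs : comb := [:: (1, gpair (pvert v) (pvert v))] ++
      comb_scale (-1) [seq (1, gpair (pedge e) (pedge e)) | e <- fset_set (out_edges v)].
    have ce (V : lmodType R[i]) (w : gis E -> V) : lin w cs = w (gpair (pvert v) (pvert v)) -
        \sum_(e <- fset_set (out_edges v)) w (gpair (pedge e) (pedge e)).
      rewrite lin_cat lin1 lin_scale scaleN1r; congr (_ - _).
      by rewrite /lin big_map; apply: eq_bigr => e _; rewrite scale1r.
    apply/eqP; rewrite -subr_eq0 -ce; apply/eqP/zero => H Pi [_ _ _ _ [_ h]] x.
    rewrite ce (_ : _ x = Pi (gpair (pvert v) (pvert v)) x -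
        \sum_(e <- fset_set (out_edges v)) Pi (gpair (pedge e) (pedge e)) x).
      by rewrite h // fsbig_fset // subrr.
    rewrite [LHS](_ : _ = Pi (gpair (pvert v) (pvert v)) x -
      (\sum_(e <- fset_set (out_edges v)) Pi (gpair (pedge e) (pedge e))) x) //; congr (_ - _).
    by elim: (enum_fset _) => [|e r IH]; rewrite ?big_nil // !big_cons -IH.
move=> a e e0; have ep := divr_gt0 e0 (ltr0Sn R 1).
have /dense_rnorm/(_ a _ ep)[_ [f df <-] fa] := den.
have [B0 hB] := l1_tail df ep; have {}hB := hB B0 (fsubset_refl _).
exists (restr f B0); set cs := restr f B0.
have dc := lin_delta_dom cs.
have dd : sa_dom (f - lin gdelta cs) by apply/l1P; exists (e / 2).
apply: le_lt_trans (rnorm_tri (iota f) _ _) _; rewrite [e]splitr ler_ltD //.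
rewrite rnormC lu.
have -> : iota f - iota (lin gdelta cs) = iota (f - lin gdelta cs).
  have := il (-1) _ _ dc df; rewrite !scaleN1r addrC => ->; by rewrite addrC.
have [_] := sup _ dd; apply => _ [H [pi [[Pi [rPi hpi]] ->]]].
exact: l1_rep_le rPi hpi _ _ dd hB.
Qed.

Lemma univ_gis_cstar (A : cstarAlg R) (u : gis E -> A) : univ u -> is_gis_cstar E A.
Proof.
move=> uu; have [fu den up lo] := uu; have [uM uS u0 uF] := fu.
have u1 s : rnorm (u s) <= 1 by exact: family_norm.
pose iota (f : L1) := unc_sum (fun s => (f s : R[i]) *: u s).
have iP f : sa_dom f -> has_sum (fun s => (f s : R[i]) *: u s) (iota f).
  by move=> df; have [l hl] := l1_apply (@seq_completeP R A) ler01 u1 df; rewrite /iota (unc_sumP hl).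
have ic cs : iota (lin gdelta cs) = lin u cs by apply/unc_sumP/l1_apply_comb.
have il (c : R[i]) f g : sa_dom f -> sa_dom g -> iota (c *: f + g) = c *: iota f + iota g.
  by move=> df dg; apply/unc_sumP/l1_apply_lin; apply: iP.
have near f cs M : sa_dom f -> l1bound (f - lin gdelta cs) M -> rnorm (iota f - lin u cs) <= M.
  move=> df hM; have dc := lin_delta_dom cs.
  have dd : sa_dom (f - lin gdelta cs) by apply/l1P; exists M.
  have -> : iota f - lin u cs = iota (f - lin gdelta cs).
    rewrite -ic; have := il (-1) _ _ dc df; rewrite !scaleN1r addrC => ->; by rewrite addrC.
  by have := l1_apply_le ler01 u1 hM (iP _ dd); rewrite mulr1.
exists iota; split.
- split => //.
  + move=> f g df dg; apply/unc_sumP.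
    have /l1P[M hM] := df; have /l1P[N hN] := dg.
    have bf := l1_abs ler01 u1 hM; have bg := l1_abs ler01 u1 hN.
    pose F (p : gis E * gis E) := cs_mul ((f p.1 : R[i]) *: u p.1) ((g p.2 : R[i]) *: u p.2).
    have FE p : F p = (f p.1 * g p.2 : R[i]) *: u (gis_mul p.1 p.2).
      by rewrite /F cs_mulZl cs_mulZr scalerA uM.
    have hF : has_sum F (cs_mul (iota f) (iota g)) := has_sum_prod bf bg (iP _ df) (iP _ dg).
    have bF : abs_bounded F (M * 1 * (N * 1)).
      move=> B; have hp : \sum_(p <- B) rnorm ((f p.1 : R[i]) *: u p.1) *
          rnorm ((g p.2 : R[i]) *: u p.2) <= M * 1 * (N * 1).
        exact: (@sum_fset_pair R _ _ (fun s => rnorm ((f s : R[i]) *: u s))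
          (fun s => rnorm ((g s : R[i]) *: u s)) _ _ B (fun=> rnorm_ge0 _) (fun=> rnorm_ge0 _) bf bg).
      by apply: le_trans hp; apply: ler_sum => p _; exact: cs_rnormM.
    (* Grouping the pairs by their product makes the coefficient of [u s] the convolution at s. *)
    apply: (has_sum_fiber (h := fun p : gis E * gis E => gis_mul p.1 p.2) bF hF) => s.
    pose c (p : gis E * gis E) : R[i]^o :=
      if gis_mul p.1 p.2 == s then f p.1 * g p.2 : R[i]^o else 0.
    have [l hl] : exists l, has_sum c l.
      apply: (@has_sum_abs _ _ _ _ (M * N) (@seq_completeC R)) => B.
      have hp : \sum_(p <- B) cabs (f p.1) * cabs (g p.2) <= M * N.
        exact: (@sum_fset_pair R _ _ (fun s => cabs (f s)) (fun s => cabs (g s)) _ _ B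
          (fun=> cabs_ge0 _) (fun=> cabs_ge0 _) hM hN).
      apply: le_trans hp; apply: ler_sum => p _; rewrite /c; case: ifP => _.
        by rewrite [leLHS]cabsM.
      by rewrite rnorm0 mulr_ge0.
    have -> : sa_mul f g s = l by apply: unc_sumP.
    have := @has_sum_map R _ R[i]^o A (fun a : R[i]^o => (a : R[i]) *: u s) 1 c l _ _ hl.
    move=> h; apply: has_sum_ext (h _ _) => [p|x y|x].
    * rewrite /c; case: eqP => [<-|_]; last by rewrite scale0r.
      by rewrite FE.
    * by rewrite scalerBl.
    * by rewrite rnormZ mul1r -[leRHS]mulr1 ler_wpM2l.
  + move=> f df; apply/unc_sumP.
    have := has_sum_map (T := @cs_star R A) (M := 1) _ _ (iP f df).
    move=> h; have {}h := has_sum_reindex (@gis_starK E) (h (@cs_starB R A) _).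
    apply: has_sum_ext (h _) => [s|x]; last by rewrite mul1r cs_rnorm_star.
    by rewrite /= cs_starZ -uS gis_starK.
- apply/dense_rnorm => a e e0; have [cs hcs] := den a e e0.
  exists (iota (lin gdelta cs)); last by rewrite ic.
  by exists (lin gdelta cs) => //; exact: lin_delta_dom.
move=> f df; split.
  move=> _ [H [pi [[Pi [rPi hpi]] ->]]]; apply/ler_addgt0Pr => e e0.
  have ep := divr_gt0 e0 (ltr0Sn R 1).
  have [B0 hB] := l1_tail df ep; have {}hB := hB B0 (fsubset_refl _).
  have [h1 _] := l1_rep_near rPi hpi df hB.
  have h2 := near _ _ _ df hB; have h3 := up (restr f B0) _ _ rPi.
  have := rnormB_ge (lin u (restr f B0)) (iota f); rewrite rnormC; lra.
move=> M ubM; apply/ler_addgt0Pr => e e0.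
have ep := divr_gt0 e0 (ltr0Sn R 1).
have [B0 hB] := l1_tail df ep; have {}hB := hB B0 (fsubset_refl _).
have h2 := near _ _ _ df hB.
have h3 : rnorm (lin u (restr f B0)) <= M + e / 2.
  apply: lo => H Pi rPi; have [pi hpi] := l1_rep_ex rPi.
  have [_ h1] := l1_rep_near rPi hpi df hB.
  apply: le_trans h1 _; rewrite lerD2r; apply: ubM; exists H, pi; split => //.
  by exists Pi.
have := rnormB_ge (iota f) (lin u (restr f B0)); lra.
Qed.

End GisL1.

(** * The graph algebra *)

Section Contractive.
Variables (R : realType) (A : cstarAlg R).
Implicit Types a b y : A.

(* A quadratic equation [2 y - y^2 = b], standing in for [y = 1 - sqrt (1 - b)],
   solved by iterating [y |-> (b + y^2) / 2]. *)
Lemma quad_root b (r : R) : 0 < r -> r < 1 -> cs_star b = b -> rnorm b <= 2 * r - r ^+ 2 ->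
  exists2 y, cs_star y = y & b = 2 *: y - cs_mul y y.
Proof.
move=> r0 r1 bS bn.
pose h : R[i] := (2^-1)%:C.
have ch : cabs h = 2^-1 by rewrite cabsR ger0_norm // invr_ge0.
pose F y := h *: (b + cs_mul y y).
pose y n := iter n F 0.
have yS n : cs_star (y n) = y n.
  elim: n => [|n IH]; first exact: cs_star0.
  rewrite /= cs_starZ cs_starD bS cs_starM IH.
  by congr (_ *: _); rewrite conj_Creal // complex_real.
(* If |y| <= r then (|b| + r^2) / 2 <= r; this is the origin of the bound 2 r - r^2. On the ball of
   radius r the iteration contracts by the factor r. *)
have yn n : rnorm (y n) <= r.
  elim: n => [|n IH]; first by rewrite rnorm0 ltW.
  rewrite /= rnormZ ch; have := rnormD b (cs_mul (y n) (y n)).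
  have := cs_rnormM (y n) (y n); have := rnorm_ge0 (y n); move: IH bn.
  by rewrite -/(y n); nra.
have step m n : rnorm (y m.+1 - y n.+1) <= r * rnorm (y m - y n).
  rewrite /= -scalerBr rnormZ ch opprD addrACA subrr add0r.
  have -> : cs_mul (y m) (y m) - cs_mul (y n) (y n) =
      cs_mul (y m - y n) (y m) + cs_mul (y n) (y m - y n).
    by rewrite cs_mulBl cs_mulBr addrA subrK.
  have := rnormD (cs_mul (y m - y n) (y m)) (cs_mul (y n) (y m - y n)).
  have := cs_rnormM (y m - y n) (y m); have := cs_rnormM (y n) (y m - y n).
  have := yn m; have := yn n; have := rnorm_ge0 (y m - y n).
  set d := rnorm (y m - y n); set a1 := rnorm (y m); set a2 := rnorm (y n).
  move=> d0 h1 h2; have : a2 * d <= r * d by rewrite ler_wpM2r.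
  have : d * a1 <= r * d by rewrite mulrC ler_wpM2r.
  by lra.
have geo n m : rnorm (y (n + m)%N - y n) <= r ^+ n.
  elim: n m => [|n IH] m; first by rewrite add0n /= subr0 expr0 (le_trans (yn m)) // ltW.
  rewrite addSn; apply: le_trans (step _ _) _; rewrite exprS ler_wpM2l //; exact: ltW.
have [l hl] : exists l, slim y l.
  apply: (@seq_completeP R A) => e e0.
  have /cvgrPdist_lt/(_ _ (divr_gt0 e0 (ltr0Sn R 1)))[n0 _ hn0] : (fun n => r ^+ n) @ \oo --> (0 : R).
    by apply: cvg_expr; rewrite ger0_norm // ltW.
  have hn := hn0 n0 (leqnn _).
  rewrite /= sub0r normrN ger0_norm ?exprn_ge0 ?ltW // in hn.
  exists n0 => m n /subnKC <- /subnKC <-.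
  apply: le_lt_trans (rnorm_tri (y n0) _ _) _; rewrite [rnorm (y n0 - _)]rnormC.
  by rewrite [e]splitr ltrD // (le_lt_trans (geo _ _)).
have lS : cs_star l = l.
  apply: (slim_unique (u := y)) => // e /hl[n0 h0]; exists n0 => n /h0.
  by rewrite -{2}(yS n) -cs_starB cs_rnorm_star.
have ln : rnorm l <= r.
  apply/ler_addgt0Pr => e /hl[n0 h0]; have := h0 n0 (leqnn _); have := yn n0.
  by have := rnormB_ge l (y n0); rewrite rnormC; lra.
have lF : l = F l.
  apply: rnorm_lt_eq => e e0; have [n0 h0] := hl _ (divr_gt0 e0 (ltr0Sn R 1)).
  apply: le_lt_trans (rnorm_tri (y n0.+1) _ _) _; rewrite rnormC [e]splitr ltrD ?h0 //.
  rewrite /= /F -scalerBr rnormZ ch opprD addrACA subrr add0r -/(y n0).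
  have -> : cs_mul (y n0) (y n0) - cs_mul l l =
      cs_mul (y n0 - l) (y n0) + cs_mul l (y n0 - l).
    by rewrite cs_mulBl cs_mulBr addrA subrK.
  have := rnormD (cs_mul (y n0 - l) (y n0)) (cs_mul l (y n0 - l)).
  have := cs_rnormM (y n0 - l) (y n0); have := cs_rnormM l (y n0 - l).
  have := h0 n0 (leqnn _); have := yn n0; have := rnorm_ge0 (y n0 - l).
  set d := rnorm (y n0 - l); set a1 := rnorm (y n0); set a2 := rnorm l in ln *.
  move=> d0 h1 h2; have : a2 * d <= 1 * d by rewrite ler_wpM2r // (le_trans ln) // ltW.
  have : d * a1 <= 1 * d by rewrite mulrC ler_wpM2r // (le_trans h1) // ltW.
  by lra.
exists l => //; suff <- : b + cs_mul l l = 2 *: l by rewrite addrK.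
rewrite [in RHS]lF /F scalerA /h (_ : 2 * _ = 1) ?scale1r //.
have -> : 2 = (2%:R : R)%:C :> R[i] by rewrite rmorph_nat.
by rewrite -rmorphM mulfV.
Qed.

(** For a of norm below 1 write a* a = 2 y - y^2 with y self-adjoint. Then |k(a) x|^2 = |x|^2 - |x -
    k(y) x|^2 <= |x|^2. The unit occurs only as the identity operator, so A may be nonunital;
    scaling gives the general case. *)
Lemma star_hom_contractive (H : hilbertType R) (k : A -> opalg H) :
  star_hom (B := cstar_star A) k -> forall a, rnorm (k a) <= rnorm a.
Proof.
move=> kh; have k0 := star_hom0 kh; have [kl kM kS] := kh.
have kZ (c : R[i]) a : k (c *: a) = c *: k a.
  by have := kl c a 0 Logic.I Logic.I; rewrite k0 !addr0.
have small (r : R) a : 0 < r -> r < 1 -> rnorm a ^+ 2 <= 2 * r - r ^+ 2 ->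
    forall x, rnorm (opval (k a) x) <= rnorm x.
  move=> r0 r1 an x.
  have bS : cs_star (cs_mul (cs_star a) a) = cs_mul (cs_star a) a by rewrite cs_starM cs_starK.
  have [|y yS ye] := quad_root r0 r1 bS; first by rewrite cs_rnormC.
  have e1 : k (cs_mul (cs_star a) a) = cs_mul (cs_star (k a)) (k a).
    by rewrite -kS // -kM.
  have e2 : k (cs_mul (cs_star a) a) = 2 *: k y - cs_mul (k y) (k y).
    rewrite ye; have := kl (-1) (cs_mul y y) (2 *: y) Logic.I Logic.I.
    by rewrite !scaleN1r addrC => ->; rewrite kZ [k (cs_mul y y)]kM // addrC.
  pose Y := opval (k y).
  have YS x1 x2 : hdot (Y x1) x2 = hdot x1 (Y x2).
    have := opval_adj (k y) x1 x2; rewrite -/Y => ->.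
    by rewrite -[opstar _]/(cs_star (k y)) -kS // [sa_star _]yS.
  have d1 : hdot (opval (k (cs_mul (cs_star a) a)) x) x = (rnorm (opval (k a) x) ^+ 2)%:C.
    by rewrite e1 -hdotxx; exact: (adjoint_sym (opval_adj (k a)) (opval (k a) x) x).
  have d2 : hdot (opval (k (cs_mul (cs_star a) a)) x) x =
      (rnorm x ^+ 2)%:C - (rnorm (x - Y x) ^+ 2)%:C.
    rewrite e2 -!hdotxx opvalD opvalN opvalZ -/Y.
    rewrite (_ : opval (cs_mul (k y) (k y)) x = Y (Y x)) //.
    rewrite !hdotBl !hdotBr hdotZl !YS; ring.
  have : rnorm (opval (k a) x) ^+ 2 = rnorm x ^+ 2 - rnorm (x - Y x) ^+ 2.
    by apply: complexI; rewrite -d1 d2 rmorphB.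
  have := sqr_ge0 (rnorm (x - Y x)) => h1 h2.
  by rewrite -(@ler_pXn2r _ 2) ?nnegrE ?rnorm_ge0 // h2; lra.
move=> a; apply: op_rnorm_le => // x.
rewrite -(@ler_pXn2r _ 2) ?nnegrE ?mulr_ge0 ?rnorm_ge0 // exprMn.
have [a0|/eqP a0] := eqVneq (rnorm a) 0.
  by rewrite (rnorm0_eq a0) k0 !rnorm0 expr0n mul0r.
have ap : 0 < rnorm a by rewrite lt_def rnorm_ge0 andbT; apply/eqP.
set N := rnorm (opval (k a) x) ^+ 2; set Q := _ * _.
have N0 : 0 <= N by exact: sqr_ge0.
apply/ler_addgt0Pr => e e0.
(* With r = 1 - t the element a is rescaled to squared norm 2 r - r^2 = 1 - t^2; the loss t^2 N is
   at most t N <= e. *)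
pose t := Num.min 2^-1 (e / (N + 1)).
have t0 : 0 < t by rewrite lt_min invr_gt0 ltr0n divr_gt0 // ltr_wpDl.
have t1 : t <= 2^-1 by rewrite ge_min lexx.
have tN : t * N <= e.
  apply: (@le_trans _ _ (e / (N + 1) * N)); first by rewrite ler_wpM2r // ge_min lexx orbT.
  by rewrite mulrAC ler_pdivrMr ?ltr_wpDl // ler_wpM2l ?lerDl // ltW.
pose r := 1 - t.
have h21 : (2^-1 : R) < 1 by rewrite invf_lt1 ?ltr1n.
have r0 : 0 < r by rewrite /r; lra.
have r1 : r < 1 by rewrite /r; lra.
pose be := 2 * r - r ^+ 2; have be0 : 0 < be by rewrite /be; nra.
have sb : Num.sqrt be ^+ 2 = be by rewrite sqr_sqrtr // ltW.
pose c := Num.sqrt be / rnorm a.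
have c0 : 0 <= c by rewrite divr_ge0 ?sqrtr_ge0.
have := small r (c%:C *: a) r0 r1.
have -> : rnorm (c%:C *: a) ^+ 2 = be.
  by rewrite rnormZ cabsR ger0_norm // /c divfK ?sb //; apply/eqP.
move=> /(_ (lexx _) x); rewrite kZ opvalZ rnormZ cabsR ger0_norm // => h.
have {}h : be * N <= Q.
  have : (c * rnorm (opval (k a) x)) ^+ 2 <= rnorm x ^+ 2.
    by rewrite ler_pXn2r ?nnegrE ?mulr_ge0 ?rnorm_ge0 ?invr_ge0 ?rnorm_ge0 ?sqrtr_ge0.
  rewrite exprMn -/N /c exprMn sb.
  by rewrite exprVn mulrAC ler_pdivrMr ?exprn_gt0 // [leRHS]mulrC.
have : be = 1 - t ^+ 2 by rewrite /be /r; ring.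
move=> eb; rewrite eb in h; have : t ^+ 2 * N <= t * N.
  by rewrite ler_wpM2r // expr2; have := ltW t0; nra.
by nra.
Qed.

End Contractive.

(** * Passage between graph relations and semigroup families *)

Section GraphFamily.
Variables (R : realType) (E : digraph).
Implicit Types (v : vert E) (e f : edge E) (es fs : seq (edge E)) (a b c d : fpath E).

Section InCstar.
Variables (D : cstarAlg R) (p : vert E -> D) (s : edge E -> D).
Local Notation "x ** y" := (cs_mul x y) (at level 40, left associativity).

Definition graph_family : Prop :=
  [/\ forall v, cs_star (p v) = p v /\ p v ** p v = p v,
      forall v w, v <> w -> p v ** p w = 0,
      (forall e, cs_star (s e) ** s e = p (rng e)) /\
      (forall e f, e <> f -> s e ** cs_star (s e) ** (s f ** cs_star (s f)) = 0),
      forall v, Vfin v -> p v = \sum_(e <- fset_set (out_edges v)) s e ** cs_star (s e)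
    & forall e, p (src e) ** (s e ** cs_star (s e)) = s e ** cs_star (s e)].

(** The product of the s e along the walk, closed by the projection of the last vertex; the factor
    makes length 0 uniform and is absorbed otherwise, by [gf_sp]. *)
Fixpoint walk_elt v es : D := if es is e :: es' then s e ** walk_elt (rng e) es' else p v.
Definition path_elt a : D := walk_elt (psrc a) (pedges a).
Definition path_family (t : gis E) : D :=
  if t is Some q then path_elt (val q).1 ** cs_star (path_elt (val q).2) else 0.

Hypothesis gf : graph_family.

Lemma gf_pS v : cs_star (p v) = p v. Proof. by have [/(_ v)[]] := gf. Qed.
Lemma gf_pp v : p v ** p v = p v. Proof. by have [/(_ v)[]] := gf. Qed.
Lemma gf_ss e : cs_star (s e) ** s e = p (rng e). Proof. by have [_ _ []] := gf. Qed.

(** By the C*-identity: with p = s* s, the element d = s - s p has d* d = p - p - p + p = 0. *)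
Lemma gf_sp e : s e ** p (rng e) = s e.
Proof.
apply/eqP; rewrite -subr_eq0; apply/eqP/rnorm0_eq/eqP.
rewrite -sqrf_eq0 -cs_rnormC cs_starB cs_starM gf_pS !cs_mulBl !cs_mulBr.
rewrite -!cs_mulA !(cs_mulA (cs_star (s e)) (s e)) gf_ss gf_pp.
by rewrite gf_pp !subrr rnorm0.
Qed.

Lemma gf_sss e : s e ** cs_star (s e) ** s e = s e.
Proof. by rewrite -cs_mulA gf_ss gf_sp. Qed.

Lemma gf_ps e : p (src e) ** s e = s e.
Proof. by have [_ _ _ _ h] := gf; rewrite -{1}(gf_sss e) !cs_mulA -(cs_mulA (p _)) h gf_sss. Qed.

(** Insert s_e* = s_e* s_e s_e* and s_f = s_f s_f* s_f: the two range projections meet in the middle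
    and are orthogonal. *)
Lemma gf_s0 e f : e <> f -> cs_star (s e) ** s f = 0.
Proof.
have [_ _ [_ h] _ _] := gf; move=> /h ef.
have e1 : cs_star (s e) ** (s e ** cs_star (s e)) = cs_star (s e).
  by rewrite -[in RHS](gf_sss e) !cs_starM cs_starK cs_mulA.
rewrite -(gf_sss f) -e1.
have -> : cs_star (s e) ** (s e ** cs_star (s e)) ** (s f ** cs_star (s f) ** s f) =
   cs_star (s e) ** (s e ** cs_star (s e) ** (s f ** cs_star (s f))) ** s f.
  by rewrite !cs_mulA.
by rewrite ef cs_mul0r cs_mul0l.
Qed.

Lemma walk_src v es : is_walk v es -> p v ** walk_elt v es = walk_elt v es.
Proof. by case: es => [|e es] /=; rewrite ?gf_pp // => /andP[/eqP <- _]; rewrite cs_mulA gf_ps. Qed.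

Lemma walk_rng v es : is_walk v es ->
  walk_elt v es ** p (last v [seq rng e | e <- es]) = walk_elt v es.
Proof.
elim: es v => [|e es IH] v /=; first by rewrite gf_pp.
by move=> /andP[_ /IH h]; rewrite -cs_mulA h.
Qed.

Lemma walk_cat v es fs : is_walk v es -> is_walk (last v [seq rng e | e <- es]) fs ->
  walk_elt v (es ++ fs) = walk_elt v es ** walk_elt (last v [seq rng e | e <- es]) fs.
Proof.
elim: es v => [|e es IH] v /=; first by move=> _ h; rewrite walk_src.
by move=> /andP[_ w1] w2; rewrite IH // cs_mulA.
Qed.

Lemma walk_iso v es : is_walk v es ->
  cs_star (walk_elt v es) ** walk_elt v es = p (last v [seq rng e | e <- es]).
Proof.
elim: es v => [|e es IH] v /=; first by rewrite gf_pS gf_pp.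
move=> /andP[_ w]; rewrite cs_starM -cs_mulA (cs_mulA (cs_star (s e))) gf_ss.
by rewrite walk_src // IH.
Qed.

(** Common initial edges cancel by s_e* s_e = p(r(e)). What is left starts at different vertices or
    with different edges, and the product is 0. *)
Lemma walk_disj v w es fs : is_walk v es -> is_walk w fs ->
  ~~ ((v == w) && prefix es fs) -> ~~ ((w == v) && prefix fs es) ->
  cs_star (walk_elt v es) ** walk_elt w fs = 0.
Proof.
have [_ pw _ _ _] := gf.
have [<-|/eqP vw w1 w2 _ _] := eqVneq v w; last first.
  rewrite -(walk_src w1) -(walk_src w2) cs_starM gf_pS.
  by rewrite -cs_mulA (cs_mulA (p v)) pw // cs_mul0l cs_mul0r.
elim: es fs v => [|e es IH] [|f fs] v //= /andP[sv w1] /andP[_ w2].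
rewrite cs_starM -cs_mulA (cs_mulA (cs_star (s e))).
move: w2; have [<- w2|/eqP ef _ _ _] := eqVneq e f; last by rewrite gf_s0 // cs_mul0l cs_mul0r.
move=> /= h1 h2; rewrite gf_ss walk_src //.
exact: IH.
Qed.

Lemma path_star_vert a : path_elt a ** p (prng a) = path_elt a.
Proof. exact/walk_rng/pwalk. Qed.

Lemma path_iso a : cs_star (path_elt a) ** path_elt a = p (prng a).
Proof. exact/walk_iso/pwalk. Qed.

Lemma path_elt_cat a b : prng a = psrc b -> path_elt (pcat a b) = path_elt a ** path_elt b.
Proof.
move=> h; rewrite /path_elt psrc_pcat // pedges_pcat // walk_cat -/(prng a) ?h //; exact: pwalk.
Qed.

Lemma path_family_pair a b : prng a = prng b ->
  path_family (gpair a b) = path_elt a ** cs_star (path_elt b).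
Proof. by move=> h; rewrite (gpair_val h). Qed.

Lemma path_elt_vert v : path_elt (pvert v) = p v. Proof. by []. Qed.
Lemma path_elt_edge e : path_elt (pedge e) = s e. Proof. exact: gf_sp. Qed.

Lemma path_familyP : gis_family path_family.
Proof.
split.
- move=> t1 t2; case: (gisP t1) => [|a b h]; first by rewrite cs_mul0l.
  case: (gisP t2) => [|c d k]; first by rewrite gis_muls0 cs_mul0r.
  rewrite (path_family_pair h) (path_family_pair k).
  have [/prefixP_cat[m hm eb]|nc] := boolP (is_prefix c b).
    subst b; rewrite prng_pcat // in h; have dm : prng d = psrc m by rewrite -k.
    rewrite (gis_mulEl hm h k) path_family_pair ?prng_pcat // !path_elt_cat //.
    rewrite !cs_starM -!cs_mulA (cs_mulA (cs_star (path_elt c))) path_iso k.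
    by rewrite -{1}(path_star_vert d) cs_starM gf_pS.
  have [/prefixP_cat[m hm ec]|nb] := boolP (is_prefix b c).
    subst c; rewrite prng_pcat // in k; have am : prng a = psrc m by rewrite h.
    rewrite (gis_mulEr hm h k) path_family_pair ?prng_pcat // !path_elt_cat //.
    rewrite -!cs_mulA (cs_mulA (cs_star (path_elt b))) path_iso -h.
    by rewrite (cs_mulA (p _)) !cs_mulA path_star_vert.
  rewrite gis_mul_disj // -cs_mulA (cs_mulA (cs_star (path_elt b))).
  by rewrite walk_disj ?cs_mul0l ?cs_mul0r //; exact: pwalk.
- move=> t; case: (gisP t) => [|a b h]; first by rewrite cs_star0.
  by rewrite gis_star_pair // !path_family_pair // cs_starM cs_starK.
- by [].
- move=> v fv; rewrite path_family_pair // path_elt_vert gf_pS gf_pp.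
  have [_ _ _ -> // _] := gf; apply: eq_bigr => e _.
  by rewrite path_family_pair // path_elt_edge.
Qed.

End InCstar.

Lemma gis_graph_family (D : cstarAlg R) (w : gis E -> D) : gis_family w ->
  graph_family (fun v => w (gpair (pvert v) (pvert v)))
    (fun e => w (gpair (pedge e) (pvert (rng e)))).
Proof.
move=> [wM wS w0 wF]; pose ee e : prng (pedge e) = prng (pvert (rng e)) := erefl.
have vv v : gis_mul (gpair (pvert v) (pvert v)) (gpair (pvert v) (pvert v)) = gpair (pvert v) (pvert v).
  by rewrite gis_mul_mid.
have sS e : cs_star (w (gpair (pedge e) (pvert (rng e)))) = w (gpair (pvert (rng e)) (pedge e)).
  by rewrite -wS gis_star_pair.
have ssE e : cs_mul (w (gpair (pedge e) (pvert (rng e))))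
    (cs_star (w (gpair (pedge e) (pvert (rng e))))) = w (gpair (pedge e) (pedge e)).
  by rewrite sS -wM gis_mul_mid.
split.
- by move=> v; rewrite -wS -wM gis_star_pair // vv.
- move=> v v' n; rewrite -wM gis_mul_disj // /is_prefix /psrc /= andbT.
    by apply/eqP => h; apply: n.
  by apply/eqP.
- split=> [e|e f ef]; first by rewrite sS -wM gis_mul_mid.
  rewrite !ssE -wM gis_mul_disj //.
    by apply/negP => /andP[_]; rewrite /pedges /= andbT => /eqP h; apply: ef.
  by apply/negP => /andP[_]; rewrite /pedges /= andbT => /eqP h; apply: ef.
- by move=> v fv; rewrite wF //; apply: eq_bigr => e _; rewrite ssE.
- move=> e; rewrite ssE -wM.
  have := @gis_mulEr E (pvert (src e)) (pvert (src e)) (pedge e) (pedge e).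
  by rewrite vert_pcat // => ->.
Qed.

Lemma path_elt_gis (D : cstarAlg R) (w : gis E -> D) a : gis_family w ->
  path_elt (fun v => w (gpair (pvert v) (pvert v)))
    (fun e => w (gpair (pedge e) (pvert (rng e)))) a = w (gpair a (pvert (prng a))).
Proof.
move=> fw; have [wM wS w0 wF] := fw.
case: a => -[v es] /= wes; rewrite /path_elt /psrc /pedges /=.
elim: es v wes => [|e es IH] v wes //=.
  by congr (w (gpair _ _)); apply: path_ext.
have /andP[/eqP sv w1] := wes; have m0 : is_walk (rng e, es).1 (rng e, es).2 by [].
rewrite (IH _ w1) -wM.
set m := FPath _; have mE : @FPath E (v, e :: es) wes = pcat (pedge e) m.
  by apply: path_ext; rewrite ?psrc_pcat ?pedges_pcat // psrc_pedge sv.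
have := @gis_mulEr E (pedge e) (pvert (rng e)) m (pvert (prng m)).
rewrite vert_pcat // => -> //; rewrite mE; congr (w (gpair _ _)).
by rewrite prng_pcat.
Qed.

(** Every pair is a product of edge elements and adjoints, so a semigroup family is determined by
    its graph part. This carries the universal property from one presentation to the other. *)
Lemma path_family_gis (D : cstarAlg R) (w : gis E -> D) t : gis_family w ->
  path_family (fun v => w (gpair (pvert v) (pvert v)))
    (fun e => w (gpair (pedge e) (pvert (rng e)))) t = w t.
Proof.
move=> fw; have [wM wS w0 _] := fw; case: (gisP t) => [|a b h]; first by rewrite w0.
rewrite path_family_pair // !path_elt_gis // -wS -wM gis_star_pair // h gis_mul_mid ?h //.
Qed.

Lemma path_family_hom (A D : cstarAlg R) (k : A -> D) p s t :
  star_hom (B := cstar_star A) k ->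
  k (path_family p s t) = path_family (fun v => k (p v)) (fun e => k (s e)) t.
Proof.
move=> kh; have [kl kM kS] := kh.
have kw v es : k (walk_elt p s v es) = walk_elt (fun v => k (p v)) (fun e => k (s e)) v es.
  by elim: es v => [|e es IH] v //=; rewrite [k _]kM // IH.
case: t => [q|]; last exact: star_hom0.
by rewrite [LHS]kM // [X in cs_mul _ X]kS // !kw.
Qed.

Lemma star_rep_hom (A : cstarAlg R) (H : hilbertType R) (phi : cstar_star A -> H -> H) :
  star_rep phi -> exists2 k : A -> opalg H, star_hom (B := cstar_star A) k &
    forall a : A, opval (k a) = phi a.
Proof.
move=> [pb pl pM pS].
have ad (a : A) : adjointable (phi a).
  by split; [exact: pb|exists (phi (cs_star a)); [exact: pb|exact: pS]].
exists (fun a : A => @SB R (op_subBanach H) _ (ad a)) => //; split.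
- by move=> c a b _ _; apply: opval_ext => x; apply: pl.
- by move=> a b _ _; apply: opval_ext => x; apply: pM.
- by move=> a _; apply/esym/opval_star_eq; apply: pS.
Qed.

Lemma star_hom_rep (A : cstarAlg R) (H : hilbertType R) (k : A -> opalg H) :
  star_hom (B := cstar_star A) k -> star_rep (B := cstar_star A) (fun a : A => opval (k a)).
Proof.
move=> [kl kM kS]; split.
- by move=> a _; exact: opval_bounded.
- by move=> c a b x _ _; rewrite kl.
- by move=> a b x _ _; rewrite kM.
- by move=> a _; rewrite kS //; exact: opval_adj.
Qed.

Lemma graph_rep_family (H : hilbertType R) (P : vert E -> H -> H) (S : edge E -> H -> H) :
  graph_rep P S -> exists p s, [/\ @graph_family (opalg H) p s,
    forall v, opval (p v) = P v & forall e, opval (s e) = S e].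
Proof.
move=> [Sa [[Pp Po Sb Sad] [_ So] SP PF PS]].
have adP v : adjointable (P v) by have [b a _] := Pp v; split => //; exists (P v).
have adS e : adjointable (S e) by split; [exact: (Sb e).1|exists (Sa e); [exact: (Sb e).2|]].
pose p v : opalg H := @SB R (op_subBanach H) _ (adP v).
pose s e : opalg H := @SB R (op_subBanach H) _ (adS e).
have sS e x : opval (cs_star (s e)) x = Sa e x.
  by rewrite (adjoint_uniq (opval_adj (s e)) (Sad e)).
exists p, s; split => //; split.
- move=> v; have [b a i] := Pp v; split; first exact: opval_star_eq.
  by apply: opval_ext.
- by move=> v w n; apply: opval_ext => x; apply: Po.
- split=> [e|e f ef]; apply: opval_ext => x.
    by have := SP e x; rewrite -sS.
  by have := So e f x ef; rewrite -!sS.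
- move=> v fv; apply: opval_ext => x; rewrite opval_sum [LHS]PF // fsbig_fset //.
  by apply: eq_bigr => e _; rewrite -sS.
- by move=> e; apply: opval_ext => x; have := PS e x; rewrite -sS.
Qed.

Lemma family_graph_rep (H : hilbertType R) (p : vert E -> opalg H) (s : edge E -> opalg H) :
  graph_family p s -> graph_rep (fun v => opval (p v)) (fun e => opval (s e)).
Proof.
move=> gf; have [pP pO [ss so] pF ps] := gf.
have proj v : projection_op (opval (p v)).
  have [a i] := pP v; split; first exact: opval_bounded.
    by rewrite -{2}a; exact: opval_adj.
  by move=> x; rewrite -{3}i.
exists (fun e => opval (cs_star (s e))); split.
- split=> //.
  + by move=> v w x n; have := congr1 (fun a : opalg H => opval a x) (pO v w n).
  + by move=> e; split; exact: opval_bounded.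
  + by move=> e; exact: opval_adj.
- split=> [e|e f x ef]; last by have := congr1 (fun a : opalg H => opval a x) (so e f ef).
  by have := proj (rng e); rewrite -ss.
- by move=> e x; rewrite -ss.
- by move=> v x fv; rewrite pF // opval_sum fsbig_fset.
- by move=> e x; have := congr1 (fun a : opalg H => opval a x) (ps e).
Qed.

Lemma graph_cstar_univ (A : cstarAlg R) : is_graph_cstar E A -> exists u : gis E -> A, univ u.
Proof.
move=> [p [s [gen [H [phi [rphi nphi gphi]]] uni]]].
have [k kh kE] := star_rep_hom rphi; have [kl kM kS] := kh.
have k0 := star_hom0 kh.
have kn (a : A) : rnorm (k a) = rnorm a by rewrite -nphi -kE.
have kB (a b : A) : k (a - b) = k a - k b.
  have := kl (-1) b a Logic.I Logic.I; rewrite !scaleN1r addrC => ->; by rewrite addrC.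
have kI : injective k.
  move=> a b e; apply/eqP; rewrite -subr_eq0; apply/eqP/rnorm0_eq.
  by rewrite -kn kB e subrr rnorm0.
have [p' [s' [gf' pE sE]]] := graph_rep_family gphi.
have kp v : k (p v) = p' v by apply: opval_inj; rewrite kE pE.
have ks e : k (s e) = s' e by apply: opval_inj; rewrite kE sE.
have kSum I (r : seq I) (F : I -> A) : k (\sum_(i <- r) F i) = \sum_(i <- r) k (F i).
  elim: r => [|i r IH]; rewrite ?big_nil // !big_cons -IH.
  by have := kl 1 (F i) (\sum_(j <- r) F j) Logic.I Logic.I; rewrite !scale1r.
have kM' (a b : A) : k (cs_mul a b) = cs_mul (k a) (k b) by exact: kM.
have kS' (a : A) : k (cs_star a) = cs_star (k a) by exact: kS.
(* The relations are known only for operators; k is isometric, hence injective, and pulls them back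
   to A. *)
have gf : graph_family p s.
  have [h1 h2 [h3 h4] h5 h6] := gf'; split.
  - move=> v; have [h h'] := h1 v.
    by split; apply: kI; rewrite ?kS' ?kM' kp.
  - by move=> v w n; apply: kI; rewrite kM' !kp h2.
  - split=> [e|e f ef]; apply: kI; first by rewrite kM' kS' ks kp.
    by rewrite !kM' !kS' !ks h4.
  - move=> v fv; apply: kI; rewrite kp h5 // kSum; apply: eq_bigr => e _.
    by rewrite kM' kS' ks.
  - by move=> e; apply: kI; rewrite !kM' kS' ks kp h6.
pose u := path_family p s; have fu : gis_family u by exact: path_familyP.
have klin cs : k (lin u cs) = lin (path_family p' s') cs.
  rewrite (lin_map (h := k)) // => [|c x y]; last exact: kl.
  suff -> : k \o u = path_family p' s' by [].
  apply/funext => t; rewrite /= /u (path_family_hom p s t kh).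
  have -> : (fun v => k (p v)) = p' by apply/funext => v; exact: kp.
  by have -> : (fun e => k (s e)) = s' by apply/funext => e; exact: ks.
exists u; split => //.
(* The closure of the combinations is a closed star subalgebra that contains the generators, so it
   is all of A. *)
- have := gen (fcl u).
  rewrite (_ : closed (fcl u) = True); last first.
    by rewrite propeqE; split => // _; apply/closed_rnorm; exact: fcl_closed.
  move=> h a e e0; have : fcl u a; last exact.
  rewrite (h Logic.I) //.
  + move=> _ [[v _ <-]|[e1 _ <-]].
      have -> : p v = u (gpair (pvert v) (pvert v)).
        by rewrite /u path_family_pair // path_elt_vert (gf_pS gf) (gf_pp gf).
      by rewrite -(lin1 u); exact: fcl_lin.
    have -> : s e1 = u (gpair (pedge e1) (pvert (rng e1))).
      rewrite /u path_family_pair // path_elt_vert (gf_pS gf) (path_elt_edge gf).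
      by rewrite (gf_sp gf).
    by rewrite -(lin1 u); exact: fcl_lin.
  + exact: fcl0.
  + by move=> c x y; exact: fclL.
  + by move=> x y; exact: fclM.
  + by move=> x; exact: fclS.
- move=> cs H' Pi rPi; have [w fw wE] := gis_rep_family rPi.
  (* The graph part of Pi extends to A by universality, and this extension is contractive. *)
  have [phi' [rphi' pp' ss']] := uni _ _ _ (family_graph_rep (gis_graph_family fw)).
  have [k' kh' kE'] := star_rep_hom rphi'; have [kl' _ _] := kh'.
  have -> : lin Pi cs = opval (k' (lin u cs)).
    rewrite (lin_map (h := k')) ?(star_hom0 kh') // => [|c x y]; last exact: kl'.
    rewrite opval_lin; suff -> : Pi = fun t => opval ((k' \o u) t) by [].
    apply/funext => t.
    rewrite -wE /= /u (path_family_hom p s t kh') -(path_family_gis t fw).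
    set p1 := fun v => w _; set s1 := fun e => w _.
    have -> : (fun v => k' (p v)) = p1 by apply/funext => v; apply: opval_inj; rewrite kE' pp'.
    by have -> : (fun e => k' (s e)) = s1 by apply/funext => e; apply: opval_inj; rewrite kE' ss'.
  by rewrite opval_norm; exact: star_hom_contractive.
(* The norm of A is read off in the given isometric representation, whose family may be
   degenerate. *)
- move=> cs M hM; rewrite -kn klin; apply: family_rep_le hM; exact: path_familyP.
Qed.

Lemma univ_graph_cstar (A : cstarAlg R) (u : gis E -> A) (H : hilbertType R)
    (phi : cstar_star A -> H -> H) :
  univ u -> star_rep phi -> (forall a : A, opnorm (phi a) = rnorm a) -> is_graph_cstar E A.
Proof.
move=> uu rphi nphi; have [fu den up lo] := uu.
pose p v := u (gpair (pvert v) (pvert v)); pose s e := u (gpair (pedge e) (pvert (rng e))).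
have gf : graph_family p s by exact: gis_graph_family.
have [k kh kE] := star_rep_hom rphi.
exists p, s; split.
- move=> B Bcl Bps B0 BL BM BS; apply/seteqP; split => // a _.
  have Bu t : B (u t).
    have Bw v es : B (walk_elt p s v es).
      elim: es v => [|e es IH] v /=; first by apply: Bps; left; exists v.
      by apply: BM => //; apply: Bps; right; exists e.
    rewrite -(path_family_gis t fu); case: (gisP t) => [|a1 b1 h1]; first exact: B0.
    by rewrite path_family_pair //; apply: BM; [exact: Bw|apply: BS; exact: Bw].
  have Bl cs : B (lin u cs).
    by elim: cs => [|q cs IH]; rewrite ?lin_nil ?lin_cons //; apply: BL.
  move/closed_rnorm: Bcl; apply => e e0; have [cs hcs] := den a e e0.
  by exists (lin u cs).
- exists H, phi; split => //.
  have := gis_graph_family fu; rewrite -/p -/s => gfu.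
  have kf : gis_family (fun t => k (u t)).
    have [uM uS u0 uF] := fu; have [kl kM kS] := kh; split.
    + by move=> t1 t2; rewrite uM [LHS]kM.
    + by move=> t; rewrite uS [LHS]kS.
    + by rewrite u0 (star_hom0 kh).
    + move=> v fv; rewrite uF //; elim: (enum_fset _) => [|e r IH].
        by rewrite !big_nil (star_hom0 kh).
      rewrite !big_cons -IH.
      by have := kl 1 (u (gpair (pedge e) (pedge e))) _ Logic.I Logic.I; rewrite !scale1r; apply.
  have := family_graph_rep (gis_graph_family kf).
  rewrite (_ : (fun v => opval _) = (fun v => phi (p v))); last by apply/funext => v; rewrite kE.
  by have -> : (fun e => opval (k (s e))) = (fun e => phi (s e)) by apply/funext => e; rewrite kE.
move=> H' P S gr; have [p' [s' [gf' pE sE]]] := graph_rep_family gr.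
have fw := path_familyP gf'.
have [k' [kh' ku kn]] := extend_family uu fw (fun cs => family_rep_le fw (up cs)).
exists (fun a : A => opval (k' a)); split; first exact: star_hom_rep.
  move=> v; rewrite /p ku -pE path_family_pair // path_elt_vert.
  by rewrite (gf_pS gf') (gf_pp gf').
move=> e; rewrite /s ku -sE path_family_pair // path_elt_vert (gf_pS gf').
by rewrite (path_elt_edge gf') (gf_sp gf').
Qed.

End GraphFamily.

(** * Cylinders of the path groupoid *)

Section XPaths.
Variable E : digraph.
Implicit Types (a b m : fpath E) (x c : xpath E) (z : nat -> edge E).

Lemma prng_take a n e0 : (n < plen a)%N ->
  last (psrc a) [seq rng e | e <- take n (pedges a)] = src (nth e0 (pedges a) n).
Proof.
rewrite /plen; move: (psrc a) (pedges a) (pwalk a) => v es w.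
elim: es v w n => [|e es IH] v; first by move=> _ n; rewrite ltn0.
move=> /= /andP[/eqP sv w] [|n] //= hn.
by rewrite (IH _ w).
Qed.

Lemma walk_step a n e0 : (n.+1 < plen a)%N ->
  rng (nth e0 (pedges a) n) = src (nth e0 (pedges a) n.+1).
Proof.
move=> h; rewrite -(prng_take e0 h) (take_nth e0) ?(ltnW h) //.
by rewrite map_rcons last_rcons.
Qed.

Lemma prng_last a n e0 : plen a = n.+1 -> prng a = rng (nth e0 (pedges a) n).
Proof.
move=> h; rewrite /prng -{1}[pedges a](@take_size _ _) -/(plen a) h (take_nth e0) -/(plen a) ?h //.
by rewrite map_rcons last_rcons.
Qed.

Lemma psrc_nth a e0 : (0 < plen a)%N -> psrc a = src (nth e0 (pedges a) 0).
Proof. by move=> h; rewrite -(prng_take e0 h) take0. Qed.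

Lemma xsrc_xcat a c : prng a = xsrc c -> xsrc (xcat a c) = psrc a.
Proof.
case: c => [y|z] /= h; first by rewrite psrc_pcat.
case: (posnP (plen a)) => [l0|l0]; last by rewrite sub0n -psrc_nth.
by rewrite (plen0 l0) /= -h (plen0 l0).
Qed.

Lemma in_X_xcat a c : prng a = xsrc c -> in_X c -> in_X (xcat a c).
Proof.
case: c => [y|z] /= h; first by rewrite prng_pcat.
move=> hz n; have [l1|l1] := ltnP n.+1 (plen a).
  rewrite -(walk_step _ l1); congr (rng _); apply: set_nth_default.
  exact: ltnW.
rewrite [X in _ = src X]nth_default //; move: l1; rewrite leq_eqVlt => /orP[/eqP l1|l1].
  by rewrite l1 subnn -h; rewrite (prng_last (z (n - plen a)%N) l1) l1.
by rewrite nth_default // subSn.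
Qed.

Lemma xcatA a m c : prng a = psrc m -> prng m = xsrc c ->
  xcat a (xcat m c) = xcat (pcat a m) c.
Proof.
move=> h1; case: c => [y|z] /= h2; first by rewrite pcatA.
congr XInf; apply/funext => n; rewrite plen_pcat // pedges_pcat // nth_cat -/(plen a).
case: ltnP => l; first exact: set_nth_default.
by rewrite nth_default // subnDA.
Qed.

Lemma xcat_inj a c c' : prng a = xsrc c -> prng a = xsrc c' -> xcat a c = xcat a c' -> c = c'.
Proof.
case: c c' => [y|z] [y'|z'] //= h h' [e]; first by congr XFin; apply: pcat_inj e.
congr XInf; apply/funext => n; have := congr1 (fun f => f (n + plen a)%N) e.
by rewrite /= addnK !nth_default // -/(plen a) leq_addl.
Qed.

(** Initial segments of one path are comparable, so the shorter is a prefix of the longer. All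
    comparisons of cylinders go back to this. *)
Lemma xcat_split a b c d : prng a = xsrc c -> prng b = xsrc d -> xcat a c = xcat b d ->
  (plen a <= plen b)%N ->
  exists m, [/\ prng a = psrc m, b = pcat a m, prng m = xsrc d & c = xcat m d].
Proof.
move=> h1 h2 e l; have sab : psrc a = psrc b.
  by rewrite -(xsrc_xcat h1) e xsrc_xcat.
have pab : is_prefix a b.
  case: c d h1 h2 e => [y|z] [y'|z'] //= h1 h2 [e].
    by apply: (is_prefix_total (c := pcat a y)) l; [|rewrite e]; exact: is_prefix_pcat.
  rewrite /is_prefix sab eqxx /=; rewrite prefixE; apply/eqP.
  apply: (@eq_from_nth _ (z 0%N)); first by rewrite size_take -/(plen a) -/(plen b); case: ltngtP l.
  move=> n; rewrite size_take -/(plen a) -/(plen b).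
  have -> : (if (plen a < plen b)%N then plen a else plen b) = plen a by case: ltngtP l.
  move=> na; rewrite nth_take //; have := congr1 (fun f => f n) e => /=.
  rewrite (set_nth_default (z 0%N) (z (n - plen a)%N)) // => ->.
  exact/set_nth_default/(leq_trans na).
have /prefixP_cat[m hm eb] := pab; exists m; split => //; first by rewrite -h2 eb prng_pcat.
have hmd : prng m = xsrc d by rewrite -h2 eb prng_pcat.
apply: (xcat_inj (a := a)) => //; first by rewrite xsrc_xcat.
by rewrite xcatA // -eb.
Qed.

Lemma xcat_split_eq a b c d : prng a = xsrc c -> prng b = xsrc d -> xcat a c = xcat b d ->
  plen a = plen b -> a = b /\ c = d.
Proof.
move=> h1 h2 e l; have [|m [hm eb hd ec]] := xcat_split h1 h2 e; first by rewrite l.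
have m0 : m = pvert (psrc m).
  by apply: plen0; apply/eqP; rewrite -(eqn_add2l (plen a)) -plen_pcat // -eb addn0 l.
have ab : a = b by rewrite eb m0 pcat_vert.
by split => //; move: e h2; rewrite -ab => e h2; exact: (xcat_inj h1 h2 e).
Qed.

End XPaths.

Section PathChain.
Variable E : digraph.
Implicit Types (a b m : fpath E) (c : xpath E) (z : nat -> edge E).

(* A property of finite paths that survives along extensions until a vertex
   where the path may stop is witnessed by a point of the path space. *)
Lemma path_chain (Bad Stop : fpath E -> Prop) a : Bad a ->
  (forall b, Bad b -> (Vinf (prng b) /\ Stop b) \/
     exists m, [/\ prng b = psrc m, (0 < plen m)%N & Bad (pcat b m)]) ->
  exists c, [/\ in_X c, xsrc c = prng a &
    (exists m, [/\ c = XFin m, prng a = psrc m, Bad (pcat a m) & Stop (pcat a m)]) \/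
    (forall n, exists m d, [/\ (n <= plen m)%N, prng a = psrc m /\ prng m = xsrc d, in_X d,
       c = xcat m d & Bad (pcat a m)])].
Proof.
move=> ba step.
have [[m [hm bm vm sm]]|nostop] := pselect (exists m, [/\ prng a = psrc m, Bad (pcat a m),
    Vinf (prng (pcat a m)) & Stop (pcat a m)]).
  exists (XFin m); split => //=; first by rewrite prng_pcat // in vm.
  by left; exists m.
pose good m := prng a = psrc m /\ Bad (pcat a m).
(* Once stopping is excluded, every good path has a strictly longer good extension, and choice
   yields an infinite chain. *)
have ext m : good m -> exists k, [/\ prng m = psrc k, (0 < plen k)%N & good (pcat m k)].
  move=> [hm bm]; have [[vm sm]|[k [hk lk bk]]] := step _ bm; first by case: nostop; exists m.
  rewrite prng_pcat // in hk; exists k; split => //; split; first by rewrite psrc_pcat.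
  by rewrite pcatA.
pose T := {m | good m}.
have g0 : good (pvert (prng a)) by split => //; rewrite pcat_vert.
have next (t : T) : exists t' : T, exists k, [/\ prng (sval t) = psrc k, (0 < plen k)%N
    & sval t' = pcat (sval t) k].
  case: t => m gm; have [k [hk lk gk]] := ext m gm.
  by exists (exist _ _ gk), k.
have [nx hnx] := choice next.
pose M n := sval (iter n nx (exist _ _ g0 : T)).
have Mg n : good (M n) by exact: svalP.
have Mk n : exists k, [/\ prng (M n) = psrc k, (0 < plen k)%N & M n.+1 = pcat (M n) k] := hnx _.
have Msrc n : psrc (M n) = prng a by case: (Mg n).
have Mlen n : (n <= plen (M n))%N.
  elim: n => [|n IH] //; have [k [hk lk ->]] := Mk n.
  by rewrite plen_pcat // -addn1 leq_add.
have Mpre n i : exists2 k, prng (M n) = psrc k & M (n + i)%N = pcat (M n) k.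
  elim: i => [|i [k hk IH]]; first by exists (pvert (prng (M n))); rewrite ?addn0 ?pcat_vert.
  have [k' [hk' _ e]] := Mk (n + i)%N; rewrite IH prng_pcat // in hk'.
  by exists (pcat k k'); rewrite ?psrc_pcat // addnS e IH pcatA.
have [e0 _] : exists e : edge E, True.
  case h : (pedges (M 1%N)) => [|e es]; last by exists e.
  by have := Mlen 1%N; rewrite /plen h.
(* The path [M n.+1] has more than n edges, and all M long enough agree on edge n, so e0 is never
   read. *)
pose z n := nth e0 (pedges (M n.+1)) n.
have Mz n i : (i < plen (M n))%N -> nth e0 (pedges (M n)) i = z i.
  move=> li; rewrite /z; have [l|l] := leqP n i.+1.
    have [k hk e] := Mpre n (i.+1 - n)%N; rewrite subnKC // in e.
    by rewrite e pedges_pcat // nth_cat -/(plen (M n)) li.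
  have [k hk e] := Mpre i.+1 (n - i.+1)%N; rewrite subnKC ?(ltnW l) // in e.
  by rewrite e pedges_pcat // nth_cat -/(plen (M i.+1)) Mlen.
have zX n : rng (z n) = src (z n.+1).
  by rewrite -(Mz n.+2 n) ?Mlen // -?(Mz n.+2 n.+1) ?Mlen // ?walk_step ?Mlen //; exact: (leq_trans _ (Mlen _)).
have zs : src (z 0%N) = prng a by rewrite -(Msrc 1%N) (psrc_nth e0) ?Mlen.
exists (XInf z); split=> //; right => n.
have ms : prng (M n) = src (z (plen (M n))).
  case l : (plen (M n)) => [|k]; first by rewrite (plen0 l) prng_pvert Msrc zs.
  by rewrite (prng_last e0 l) Mz ?l.
exists (M n), (XInf (fun k => z (k + plen (M n))%N)); split.
- exact: Mlen.
- by split; [rewrite Msrc|].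
- by move=> k /=; rewrite addSn.
- rewrite /=; congr XInf; apply/funext => k; have [l|l] := ltnP k (plen (M n)).
    by rewrite (set_nth_default e0) // Mz.
  by rewrite nth_default // subnK.
- by case: (Mg n).
Qed.

End PathChain.

Section Cylinders.
Variable E : digraph.
Implicit Types (a b m : fpath E) (c x : xpath E) (s t : gis E) (g h : pgroupoid E).

Lemma pg_val_inj g h : pg_val g = pg_val h -> g = h.
Proof. by case: g h => [g hg] [h hh] /= e; subst h; rewrite (Prop_irrelevance hg hh). Qed.

Definition cyl s : set (pgroupoid E) :=
  [set g | if s is Some p then pg_cyl (val p).1 (val p).2 (pg_val g) else False].

Definition pdeg a b : int := (plen a)%:Z - (plen b)%:Z.

Lemma cyl_pair a b : prng a = prng b -> cyl (gpair a b) = [set g | pg_cyl a b (pg_val g)].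
Proof. by move=> ab; rewrite (gpair_val ab). Qed.

Lemma cylP a b g : prng a = prng b ->
  cyl (gpair a b) g <->
  exists c, [/\ in_X c, xsrc c = prng a & pg_val g = (xcat a c, pdeg a b, xcat b c)].
Proof.
move=> ab; rewrite cyl_pair //; split=> [[c [Xc sc] /= <-]|[c [Xc sc e]]]; first by exists c.
by exists c => //; rewrite e.
Qed.

Lemma point_ex a b c : prng a = prng b -> in_X c -> xsrc c = prng a ->
  exists g, pg_val g = (xcat a c, pdeg a b, xcat b c).
Proof.
move=> ab Xc sc.
have h : in_pg (xcat a c, pdeg a b, xcat b c) by exists a, b; split => //; exists c.
by exists (PGroupoid h).
Qed.

Lemma cyl_cover g : exists s, cyl s g.
Proof.
case: g => t [a [b [ab h]]]; exists (gpair a b).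
by rewrite cyl_pair.
Qed.

(** The natural partial order of the inverse semigroup on nonzero elements: t restricts s along a
    common continuation m. *)
Definition gle t s := exists a b m, [/\ prng a = prng b, prng a = psrc m,
  s = gpair a b & t = gpair (pcat a m) (pcat b m)].

Lemma gle_refl s : s <> None -> gle s s.
Proof.
case: (gisP s) => // a b h _; exists a, b, (pvert (prng a)); split => //.
by rewrite !pcat_vert.
Qed.

Lemma gle_trans r t s : gle r t -> gle t s -> gle r s.
Proof.
move=> [a [b [m [h hm et er]]]] [a' [b' [m' [h' hm' es et']]]].
have hp' : prng (pcat a' m') = prng (pcat b' m') by rewrite !prng_pcat // -h'.
have hm2 : prng b' = psrc m' by rewrite -h'.
have [ea eb] := gpair_inj h hp' (etrans (esym et) et').
have mm : prng m' = psrc m by rewrite -hm ea prng_pcat.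
exists a', b', (pcat m' m); split => //; first by rewrite psrc_pcat.
by rewrite er ea eb !pcatA.
Qed.

Lemma cyl_le t s : gle t s -> cyl t `<=` cyl s.
Proof.
move=> [a [b [m [ab am -> ->]]]] g; have bm : prng b = psrc m by rewrite -ab.
have h : prng (pcat a m) = prng (pcat b m) by rewrite !prng_pcat.
move/(cylP _ h) => [c [Xc sc e]]; apply/cylP => //; rewrite prng_pcat // in sc.
exists (xcat m c); split; [exact: in_X_xcat|by rewrite xsrc_xcat|].
by rewrite e !xcatA // /pdeg !plen_pcat // !PoszD opprD addrACA subrr addr0.
Qed.

Definition glen s : nat := if s is Some p then plen (val p).1 else 0%N.

Lemma glen_pair a b : prng a = prng b -> glen (gpair a b) = plen a.
Proof. by move=> h; rewrite (gpair_val h). Qed.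

(** Cylinders that meet are nested. A common point splits along both pairs, and equality of degrees
    forces the same continuation m in both components. *)
Lemma cyl_nest s t g : cyl s g -> cyl t g -> (glen s <= glen t)%N -> gle t s.
Proof.
case: (gisP s) => // a b ab /(cylP _ ab)[c [Xc sc e]].
case: (gisP t) => // a' b' ab' /(cylP _ ab')[c' [Xc' sc' e']].
rewrite !glen_pair // => l; move: e'; rewrite e => -[e1 e2 e3].
(* Equal degrees turn the comparison of first components into one of second components. *)
have lb : (plen b <= plen b')%N.
  by move: e2 l; rewrite /pdeg => /eqP; rewrite subr_eq addrAC eq_sym subr_eq -!PoszD eqz_nat => /eqP e4 l; rewrite -(leq_add2l (plen a)) -e4 leq_add2r.
have [m [hm ea hmc ec]] := xcat_split (esym sc) (esym sc') e1 l.
have hb : prng b = xsrc c by rewrite -ab sc.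
have hb' : prng b' = xsrc c' by rewrite -ab' sc'.
have [m' [hm' eb hmc' ec']] := xcat_split hb hb' e3 lb.
have [mm _] : m = m' /\ c' = c'.
  apply: xcat_split_eq => //; first by rewrite -ec.
  have := congr1 (fun k : int => k) e2; rewrite /pdeg ea eb !plen_pcat // !PoszD.
  move=> e4; have {}e4 : (plen m)%:Z = (plen m')%:Z.
    by apply/eqP; rewrite -subr_eq0; apply/eqP; move: e4; lia.
  by case: e4.
exists a, b, m; split => //; first by rewrite ea eb -mm.
Qed.

(** As cylinders are nested or disjoint, their intersection is the smaller one or empty. *)
Definition gmeet s t : gis E :=
  if `[< gle t s >] then t else if `[< gle s t >] then s else None.

Lemma cyl_meet s t : cyl (gmeet s t) = cyl s `&` cyl t.
Proof.
rewrite /gmeet; apply/seteqP; split => g.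
  by case: asboolP => [/cyl_le le gt|_]; [split => //; exact: le|case: asboolP => // /cyl_le le gs; split => //; exact: le].
move=> [gs gt]; have [l|l] := leqP (glen s) (glen t).
  by case: asboolP => // -[]; exact: (cyl_nest gs gt).
case: asboolP => // _; case: asboolP => // -[]; apply: (cyl_nest gt gs).
exact: ltnW.
Qed.

Lemma gmeet_le s t : gmeet s t = None \/ gle (gmeet s t) s /\ gle (gmeet s t) t.
Proof.
rewrite /gmeet; case: asboolP => [h|_].
  right; split => //; apply: gle_refl; case: h => a [b [m [ab am _ ->]]].
  by apply: gpair_neq0; rewrite !prng_pcat // -ab.
case: asboolP => [h|_]; last by left.
right; split => //; apply: gle_refl; case: h => a [b [m [ab am _ ->]]].
by apply: gpair_neq0; rewrite !prng_pcat // -ab.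
Qed.

Lemma gmeet_idr s t : gle t s -> gmeet s t = t.
Proof. by rewrite /gmeet; case: asboolP. Qed.

Lemma cyl_inv s g : cyl (gis_star s) g <-> cyl s (pg_inv g).
Proof.
case: (gisP s) => // a b h; rewrite gis_star_pair //.
rewrite cylP // cylP //; split=> -[c [Xc sc e]].
  by exists c; split => //; [rewrite h|rewrite /= e /= /pdeg opprB].
exists c; split => //; first by rewrite -h.
move: e => /=; case: (pg_val g) => -[x n] y /= [-> e ->]; rewrite /pdeg.
by rewrite -[n]opprK e /pdeg opprB.
Qed.

(** A cylinder is a bisection: its points are determined by their first component, which is that of
    k. *)
Lemma pg_prod_inj k p q p' q' s : pg_prod p q k -> pg_prod p' q' k -> cyl s p -> cyl s p' ->
  p = p' /\ q = q'.
Proof.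
move=> [x [n [y [n' [w [ep eq ek]]]]]] [x' [l [y' [l' [w' [ep' eq' ek']]]]]].
case: (gisP s) => // a b ab /(cylP _ ab)[c [Xc sc e]] /(cylP _ ab)[c' [Xc' sc' e']].
move: ek'; rewrite ek => -[xx nn ww].
have cc : c = c'.
  apply: (xcat_inj (a := a)) => //.
  by move: e e'; rewrite ep ep' => -[<- _ _] [<- _ _].
have pp : p = p' by apply: pg_val_inj; rewrite e e' cc.
split => //; apply: pg_val_inj; rewrite eq eq'.
move: ep; rewrite pp ep' => -[_ nl yy]; rewrite -yy ww; congr (_, _, _).
by apply: (addrI n); rewrite nn nl.
Qed.

(** A composable pair passes through one path b z = c z', so b and c are comparable and the
    remainder m of the semigroup product is split off from z or z'. Hence indicators convolve like
    semigroup elements. *)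
Lemma cyl_mul s t k : cyl (gis_mul s t) k <-> exists p q, [/\ pg_prod p q k, cyl s p & cyl t q].
Proof.
case: (gisP s) => [|a b ab]; first by split=> // -[p [q []]].
case: (gisP t) => [|c d cd]; first by rewrite gis_muls0; split=> // -[p [q []]].
split.
  have [/prefixP_cat[m hm eb]|nc] := boolP (is_prefix c b).
    have am : prng a = prng m by rewrite ab eb prng_pcat.
    have dm : prng d = psrc m by rewrite -cd.
    rewrite eb gis_mulEl // => /cylP[|z [Xz sz e]]; first by rewrite prng_pcat.
    have [p ep] := point_ex ab Xz sz.
    have [q eq] : exists q, pg_val q = (xcat c (xcat m z), pdeg c d, xcat d (xcat m z)).
      by apply: point_ex => //; [apply: in_X_xcat => //; rewrite -am sz|rewrite xsrc_xcat // -am sz].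
    exists p, q; split; last 2 first.
    - by rewrite -eb; apply/cylP => //; exists z.
    - apply/cylP => //; exists (xcat m z); split => //; [apply: in_X_xcat => //; rewrite -am sz//|rewrite xsrc_xcat // -am sz //].
    exists (xcat a z), (pdeg a b), (xcat b z), (pdeg c d), (xcat d (xcat m z)).
    rewrite ep eq e eb !xcatA -?am ?sz //; split => //; congr (_, _, _).
    by rewrite /pdeg !plen_pcat // !PoszD; lia.
  have [/prefixP_cat[m hm ec]|nb] := boolP (is_prefix b c); last first.
    by rewrite gis_mul_disj.
  have dm : prng m = prng d by rewrite -cd ec prng_pcat.
  have am : prng a = psrc m by rewrite ab.
  rewrite ec gis_mulEr // => /cylP[|z [Xz sz e]]; first by rewrite prng_pcat.
  rewrite prng_pcat // in sz.
  have [p ep] : exists p, pg_val p = (xcat a (xcat m z), pdeg a b, xcat b (xcat m z)).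
    by apply: point_ex => //; [apply: in_X_xcat|rewrite xsrc_xcat].
  have [q eq] : exists q, pg_val q = (xcat c z, pdeg c d, xcat d z).
    by apply: point_ex => //; rewrite ec prng_pcat.
  exists p, q; split; last 2 first.
  - by apply/cylP => //; exists (xcat m z); split => //; [apply: in_X_xcat|rewrite xsrc_xcat].
  - by rewrite -ec; apply/cylP => //; exists z; split => //; rewrite ec prng_pcat.
  exists (xcat a (xcat m z)), (pdeg a b), (xcat b (xcat m z)), (pdeg c d), (xcat d z).
  rewrite ep eq e ec !xcatA //; split => //; congr (_, _, _).
  by rewrite /pdeg !plen_pcat // !PoszD; lia.
move=> [p [q [[x [n [y [n' [w [ep eq ek]]]]]] /(cylP _ ab)[z [Xz sz e]] /(cylP _ cd)[z' [Xz' sz' e']]]]].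
move: e e'; rewrite ep eq => -[ex en ey] [ey' en' ew].
have hb : prng b = xsrc z by rewrite -ab sz.
have eyz : xcat b z = xcat c z' by rewrite -ey ey'.
have [l|l] := leqP (plen c) (plen b).
  have [m [hm eb hmz ez]] := xcat_split (esym sz') hb (esym eyz) l.
  have am : prng a = prng m by rewrite ab eb prng_pcat.
  have dm : prng d = psrc m by rewrite -cd.
  rewrite eb gis_mulEl //; apply/cylP; first by rewrite prng_pcat.
  exists z; split => //; rewrite ek ex ew ez xcatA //; congr (_, _, _).
  by rewrite en en' /pdeg eb !plen_pcat // !PoszD; lia.
have [m [hm ec hmz ez]] := xcat_split hb (esym sz') eyz (ltnW l).
have dm : prng m = prng d by rewrite -cd ec prng_pcat.
have am : prng a = psrc m by rewrite ab.
rewrite ec gis_mulEr //; apply/cylP; first by rewrite prng_pcat.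
exists z'; split => //; first by rewrite prng_pcat.
rewrite ek ex ew ez xcatA //; congr (_, _, _).
by rewrite en en' /pdeg ec !plen_pcat // !PoszD; lia.
Qed.

(** A finite intersection of members of [pg_basic] imposes finitely many cylinder memberships and
    exclusions; arbitrary neighbourhoods contain such a set. *)
Lemma nbhs_cyl g (N : set (pgroupoid E)) : nbhs g N ->
  exists ss ts : seq (gis E), [/\ forall s, s \in ss -> cyl s g, forall t, t \in ts -> ~ cyl t g
    & forall h, (forall s, s \in ss -> cyl s h) -> (forall t, t \in ts -> ~ cyl t h) -> N h].
Proof.
rewrite nbhsE => -[U [oU Ug] UN].
suff [ss [ts [h1 h2 h3]]] : exists ss ts : seq (gis E), [/\ forall s, s \in ss -> cyl s g,
    forall t, t \in ts -> ~ cyl t g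
    & forall h, (forall s, s \in ss -> cyl s h) -> (forall t, t \in ts -> ~ cyl t h) -> U h].
  by exists ss, ts; split => // h hs ht; apply/UN/h3.
move: oU Ug => [D' D'f <-] [V D'V Vg].
have [F Fb eV] := D'f _ D'V.
suff [ss [ts [h1 h2 h3]]] : exists ss ts : seq (gis E), [/\ forall s, s \in ss -> cyl s g,
    forall t, t \in ts -> ~ cyl t g
    & forall h, (forall s, s \in ss -> cyl s h) -> (forall t, t \in ts -> ~ cyl t h) ->
        forall W, W \in enum_fset F -> W h].
  by exists ss, ts; split => // h hs ht; exists V => //; change (V h); rewrite -eV => W WF; apply: h3 WF.
have {eV} : forall W, W \in enum_fset F -> W g by move: Vg; rewrite -eV.
have {Fb} : forall W, W \in enum_fset F -> pg_basic W by move=> W /Fb; rewrite inE.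
elim: (enum_fset F) => [|W r IH] Fb Fg; first by exists [::], [::].
have [|W' W'r|ss [ts [h1 h2 h3]]] := IH; first by move=> W' W'r; apply: Fb; rewrite inE W'r orbT.
  by apply: Fg; rewrite inE W'r orbT.
have [a [b [ms [ab am eW]]]] := Fb W (mem_head _ _).
have := Fg W (mem_head _ _); rewrite eW => -[gab gms].
have pm m : m \in ms -> prng (pcat a m) = prng (pcat b m).
  by move=> /am am'; rewrite !prng_pcat // -?ab am'.
exists (gpair a b :: ss), ([seq gpair (pcat a m) (pcat b m) | m <- ms] ++ ts); split.
- by move=> s; rewrite inE => /orP[/eqP ->|/h1] //; rewrite cyl_pair.
- move=> t; rewrite mem_cat => /orP[/mapP[m mms ->]|/h2] //.
  by rewrite cyl_pair; [exact: gms|exact: pm].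
move=> h hs ht W'; rewrite inE => /orP[/eqP ->|W'r].
  split; first by have := hs _ (mem_head _ _); rewrite cyl_pair.
  move=> m mms.
  have tin : gpair (pcat a m) (pcat b m) \in [seq gpair (pcat a m) (pcat b m) | m <- ms] ++ ts.
    by rewrite mem_cat; apply/orP; left; apply/mapP; exists m.
  by have := ht _ tin; rewrite cyl_pair // pm.
apply: h3 W'r => s ss'; first by apply: hs; rewrite inE ss' orbT.
by apply: ht; rewrite mem_cat ss' orbT.
Qed.

Lemma open_basic (U : set (pgroupoid E)) : pg_basic U -> open U.
Proof.
move=> bU; exists [set U]; last by rewrite bigcup_set1.
by move=> _ ->; exact: finI_from1.
Qed.

Lemma open_cyl s : open (cyl s).
Proof.
case: (gisP s) => [|a b ab]; first by rewrite (_ : cyl None = set0); [exact: open0|].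
rewrite cyl_pair //; apply: open_basic; exists a, b, [::]; split => //.
by apply/seteqP; split => // g [].
Qed.

(** Let t be a cylinder around a point outside. If t is the longer pair the two are disjoint by
    nesting; if t is shorter, either it contains the given cylinder, whose removal leaves a basic
    set, or the two are disjoint. *)
Lemma closed_cyl s : closed (cyl s).
Proof.
case: (gisP s) => [|a b ab]; first by rewrite (_ : cyl None = set0); [exact: closed0|].
rewrite -openC openE => g ng; have [t gt] := cyl_cover g.
have [l|l] := leqP (glen (gpair a b)) (glen t).
  apply: filterS (open_nbhs_nbhs (conj (open_cyl t) gt)) => h ht hab.
  by apply: ng; apply: cyl_le gt; exact: cyl_nest hab ht l.
case: (gisP t) gt l => [|a' b' ab'] gt l //.
rewrite !glen_pair // in l.
have [[m [hm ea eb]]|nm] := pselect (exists m, [/\ prng a' = psrc m, a = pcat a' m & b = pcat b' m]).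
  have bU : pg_basic (cyl (gpair a' b') `\` cyl (gpair a b)).
    exists a', b', [:: m]; split => // [k|]; first by rewrite inE => /eqP ->.
    rewrite !cyl_pair //; apply/seteqP; split => h [h1 h2]; split => //.
      by move=> k; rewrite inE => /eqP ->; rewrite -ea -eb.
    by rewrite ea eb; apply: h2; rewrite inE.
  apply: (filterS (P := cyl (gpair a' b') `\` cyl (gpair a b))); first by move=> h [].
  by apply: open_nbhs_nbhs; split; [exact: open_basic|].
apply: filterS (open_nbhs_nbhs (conj (open_cyl _) gt)) => h ht hab; apply: nm.
have [|a1 [b1 [m [e1 e2 e3 e4]]]] := cyl_nest ht hab.
  by rewrite !glen_pair // ltnW.
have [ea eb] := gpair_inj ab' e1 e3.
have ee : prng (pcat a1 m) = prng (pcat b1 m) by rewrite !prng_pcat // -e1.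
have [ea2 eb2] := gpair_inj ab ee e4.
by exists m; rewrite ea eb.
Qed.

(** A point of X that is a finite path stops at an infinite emitter, so at a finite emitter it has
    to go on by an edge. *)
Lemma cyl_vfin a b g : prng a = prng b -> Vfin (prng a) -> cyl (gpair a b) g ->
  exists2 e, src e = prng a & cyl (gpair (pcat a (pedge e)) (pcat b (pedge e))) g.
Proof.
move=> ab fa /(cylP _ ab)[c [Xc sc eg]].
have [e [d [Xd sd ec se]]] : exists e d, [/\ in_X d, xsrc d = rng e, c = xcat (pedge e) d & src e = prng a].
  case: c Xc sc eg => [y|z] /= Xc sc _.
    case ey : (pedges y) => [|e es].
      by move: Xc; rewrite (plen0 (a := y)) ?prng_pvert ?sc // /plen ey.
    have w : is_walk (rng e, es).1 (rng e, es).2.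
      by have := pwalk y; rewrite ey /= => /andP[].
    have se : src e = psrc y by have := pwalk y; rewrite ey /= => /andP[/eqP].
    pose y' : fpath E := @FPath E (rng e, es) w; have ey' : y = pcat (pedge e) y'.
      by apply: path_ext; rewrite ?psrc_pcat ?pedges_pcat.
    exists e, (XFin y'); split => //; last by rewrite se.
      by move: Xc; rewrite /in_X ey' prng_pcat.
    by rewrite /= -ey'.
  exists (z 0%N), (XInf (fun n => z n.+1)); split => //=.
  by congr XInf; apply/funext => -[|n] //=; rewrite subSS subn0 nth_nil.
have be : prng b = psrc (pedge e) by rewrite -ab -se.
have ae : prng a = psrc (pedge e) by rewrite -se.
exists e => //; apply/cylP; first by rewrite !prng_pcat.
exists d; split => //; first by rewrite prng_pcat.
rewrite eg ec !xcatA //; congr (_, _, _).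
by rewrite /pdeg !plen_pcat // !PoszD opprD addrACA subrr addr0.
Qed.

Section CylInduction.
Variable Good : set (pgroupoid E) -> Prop.
Hypothesis good0 : Good set0.
Hypothesis goodS : forall U V, U `<=` V -> Good V -> Good U.
Hypothesis goodU : forall t V, Good (cyl t) -> Good V -> Good (cyl t `|` V).

Lemma good_cover (ts : seq (gis E)) V : (forall t, t \in ts -> Good (cyl t)) -> Good V ->
  Good [set g | (exists2 t, t \in ts & cyl t g) \/ V g].
Proof.
move=> + gV; elim: ts => [|t ts IH] h.
  by apply: goodS gV => g [[]|].
apply: goodS (goodU (h t (mem_head _ _)) (IH _)) => [g|r rt]; last by apply: h; rewrite inE rt orbT.
move=> [[r]|gV']; last by right; right.
by rewrite inE => /orP[/eqP -> ht|rt hr]; [left|right; left; exists r].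
Qed.

(** Compactness of cylinders as an induction principle, by a branching argument: a bad cylinder
    contains ever smaller bad ones, which shrink to a point, and the good neighbourhood of that
    point contains one of them. In [goodU] one set is a cylinder, over which step functions can be
    glued. *)
Lemma cyl_induction s : (forall g, cyl s g -> exists2 N, nbhs g N & Good N) -> Good (cyl s).
Proof.
case: (gisP s) => [_|a b ab loc]; first by rewrite (_ : cyl None = set0).
apply: contrapT => bad0.
pose cc m := gpair (pcat a m) (pcat b m).
have ccP m : prng a = psrc m -> prng (pcat a m) = prng (pcat b m).
  by move=> am; rewrite !prng_pcat // -ab.
have ccle m : prng a = psrc m -> gle (cc m) (gpair a b) by move=> am; exists a, b, m.
pose v := prng a.
(* The stopping predicate is False: a bad cylinder always has a strictly smaller bad one, also at an
   infinite emitter. *)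
have [||c [Xc sc lim]] := @path_chain E (fun m => psrc m = v /\ ~ Good (cyl (cc m))) (fun=> False) (pvert v).
- by split => //; rewrite /cc !pcat_vert // -ab.
- move=> m [sm bm]; right; have am : prng a = psrc m by rewrite sm.
  have bm' : prng b = psrc m by rewrite -ab.
  apply: contrapT => nx.
  have step k : prng m = psrc k -> (0 < plen k)%N -> Good (cyl (cc (pcat m k))).
    by move=> mk lk; apply: contrapT => nb; apply: nx; exists k; split => //; rewrite psrc_pcat.
  have ccA k : prng m = psrc k -> cc (pcat m k) = gpair (pcat (pcat a m) k) (pcat (pcat b m) k).
    by move=> mk; rewrite /cc !pcatA.
  have [fv|iv] := pselect (Vfin (prng m)).
    apply: bm; have gts : forall t, t \in [seq cc (pcat m (pedge e)) | e <- fset_set (out_edges (prng m))] -> Good (cyl t).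
      move=> t /mapP[e]; rewrite in_fset_set // inE => se ->.
      by apply: step.
    apply: goodS (good_cover gts good0) => g gm; left.
    have [|e se ge] := cyl_vfin (ccP _ am) _ gm; first by rewrite prng_pcat.
    rewrite prng_pcat // in se; exists (cc (pcat m (pedge e))); last by rewrite ccA.
    by apply/mapP; exists e => //; rewrite in_fset_set // inE.
  (* At an infinite emitter the path may end with m. The good neighbourhood N of this point covers
     the cylinder up to finitely many subcylinders; they omit the point, so they are proper and
     good, and the cylinder would be good too. *)
  have Xv : in_X (XFin (pvert (prng m))) by [].
  have [|g0 eg0] := point_ex (ccP _ am) Xv; first by rewrite prng_pcat.
  have g0m : cyl (cc m) g0.
    by apply/cylP; [exact: ccP|exists (XFin (pvert (prng m))); split => //; rewrite prng_pcat].
  have [N /nbhs_cyl[ss [ts [h1 h2 h3]]] gN] := loc g0 (cyl_le (ccle _ am) g0m).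
  have g0t t : cyl t g0 -> gle (cc m) t.
    move=> tg; apply: (cyl_nest tg g0m); case: (gisP t) tg => // a' b' ab'.
    move=> /(cylP _ ab')[d [Xd sd]]; rewrite eg0 => -[e _ _].
    rewrite !glen_pair ?ccP //; case: d e {Xd} sd => //= y [e] sd.
    have := congr1 (@plen E) e; rewrite pcat_vert ?prng_pcat // => ->.
    by rewrite [in leqRHS]plen_pcat ?leq_addr.
  pose ts' := [seq t <- ts | `[< gle t (cc m) >]].
  apply: bm; apply: (goodS (V := [set g | (exists2 t, t \in ts' & cyl t g) \/ N g])).
    move=> g gm; have [[t tts gt]|nt] := pselect (exists2 t, t \in ts & cyl t g).
      left; exists t => //; rewrite mem_filter tts andbT; apply/asboolP.
      apply: (cyl_nest gm gt); rewrite leqNgt; apply/negP => l.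
      by apply: (h2 t tts); apply: cyl_le g0m; apply: (cyl_nest gt gm); exact: ltnW.
    right; apply: h3 => [r rss|t tts gt]; first by apply: cyl_le gm; exact/g0t/h1.
    by apply: nt; exists t.
  apply: good_cover gN => t; rewrite mem_filter => /andP[/asboolP[a1 [b1 [k [e1 e2 e3 e4]]]] tts].
  have [ea eb] := gpair_inj (ccP _ am) e1 e3.
  have mk : prng m = psrc k by rewrite -e2 -ea prng_pcat.
  rewrite e4 -ea -eb -ccA //; apply: step => //; rewrite lt0n; apply/eqP => k0.
  apply: (h2 t tts); rewrite e4 -ea -eb (plen0 k0) !pcat_vert -?mk ?prng_pcat //.
case: lim => [[m [_ _ _ []]]|lim].
have [g eg] := point_ex ab Xc sc.
have gab : cyl (gpair a b) g by apply/cylP => //; exists c.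
have [N /nbhs_cyl[ss [ts [h1 h2 h3]]] gN] := loc g gab.
(* Longer than every condition that describes N: a cylinder of this length around g lies inside
   those of ss and misses those of ts, hence lies in N. *)
pose n := (\max_(t <- ss ++ ts) glen t).+1.
have [m [d [nm [vm md] Xd ec [_ bm]]]] := lim n.
have am : prng a = psrc m by [].
have e0 : pcat (pvert v) m = m by rewrite vert_pcat.
rewrite e0 in bm.
have gm : cyl (cc m) g.
  apply/cylP; first exact: ccP.
  exists d; split => //; first by rewrite prng_pcat.
  rewrite eg ec !xcatA // -?ab //; congr (_, _, _).
  by rewrite /pdeg !plen_pcat // -?ab // !PoszD opprD addrACA subrr addr0.
have lm t : t \in ss ++ ts -> (glen t < glen (cc m))%N.
  move=> tin; rewrite glen_pair ?ccP // plen_pcat //.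
  apply: leq_trans (leq_trans nm (leq_addl _ _)); rewrite ltnS.
  by apply: leq_bigmax_seq.
apply: bm; apply: goodS gN => h hm; apply: h3 => [t tss|t tts ht].
  by apply: cyl_le hm; apply: (cyl_nest (h1 _ tss) gm); rewrite ltnW // lm // mem_cat tss.
apply: (h2 _ tts); apply: cyl_le gm; apply: (cyl_nest ht hm).
by rewrite ltnW // lm // mem_cat tts orbT.
Qed.

End CylInduction.

(** If an ultrafilter F converges to no point of the cylinder, each point has a neighbourhood
    outside F. Not belonging to F passes to subsets and finite unions, so the cylinder itself is
    outside F. *)
Lemma compact_cyl s : compact (cyl s).
Proof.
rewrite compact_ultra => F UF Fs; apply: contrapT => nc.
have : ~ F (cyl s); last exact.
apply: (@cyl_induction (fun U => ~ F U)).
- exact: filter_not_empty.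
- by move=> U V UV nV FU; apply: nV; apply: filterS UV FU.
- move=> t V nt nV FtV; have [//|Ft] := in_ultra_setVsetC (cyl t) UF.
  by apply: nV; apply: filterS (filterI FtV Ft) => g [[]].
- move=> g gs; apply: contrapT => nN; apply: nc; exists g; split => // N gN.
  by apply: contrapT => nF; apply: nN; exists N.
Qed.

Lemma compact_cover_cyl (K : set (pgroupoid E)) : compact K ->
  exists ss : seq (gis E), forall g, K g -> exists2 s, s \in ss & cyl s g.
Proof.
rewrite compact_ultra => cK; apply: contrapT => nc.
pose B (ss : seq (gis E)) := K `\` [set g | exists2 s, s \in ss & cyl s g].
pose F := filter_from setT B.
have FF : ProperFilter F.
  apply: filter_from_proper.
    apply: filter_from_filter; first by exists [::].
    move=> ss ts _ _; exists (ss ++ ts) => // g [Kg ng]; split; split=> // -[s sin gs].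
      by apply: ng; exists s; rewrite // mem_cat sin.
    by apply: ng; exists s; rewrite // mem_cat sin orbT.
  move=> ss _; apply/set0P/negP => /eqP e; apply: nc; exists ss => g Kg.
  by apply: contrapT => n; have : B ss g by []; rewrite e.
have [U [UU FU]] := ultraFilterLemma FF.
have UK : U K by apply: FU; exists [::] => // g [].
have [g [Kg Ug]] := cK U UU UK.
have [s gs] := cyl_cover g.
have : U (cyl s `&` B [:: s]).
  apply: filterI; first by apply: Ug; apply: open_nbhs_nbhs; split => //; exact: open_cyl.
  by apply: FU; exists [:: s].
move=> /filter_ex[h [hs [_ nh]]]; apply: nh; exists s => //.
by rewrite inE.
Qed.

End Cylinders.

(** * Continuous functions of compact support *)

Section StepFunctions.
Variables (R : realType) (E : digraph).
Local Notation comb := (comb R E).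
Local Notation Cc := (pg_Cc R E).
Implicit Types (cs ds : comb) (s t : gis E) (ss ts : seq (gis E)) (f g : Cc) (x y k : pgroupoid E).

Definition ind s : Cc := fun x => (`[< cyl s x >])%:R.
Definition step cs : Cc := lin ind cs.

Lemma indT s x : cyl s x -> ind s x = 1.
Proof. by move=> h; rewrite /ind asboolT. Qed.
Lemma indF s x : ~ cyl s x -> ind s x = 0.
Proof. by move=> h; rewrite /ind asboolF. Qed.

Lemma stepE cs x : step cs x = \sum_(p <- cs) p.1 * ind p.2 x.
Proof.
by rewrite /step; elim: cs => [|p cs IH]; rewrite ?lin_nil ?big_nil // lin_cons big_cons -IH.
Qed.

Lemma step_cat cs ds x : step (cs ++ ds) x = step cs x + step ds x.
Proof. by rewrite !stepE big_cat. Qed.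
Lemma step_scale c cs x : step (comb_scale c cs) x = c * step cs x.
Proof. by rewrite !stepE big_map mulr_sumr; apply: eq_bigr => p _; rewrite mulrA. Qed.

(** Support read off the terms themselves; it implies [supp_in], but not conversely, as terms may
    cancel. The function [cuts] mediates between the two. *)
Definition under ss cs := forall p, p \in cs -> p.2 = None \/ exists2 s, s \in ss & gle p.2 s.
Definition supp_in ss f := forall x, f x <> 0 -> exists2 s, s \in ss & cyl s x.
Definition sbound f (M : R) := forall x, cabs (f x) <= M.

Lemma under_cat ss cs ds : under ss cs -> under ss ds -> under ss (cs ++ ds).
Proof. by move=> h1 h2 p; rewrite mem_cat => /orP[/h1|/h2]. Qed.
Lemma under_scale ss c cs : under ss cs -> under ss (comb_scale c cs).
Proof. by move=> h p /mapP[q /h hq ->]. Qed.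
Lemma under_sub ss ts cs : {subset ss <= ts} -> under ss cs -> under ts cs.
Proof. by move=> h u p /u[->|[s /h ss' le]]; [left|right; exists s]. Qed.

Lemma under_supp ss cs : under ss cs -> supp_in ss (step cs).
Proof.
move=> h x; rewrite stepE => n0; apply: contrapT => n; apply: n0.
rewrite big1_seq // => p /= pcs; rewrite indF ?mulr0 // => px.
case: (h p pcs) => [e|[s sin le]]; first by rewrite e in px.
by apply: n; exists s => //; apply: cyl_le le _ px.
Qed.

Lemma self_supp cs : supp_in [seq p.2 | p <- cs] (step cs).
Proof.
move=> x; rewrite stepE => n0; apply: contrapT => n; apply: n0.
rewrite big1_seq // => p /= pcs; rewrite indF ?mulr0 // => px.
by apply: n; exists p.2 => //; apply/mapP; exists p.
Qed.

Lemma supp_lin ss (c : R[i]) f g : supp_in ss f -> supp_in ss g -> supp_in ss (c *: f + g).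
Proof.
move=> hf hg x n0; apply: contrapT => n; apply: n0.
have f0 : f x = 0 by apply: contrapT => h; exact/n/hf.
have g0 : g x = 0 by apply: contrapT => h; exact/n/hg.
by rewrite [LHS](_ : _ = c * f x + g x) // f0 g0 mulr0 addr0.
Qed.

Lemma supp_sub ss ts f : {subset ss <= ts} -> supp_in ss f -> supp_in ts f.
Proof. by move=> h hf x /hf[s /h]; exists s. Qed.

Lemma Cc_sub f g x : (f - g) x = f x - g x. Proof. by []. Qed.
Lemma Cc_lin c f g x : (c *: f + g) x = c * f x + g x. Proof. by []. Qed.

Lemma supp_B ss f g : supp_in ss f -> supp_in ss g -> supp_in ss (f - g).
Proof.
by move=> hf hg; have := @supp_lin ss (-1) _ _ hg hf; rewrite scaleN1r addrC.
Qed.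

(** Each cylinder of ss contributes at most one factorization of k, as it is a bisection. Hence
    convolution is a finite sum with at most [size ss] terms. *)
Lemma fact_list ss k : exists L : seq (pgroupoid E * pgroupoid E),
  [/\ uniq L, (size L <= size ss)%N,
      forall p, p \in L -> pg_prod p.1 p.2 k /\ exists2 s, s \in ss & cyl s p.1
    & forall p, pg_prod p.1 p.2 k -> (exists2 s, s \in ss & cyl s p.1) -> p \in L].
Proof.
elim: ss => [|s ss [L [uL sL pL eL]]]; first by exists [::]; split=> // p _ [s].
have [[q [hq sq nq]]|no] := pselect (exists q, [/\ pg_prod q.1 q.2 k, cyl s q.1 & q \notin L]).
  exists (q :: L); split => //=; first by rewrite nq.
    move=> p; rewrite inE => /orP[/eqP ->|/pL[h [r rss rp]]].
      by split => //; exists s; rewrite ?mem_head.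
    by split => //; exists r; rewrite ?inE ?rss ?orbT.
  move=> p hp [r]; rewrite !inE => /orP[/eqP ->|rss] rp; last by rewrite eL ?orbT //; exists r.
  have [e1 e2] := pg_prod_inj hp hq rp sq.
  by rewrite [p]surjective_pairing e1 e2 -surjective_pairing eqxx.
exists L; split => //; first exact: leqW.
  move=> p /pL[h [r rss rp]]; split => //; exists r => //.
  by rewrite inE rss orbT.
move=> p hp [r]; rewrite inE => /orP[/eqP ->|rss] rp; last by apply: eL => //; exists r.
by apply: contrapT => /negP np; apply: no; exists p.
Qed.

Lemma conv_list ss k : exists L : seq (pgroupoid E * pgroupoid E),
  [/\ (size L <= size ss)%N,
      forall p, p \in L -> pg_prod p.1 p.2 k /\ exists2 s, s \in ss & cyl s p.1,
      forall p, pg_prod p.1 p.2 k -> (exists2 s, s \in ss & cyl s p.1) -> p \in L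
    & forall f g, supp_in ss f -> sa_mul f g k = \sum_(p <- L) f p.1 * g p.2].
Proof.
have [L [uL sL pL eL]] := fact_list ss k; exists L; split => // f g hf.
rewrite /= (fsbigE L) //=; last 2 first.
- by move=> p /pL[].
- move=> p hp np; have [->|/eqP f0] := eqVneq (f p.1) 0; first by rewrite mul0r.
  by move: np; rewrite eL //; exact: hf.
rewrite big_seq_cond [RHS]big_seq; apply: eq_bigl => p.
by case pL' : (p \in L) => //=; rewrite mem_set //; case: (pL p pL').
Qed.

Lemma conv_linl ss (c : R[i]) f f' g : supp_in ss f -> supp_in ss f' ->
  sa_mul (c *: f + f') g = c *: sa_mul f g + sa_mul f' g.
Proof.
move=> hf hf'; apply/funext => k; have [L [_ _ _ h]] := conv_list ss k.
rewrite [RHS](_ : _ = c * sa_mul f g k + sa_mul f' g k) //.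
rewrite !h //; last exact: supp_lin.
rewrite mulr_sumr -big_split; apply: eq_bigr => p _.
by rewrite Cc_lin mulrDl mulrA.
Qed.

Lemma conv_linr ss (c : R[i]) f g g' : supp_in ss f ->
  sa_mul f (c *: g + g') = c *: sa_mul f g + sa_mul f g'.
Proof.
move=> hf; apply/funext => k; have [L [_ _ _ h]] := conv_list ss k.
rewrite [RHS](_ : _ = c * sa_mul f g k + sa_mul f g' k) //.
rewrite !h // mulr_sumr -big_split; apply: eq_bigr => p _.
by rewrite Cc_lin mulrDr mulrCA.
Qed.

Lemma conv_bound ss f g M N : 0 <= M -> supp_in ss f -> sbound f M -> sbound g N ->
  sbound (sa_mul f g) ((size ss)%:R * (M * N)).
Proof.
move=> M0 hf fM gN k; have [L [sL _ _ h]] := conv_list ss k; rewrite h //.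
have N0 : 0 <= N by apply: le_trans (gN k).
apply: le_trans (cabs_sum _ _) _; apply: (@le_trans _ _ (\sum_(p <- L) M * N)).
  by apply: ler_sum => p _; rewrite cabsM ler_pM.
rewrite big_const_seq count_predT iter_addr_0 -[leLHS]mulr_natl.
by rewrite ler_wpM2r ?mulr_ge0 // ler_nat.
Qed.

(** By [cyl_mul], k factors through the two cylinders exactly when it lies in the cylinder of the
    product, and the factorization is unique. *)
Lemma conv_ind s t : sa_mul (ind s) (ind t) = ind (gis_mul s t).
Proof.
apply/funext => k; have [L [sL pL eL h]] := conv_list [:: s] k.
rewrite h; last first.
  by move=> x n; exists s; rewrite ?mem_head //; apply: contrapT => ns; rewrite indF in n.
have [/[dup] stk /cyl_mul[p [q [pq sp tq]]]|nst] := pselect (cyl (gis_mul s t) k).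
  have inL : (p, q) \in L by apply: eL => //; exists s; rewrite ?mem_head.
  case: L inL sL {pL eL h} => [|l [|l' L]] //; rewrite inE => /eqP <- _.
  by rewrite big_seq1 !indT // mulr1.
rewrite indF // big1_seq // => p /= /pL[pk [r]]; rewrite inE => /eqP -> sp.
by rewrite [ind t _]indF ?mulr0 // => tq; apply: nst; apply/cyl_mul; exists p.1, p.2.
Qed.

Lemma ind_supp s : supp_in [:: s] (ind s).
Proof.
by move=> x n; exists s; rewrite ?mem_head //; apply: contrapT => ns; rewrite indF in n.
Qed.

Lemma step_cons p cs : step (p :: cs) = p.1 *: ind p.2 + step cs.
Proof. exact: lin_cons. Qed.

Lemma conv0r ss f : supp_in ss f -> sa_mul f 0 = 0.
Proof.
move=> hf; have := conv_linr (-1) 0 0 hf; rewrite scaler0 addr0 => ->.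
by rewrite scaleN1r addNr.
Qed.

Lemma conv_ind_step s ds :
  sa_mul (ind s) (step ds) = step [seq (q.1, gis_mul s q.2) | q <- ds].
Proof.
elim: ds => [|q ds IH]; first by rewrite /step !lin_nil; exact: conv0r (@ind_supp s).
by rewrite step_cons (conv_linr _ _ _ (@ind_supp s)) conv_ind IH /= step_cons.
Qed.

Lemma conv_step cs ds : sa_mul (step cs) (step ds) = step (comb_mul cs ds).
Proof.
elim: cs => [|p cs IH].
  apply/funext => k; have [L [sL _ _ ->]] := conv_list [::] k.
    by rewrite stepE big_nil; case: L sL => // _; rewrite big_nil.
  by move=> x; rewrite stepE big_nil.
pose ss := p.2 :: [seq q.2 | q <- cs].
have si : supp_in ss (ind p.2).
  by move=> x /ind_supp[s]; rewrite inE => /eqP -> h; exists p.2; rewrite ?mem_head.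
have sc : supp_in ss (step cs).
  have sub : {subset [seq q.2 | q <- cs] <= ss} by move=> r h; rewrite inE h orbT.
  exact: (supp_sub sub (@self_supp cs)).
rewrite step_cons (conv_linl _ _ si sc) IH conv_ind_step.
rewrite [in RHS]/comb_mul /= -/(comb_mul cs ds) [in RHS]/step lin_cat; congr (_ + _).
by rewrite -lin_scale /comb_scale -map_comp.
Qed.

Lemma star_ind s : sa_star (ind s) = ind (gis_star s).
Proof.
apply/funext => k /=; rewrite /ind conjC_nat; congr ((_ : bool)%:R).
by apply: asbool_equiv_eq; rewrite cyl_inv.
Qed.

Lemma star_step cs : sa_star (step cs) = step (comb_star cs).
Proof.
apply/funext => k; rewrite [LHS](_ : _ = (step cs (pg_inv k))^*) // !stepE big_map rmorph_sum.
apply: eq_bigr => p _; rewrite rmorphM /=; congr (_ * _).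
by have := congr1 (fun f : Cc => f k) (star_ind p.2).
Qed.

(** Multiplication by [ind s], carried out on combinations. *)
Definition cut s cs : comb := [seq (p.1, gmeet s p.2) | p <- cs].

Lemma step_cut s cs x : step (cut s cs) x = ind s x * step cs x.
Proof.
rewrite !stepE big_map mulr_sumr; apply: eq_bigr => p _ /=; rewrite mulrCA; congr (_ * _).
have [sx|nsx] := pselect (cyl s x); last first.
  by rewrite [ind s x]indF // mul0r indF // cyl_meet => -[].
rewrite [ind s x]indT // mul1r; have [px|npx] := pselect (cyl p.2 x).
  by rewrite !indT // cyl_meet.
by rewrite !indF // cyl_meet => -[].
Qed.

Lemma under_cut s cs : under [:: s] (cut s cs).
Proof.
move=> p /mapP[q _ ->] /=; have [->|[h _]] := gmeet_le s q.2; first by left.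
by right; exists s; rewrite ?mem_head.
Qed.

Lemma under_cut_ss ss s cs : under ss cs -> under ss (cut s cs).
Proof.
move=> h p /mapP[q /h hq ->] /=; have [->|[_ le]] := gmeet_le s q.2; first by left.
case: hq => [e|[t tss le']].
  by case: le => a [b [m [ab am e2 _]]]; rewrite e in e2; case: (gpair_neq0 ab).
by right; exists t => //; apply: gle_trans le le'.
Qed.

(** Splits off 1_s f and goes on with f - 1_s f, so that every term ends up below a member of ss
    while the function on the union of ss is unchanged. *)
Fixpoint cuts ss cs : comb :=
  if ss is s :: ss' then cut s cs ++ cuts ss' (cs ++ comb_scale (-1) (cut s cs)) else [::].

Lemma under_cuts ss cs : under ss (cuts ss cs).
Proof.
elim: ss cs => [|s ss IH] cs //=; apply: under_cat.
  by apply: under_sub (@under_cut _ _) => r; rewrite !inE => ->.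
by apply: under_sub (IH _) => r h; rewrite inE h orbT.
Qed.

Lemma step_cuts ss cs x : (exists2 s, s \in ss & cyl s x) -> step (cuts ss cs) x = step cs x.
Proof.
elim: ss cs => [|s ss IH] cs [] // r; rewrite inE => rin rx /=.
rewrite step_cat step_cut; have [sx|nsx] := pselect (cyl s x).
  rewrite indT // mul1r -[RHS]addr0; congr (_ + _).
  have e0 : step (cs ++ comb_scale (-1) (cut s cs)) x = 0.
    by rewrite step_cat step_scale step_cut indT // mul1r mulN1r subrr.
  have [h|n] := pselect (exists2 s', s' \in ss & cyl s' x); first by rewrite IH.
  by apply: contrapT => /(under_supp (@under_cuts ss _)).
rewrite indF // mul0r add0r IH; last first.
  by case/orP: rin => [/eqP e|h]; [rewrite e in rx|exists r].
by rewrite step_cat step_scale step_cut indF // mul0r mulr0 addr0.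
Qed.

(** The members of C_c(G) as uniform limits of step functions; the fixed list ss stands for the
    compact support. *)
Definition capprox ss f := forall e : R, 0 < e ->
  exists2 cs, supp_in ss (step cs) & sbound (f - step cs) e.

Lemma capprox_supp ss f : capprox ss f -> supp_in ss f.
Proof.
move=> h x n0; apply: contrapT => n; apply: n0; apply: cabs0_eq; apply/eqP.
rewrite eq_le cabs_ge0 andbT; apply/ler_addgt0Pr => e e0; rewrite add0r.
have [cs ucs /(_ x)] := h e e0; rewrite Cc_sub.
have -> : step cs x = 0 by apply: contrapT => /ucs.
by rewrite subr0.
Qed.

Lemma sbound_step cs : exists2 M, 0 <= M & sbound (step cs) M.
Proof.
exists (\sum_(p <- cs) cabs p.1); first exact: sumr_ge0.
move=> x; rewrite stepE; apply: le_trans (cabs_sum _ _) _; apply: ler_sum => p _.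
rewrite cabsM -[leRHS]mulr1 ler_wpM2l //.
have [h|h] := pselect (cyl p.2 x); first by rewrite indT // cabs1.
by rewrite indF // cabs0.
Qed.

Lemma capprox_bound ss f : capprox ss f -> exists2 M, 0 <= M & sbound f M.
Proof.
move=> h; have [cs _ hcs] := h 1 ltr01; have [M M0 hM] := sbound_step cs.
exists (1 + M); first by rewrite addr_ge0.
move=> x; have := hcs x; have := hM x; rewrite Cc_sub => h1 h2.
by have := cabsD (f x - step cs x) (step cs x); rewrite subrK; lra.
Qed.

Lemma nbhs_cylI s x : nbhs x [set y | cyl s y <-> cyl s x].
Proof.
have [h|h] := pselect (cyl s x).
  by apply: filterS (open_nbhs_nbhs (conj (open_cyl s) h)) => y hy; split.
have oc : open (~` cyl s) by rewrite openC; exact: closed_cyl.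
by apply: filterS (open_nbhs_nbhs (conj oc h)) => y hy; split.
Qed.

Lemma nbhs_step cs x : nbhs x [set y | step cs y = step cs x].
Proof.
elim: cs => [|p cs IH]; first by apply: filterS filterT => y _ /=; rewrite !stepE !big_nil.
apply: filterS (filterI (nbhs_cylI p.2 x) IH) => y [e1]; rewrite /= !stepE !big_cons => ->.
by congr (_ * _ + _); rewrite /ind; congr (_%:R); congr (nat_of_bool _); apply: asbool_equiv_eq.
Qed.

Lemma supp_compact ss f : supp_in ss f -> compact (closure [set x | f x != 0]).
Proof.
move=> h; pose K := \big[setU/set0]_(s <- ss) cyl s.
have cK : compact K by apply: bigsetU_compact => s _; exact: compact_cyl.
have clK : closed K by apply: closed_bigsetU => s _; exact: closed_cyl.
apply: (subclosed_compact (B := K)) => //; first exact: closed_closure.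
have clE : closure K = K by apply/esym/closure_id.
rewrite -clE; apply: closureS => x /= /eqP/h[s sin sx].
by rewrite /K -bigcup_seq; exists s.
Qed.

Lemma capprox_dom ss f : capprox ss f -> sa_dom f.
Proof.
move=> h; split; last exact: supp_compact (capprox_supp h).
apply/cts_rnorm => x e e0; have ep : 0 < e / 4 by rewrite divr_gt0.
have [cs _ hcs] := h _ ep; apply: filterS (nbhs_step cs x) => y /= ey.
have := hcs y; have := hcs x; rewrite !Cc_sub ey => h1 h2.
have := cabsD (f y - step cs x) (step cs x - f x); rewrite addrA subrK [cabs (step cs x - _)]cabsC.
rewrite /rnorm -/(cabs _); lra.
Qed.

Lemma dom_capprox f : sa_dom f -> exists ss, capprox ss f.
Proof.
move=> [cf cK]; have [ss hss] := compact_cover_cyl cK; exists ss => e e0.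
pose Good (U : set (pgroupoid E)) := exists cs, forall x, U x -> cabs (f x - step cs x) <= e.
have G0 : Good set0 by exists [::].
have GS U V : U `<=` V -> Good V -> Good U by move=> UV [cs h]; exists cs => x /UV/h.
have GU t V : Good (cyl t) -> Good V -> Good (cyl t `|` V).
  (* Gluing by the function ds + 1_t (cs - ds). *)
  move=> [cs h] [ds k]; exists (ds ++ cut t cs ++ comb_scale (-1) (cut t ds)) => x xtV.
  rewrite !step_cat step_scale !step_cut.
  have [xt|nxt] := pselect (cyl t x).
    rewrite indT // !mul1r mulN1r addrCA subrr addr0; exact: h.
  rewrite indF // !mul0r mulr0 !addr0; apply: k.
  by case: xtV.
have Gc s : Good (cyl s).
  apply: cyl_induction => // x xs; have [s0 xs0] := cyl_cover x.
  exists ([set y | rnorm (f y - f x) < e] `&` cyl s0).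
    apply: filterI; first by move/cts_rnorm: cf; exact.
    by apply: open_nbhs_nbhs; split => //; exact: open_cyl.
  (* Near x, inside a cylinder, f is within e of the constant f x. *)
  exists [:: (f x, s0)] => y [/= hy ys0]; rewrite stepE big_seq1 /= indT // mulr1.
  exact: ltW.
have [cs hcs] := good_cover (ts := ss) GS GU (fun t _ => Gc t) G0.
exists (cuts ss cs); first exact: under_supp (@under_cuts ss cs).
move=> x; rewrite Cc_sub; have [h|n] := pselect (exists2 s, s \in ss & cyl s x).
  by rewrite step_cuts //; apply: hcs; left.
have -> : f x = 0.
  apply: contrapT => /eqP fx; apply: n; apply: hss; exact: subset_closure.
have -> : step (cuts ss cs) x = 0 by apply: contrapT => /(under_supp (@under_cuts ss cs)).
by rewrite subr0 cabs0 ltW.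
Qed.

Lemma capprox_step ss cs : supp_in ss (step cs) -> capprox ss (step cs).
Proof. by move=> h e e0; exists cs => // x; rewrite Cc_sub subrr cabs0 ltW. Qed.

Lemma step_dom cs : sa_dom (step cs).
Proof. exact: capprox_dom (capprox_step (@self_supp cs)). Qed.

Lemma ind_dom s : sa_dom (ind s).
Proof. by have := step_dom [:: (1, s)]; rewrite /step lin1. Qed.

End StepFunctions.

(* Split x as q x + (x - q x) for one projection after the other; T preserves
   orthogonality of the parts. *)
Lemma joint_eigen_bound (R : realType) (H : hilbertType R) (T : opalg H) (M : R)
    (Q : seq (opalg H)) (K : H -> Prop) :
  (forall q, q \in Q -> [/\ cs_star q = q, cs_mul q q = q & cs_mul q T = cs_mul T q]) ->
  (forall q r, q \in Q -> r \in Q -> cs_mul q r = cs_mul r q) ->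
  0 <= M ->
  (forall q x, q \in Q -> K x -> K (opval q x) /\ K (x - opval q x)) ->
  (forall x, K x -> (forall q, q \in Q -> opval q x = x \/ opval q x = 0) ->
     rnorm (opval T x) <= M * rnorm x) ->
  forall x, K x -> rnorm (opval T x) <= M * rnorm x.
Proof.
move=> + + M0; elim: Q K => [|q Q IH] K hQ cQ inv eig x Kx; first exact: eig.
have [qs qq qT] := hQ q (mem_head _ _).
have qqE y : opval q (opval q y) = opval q y by rewrite -opvalM -[in RHS]qq.
have bq := opval_bounded q; have bT := opval_bounded T.
(* Making the eigenvector condition for q part of K lets the induction go on with Q: both parts q x
   and x - q x satisfy it, and the other projections preserve it. *)
pose K' y := K y /\ (opval q y = y \/ opval q y = 0).
have IHK : forall y, K' y -> rnorm (opval T y) <= M * rnorm y.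
  apply: IH.
  - by move=> r rQ; apply: hQ; rewrite inE rQ orbT.
  - by move=> r r' rQ rQ'; apply: cQ; rewrite inE ?rQ ?rQ' orbT.
  - move=> r y rQ [Ky qy]; have rQ' : r \in q :: Q by rewrite inE rQ orbT.
    have [h1 h2] := inv r y rQ' Ky.
    have qr : opval q (opval r y) = opval r (opval q y).
      by have := congr1 (fun a => opval a y) (cQ q r (mem_head _ _) rQ').
    split; split => //; rewrite ?bounded_opB // qr; case: qy => ->.
    + by left.
    + by right; rewrite bounded_op0 //; exact: opval_bounded.
    + by left.
    + by right; rewrite [opval r 0]bounded_op0 ?subr0 //; exact: opval_bounded.
  move=> y [Ky qy] hy; apply: eig => // r; rewrite inE => /orP[/eqP -> //|]; exact: hy.
have [h1 h2] := inv q x (mem_head _ _) Kx.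
have b1 : rnorm (opval T (opval q x)) <= M * rnorm (opval q x).
  by apply: IHK; split => //; left.
have b2 : rnorm (opval T (x - opval q x)) <= M * rnorm (x - opval q x).
  by apply: IHK; split => //; right; rewrite bounded_opB // qqE subrr.
have qa y z : hdot (opval q y) z = hdot y (opval q z).
  by have := opval_adj q y z; rewrite [opstar q]qs.
have Tq y : opval T (opval q y) = opval q (opval T y).
  by have := congr1 (fun a => opval a y) qT.
have o1 : hdot (opval q x) (x - opval q x) = 0.
  by rewrite qa bounded_opB // qqE subrr hdot0r.
have o2 : hdot (opval T (opval q x)) (opval T (x - opval q x)) = 0.
  by rewrite Tq qa -Tq bounded_opB // qqE subrr bounded_op0 // hdot0r.
have ex : x = opval q x + (x - opval q x) by rewrite addrC subrK.
have := rnorm_pyth o1; have := rnorm_pyth o2; rewrite -bounded_opD // -ex => e2 e1.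
rewrite -(@ler_pXn2r _ 2) ?nnegrE ?mulr_ge0 // exprMn e2 e1 mulrDr -!exprMn.
by apply: lerD; rewrite ler_pXn2r ?nnegrE ?mulr_ge0.
Qed.

(** * Sup-norm bounds for combinations of cylinders *)

Section FamilyBound.
Variables (R : realType) (E : digraph).
Local Notation comb := (comb R E).
Implicit Types (cs ds : comb) (s t : gis E) (ss ts : seq (gis E)) (a b c m : fpath E).

Lemma idem_prefix b c : is_prefix c b ->
  gis_mul (gpair b b) (gpair c c) = gpair b b /\ gis_mul (gpair c c) (gpair b b) = gpair b b.
Proof.
case/prefixP_cat => m cm ->; split; first by rewrite gis_mulEl // prng_pcat.
by rewrite gis_mulEr // prng_pcat.
Qed.

Lemma idem_comm b c : gis_mul (gpair b b) (gpair c c) = gis_mul (gpair c c) (gpair b b).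
Proof.
have [/idem_prefix[-> ->]//|n1] := boolP (is_prefix c b).
have [/idem_prefix[-> ->]//|n2] := boolP (is_prefix b c).
by rewrite !gis_mul_disj.
Qed.

(** The source idempotent: (b, b) for the pair (a, b). *)
Definition gsrc t : gis E := gis_mul (gis_star t) t.

Lemma gsrc_pair a b : prng a = prng b -> gsrc (gpair a b) = gpair b b.
Proof. by move=> h; rewrite /gsrc gis_star_pair // gis_mul_mid. Qed.

Lemma gsrc_comm s t : gis_mul (gsrc s) (gsrc t) = gis_mul (gsrc t) (gsrc s).
Proof.
case: (gisP s) => [|a b h]; first by rewrite gis_muls0.
case: (gisP t) => [|a' b' h']; first by rewrite gis_muls0.
by rewrite !gsrc_pair // idem_comm.
Qed.

Lemma gle_mul_gsrc s t : gle t s -> gis_mul s (gsrc t) = t.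
Proof.
move=> [a [b [m [ab am -> ->]]]]; have bm : prng b = psrc m by rewrite -ab.
have e : prng (pcat a m) = prng (pcat b m) by rewrite !prng_pcat.
by rewrite gsrc_pair // gis_mulEr // prng_pcat.
Qed.

Section Chain.
Variables (H : hilbertType R) (w : gis E -> opalg H).
Hypothesis fw : gis_family w.

(** The relation at the vertex r(b), conjugated by the element (b, r(b)). *)
Lemma idem_vfin b : Vfin (prng b) ->
  w (gpair b b) = \sum_(e <- fset_set (out_edges (prng b)))
    w (gpair (pcat b (pedge e)) (pcat b (pedge e))).
Proof.
move=> fb; have [wM _ _ wF] := fw; pose v := pvert (prng b).
have hv : prng b = prng v by [].
have -> : gpair b b = gis_mul (gpair b v) (gis_mul (gpair v v) (gpair v b)).
  by rewrite !gis_mul_mid.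
rewrite !wM wF // cs_mul_suml cs_mul_sumr.
rewrite [LHS]big_seq [RHS]big_seq; apply: eq_bigr => e.
rewrite in_fset_set // inE => se; rewrite -!wM; congr (w _).
have sv : prng v = psrc (pedge e) by rewrite psrc_pedge se.
have ev : pedge e = pcat v (pedge e) by rewrite vert_pcat ?psrc_pedge.
rewrite {2}ev gis_mulEl //= ?psrc_pedge ?se //.
have -> : gpair (pedge e) (pcat b (pedge e)) = gpair (pcat v (pedge e)) (pcat b (pedge e)) by rewrite -ev.
by rewrite gis_mulEr // ?prng_pcat ?psrc_pedge ?se.
Qed.

(* At a finite emitter the Cuntz-Krieger relation provides an edge whose
   projection does not kill x; the path that follows these edges gives the point. *)
Lemma chain_point a b x : prng a = prng b -> opval (w (gpair b b)) x <> 0 ->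
  exists2 g, cyl (gpair a b) g &
    forall t, cyl t g -> opval (w (gsrc t)) x <> 0.
Proof.
move=> ab bx; have [wM _ _ _] := fw.
have [||c [Xc sc lim]] := @path_chain E (fun m => opval (w (gpair m m)) x <> 0) (fun=> True) b.
- exact: bx.
- move=> m mx; have [fm|im] := pselect (Vfin (prng m)); last by left.
  right; apply: contrapT => n; apply: mx; rewrite idem_vfin // opval_sum big1_seq // => e /= he.
  apply: contrapT => h; apply: n; exists (pedge e); split => //.
  by move: he; rewrite in_fset_set // inE psrc_pedge.
have sca : xsrc c = prng a by rewrite ab.
have [g eg] := point_ex ab Xc sca.
exists g; first by apply/cylP => //; exists c.
move=> t tg.
(* An initial piece b m of the path, long enough to refine t: its projection lies below that of t
   and does not kill x. *)
suff [m [bm bmx gm l]] : exists m, [/\ prng b = psrc m, opval (w (gpair (pcat b m) (pcat b m))) x <> 0,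
    cyl (gpair (pcat a m) (pcat b m)) g & (glen t <= plen (pcat a m))%N].
  have e : prng (pcat a m) = prng (pcat b m) by rewrite !prng_pcat // ab.
  rewrite -(glen_pair e) in l.
  have [a' [b' [k [ab' ak et em]]]] := cyl_nest tg gm l.
  have bk : prng b' = psrc k by rewrite -ab'.
  have ek : prng (pcat a' k) = prng (pcat b' k) by rewrite !prng_pcat.
  have [_ eb] := gpair_inj e ek em.
  rewrite et gsrc_pair // => h; apply: bmx; rewrite eb.
  have [<- _] := idem_prefix (is_prefix_pcat bk).
  rewrite wM [LHS](_ : _ = opval (w (gpair (pcat b' k) (pcat b' k))) (opval (w (gpair b' b')) x)) //.
  by rewrite h bounded_op0 //; exact: opval_bounded.
case: lim => [[m [em bm mx _]]|lim].
  have am : prng a = psrc m by rewrite ab.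
  have hm : prng (pcat a m) = prng (pcat b m) by rewrite !prng_pcat.
  exists m; split => //.
    apply/cylP => //; exists (XFin (pvert (prng m))); split.
    - by move: Xc; rewrite em.
    - by rewrite prng_pcat.
    by rewrite eg em /= !pcat_vert ?prng_pcat // /pdeg !plen_pcat // !PoszD opprD addrACA subrr addr0.
  case: (gisP t) tg => // a' b' ab' /(cylP _ ab')[d [_ sd]].
  rewrite eg em => -[]; case: d sd => //= y sy [e] _ _.
  by rewrite glen_pair // e plen_pcat ?leq_addr.
have [m [d [lm [bm md] Xd ec mx]]] := lim (glen t).
have am : prng a = psrc m by rewrite ab.
have e : prng (pcat a m) = prng (pcat b m) by rewrite !prng_pcat.
exists m; split => //; last by rewrite plen_pcat // (leq_trans lm) // leq_addl.
apply/cylP => //; exists d; split => //; first by rewrite prng_pcat.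
rewrite eg ec !xcatA //; congr (_, _, _).
by rewrite /pdeg !plen_pcat // !PoszD opprD addrACA subrr addr0.
Qed.

(** Below a single s, the value is w(s) times a combination T of commuting source projections. On a
    joint eigenvector x the operator T acts by a scalar, which is the value of [step cs] at a
    suitable point and so at most M in modulus. *)
Lemma single_bound s cs M : under [:: s] cs -> 0 <= M -> @sbound R E (step cs) M ->
  rnorm (lin w cs) <= M.
Proof.
move=> ucs M0 hM; have [wM wS w0 _] := fw.
pose T := lin w [seq (p.1, gsrc p.2) | p <- cs].
have eT : lin w cs = cs_mul (w s) T.
  rewrite /T /lin big_map cs_mul_sumr [LHS]big_seq [RHS]big_seq; apply: eq_bigr => p /ucs pcs.
  rewrite [RHS](cs_mulZr p.1 (w s) (w (gsrc p.2))) -wM; case: pcs => [->|[r]]; first by rewrite gis_muls0.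
  by rewrite inE => /eqP -> /gle_mul_gsrc ->.
suff : rnorm T <= M.
  rewrite eT => hT; apply: le_trans (cs_rnormM _ _) _.
  by rewrite -[leRHS]mul1r ler_pM // (family_norm _ fw).
have qq t : cs_mul (w (gsrc t)) (w (gsrc t)) = w (gsrc t) by rewrite -wM gis_inv_idem.
have qs t : cs_star (w (gsrc t)) = w (gsrc t) by rewrite -wS gis_starM gis_starK.
have qc t t' : cs_mul (w (gsrc t)) (w (gsrc t')) = cs_mul (w (gsrc t')) (w (gsrc t)).
  by rewrite -!wM gsrc_comm.
pose Q := [seq w (gsrc p.2) | p <- cs].
apply: op_rnorm_le => // x; apply: (@joint_eigen_bound R H T M Q (fun=> True)) => //.
- move=> _ /mapP[p _ ->]; split => //.
  rewrite /T /lin big_map cs_mul_sumr cs_mul_suml; apply: eq_bigr => q _.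
  have e1 := cs_mulZr q.1 (w (gsrc p.2)) (w (gsrc q.2)).
  have e2 := cs_mulZl q.1 (w (gsrc q.2)) (w (gsrc p.2)).
  by rewrite [LHS]e1 [RHS]e2 qc.
- by move=> _ _ /mapP[p _ ->] /mapP[q _ ->].
move=> {}x _ eig.
have [->|/eqP x0] := eqVneq x 0; first by rewrite bounded_op0 ?rnorm0 ?mulr0 //; exact: opval_bounded.
have {}eig p : p \in cs -> opval (w (gsrc p.2)) x = x \/ opval (w (gsrc p.2)) x = 0.
  by move=> pcs; apply: eig; apply/mapP; exists p.
have ET : opval T x = \sum_(p <- cs) p.1 *: opval (w (gsrc p.2)) x.
  by rewrite /T opval_lin lin_fctE big_map.
(* Among the projections that fix x the longest one is the smallest; if none fixes x then T x =
   0. *)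
have [[p0 [p0cs p0x p0max]]|no] := pselect (exists p0, [/\ p0 \in cs, opval (w (gsrc p0.2)) x = x &
    forall p, p \in cs -> opval (w (gsrc p.2)) x = x -> (glen p.2 <= glen p0.2)%N]); last first.
  suff -> : opval T x = 0 by rewrite rnorm0 mulr_ge0.
  rewrite ET big1_seq // => p /= pcs; have [px|->] := eig p pcs; last by rewrite scaler0.
  case: no; pose P n := has (fun q => `[< opval (w (gsrc q.2)) x = x >] && (glen q.2 == n)) cs.
  have exP : exists n, P n.
    by exists (glen p.2); apply/hasP; exists p => //; rewrite eqxx andbT; apply/asboolP.
  have ubP n : P n -> (n <= \max_(q <- cs) glen q.2)%N.
    by case/hasP => q qcs /andP[_ /eqP <-]; exact: leq_bigmax_seq.
  case: (ex_maxnP exP ubP) => n /hasP[q qcs /andP[/asboolP qx /eqP <-]] nmax.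
  exists q; split => // r rcs rx; apply: nmax; apply/hasP; exists r => //.
  by rewrite eqxx andbT; apply/asboolP.
have s0 : p0.2 <> None.
  by move=> e; apply: x0; rewrite -p0x e /gsrc /= w0.
have le_s p : p \in cs -> opval (w (gsrc p.2)) x = x -> gle p.2 s.
  move=> pcs px; have [e|[r]] := ucs p pcs; last by rewrite inE => /eqP ->.
  by case: x0; rewrite -px e /gsrc /= w0.
(* Every cylinder through g has a projection that does not kill x and so, if it occurs in cs, fixes
   x. Conversely, a projection that fixes x belongs to a cylinder that contains the one of p0 and
   hence g. *)
have [g gp0 gx] : exists2 g, cyl p0.2 g & forall t, cyl t g -> opval (w (gsrc t)) x <> 0.
  case: (gisP p0.2) s0 p0x => // a b ab _; rewrite gsrc_pair // => bx.
  by apply: chain_point => //; rewrite bx.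
suff -> : opval T x = step cs g *: x by rewrite rnormZ ler_wpM2r.
rewrite ET stepE scaler_suml [LHS]big_seq [RHS]big_seq; apply: eq_bigr => p pcs.
rewrite -scalerA; congr (_ *: _).
have [pg|npg] := pselect (cyl p.2 g).
  by rewrite indT // scale1r; have [//|h] := eig p pcs; case: (gx _ pg).
rewrite indF // scale0r; have [px|//] := eig p pcs.
case: npg; apply: cyl_le gp0.
have [a [b [m [ab am es ep]]]] := le_s p pcs px.
have [a' [b' [m' [ab' am' es' ep']]]] := le_s p0 p0cs p0x.
have [ea eb] := gpair_inj ab ab' (etrans (esym es) es').
rewrite -ea -eb {a' b' ea eb ab' es'} in am' ep' *.
have bm : prng b = psrc m by rewrite -ab.
have bm' : prng b = psrc m' by rewrite -ab.
have hm : prng (pcat a m) = prng (pcat b m) by rewrite !prng_pcat.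
have hm' : prng (pcat a m') = prng (pcat b m') by rewrite !prng_pcat.
have := p0max p pcs px; rewrite ep ep' !glen_pair // !plen_pcat // leq_add2l => l.
(* Both projections fix x, which is not 0, so their product is not zero and the paths b m, b m' are
   comparable; maximality of p0 makes b m the prefix. *)
have nz : gis_mul (gsrc p0.2) (gsrc p.2) <> None.
  move=> e; apply: x0; rewrite -[LHS]p0x -[in LHS]px.
  have := congr1 (fun a : opalg H => opval a x) (wM (gsrc p0.2) (gsrc p.2)); rewrite e w0; exact: esym.
have lb : (plen (pcat b m) <= plen (pcat b m'))%N by rewrite !plen_pcat // leq_add2l.
have pre : is_prefix (pcat b m) (pcat b m').
  apply: contraT => n1; have [pr|n2] := boolP (is_prefix (pcat b m') (pcat b m)).
    move: n1; rewrite (is_prefix_eq pr) ?is_prefix_refl //; apply/eqP.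
    by rewrite eqn_leq lb andbT is_prefix_len.
  by case: nz; rewrite ep ep' !gsrc_pair // gis_mul_disj.
have /prefixP_cat[k hk ek] := pre.
have mk : prng m = psrc k by rewrite -hk prng_pcat.
have em' : m' = pcat m k.
  apply: (@pcat_inj _ b) => //; first by rewrite psrc_pcat.
  by rewrite ek pcatA.
exists (pcat a m), (pcat b m), k; split => //; first by rewrite prng_pcat.
by rewrite em' !pcatA.
Qed.

End Chain.

Lemma single_bound_univ (A : cstarAlg R) (u : gis E -> A) s cs M : univ u ->
  under [:: s] cs -> 0 <= M -> @sbound R E (step cs) M -> rnorm (lin u cs) <= M.
Proof.
move=> [_ _ _ h] ucs M0 hM; apply: h => H Pi hPi.
have [w fw ew] := gis_rep_family hPi.
have -> : lin Pi cs = opval (lin w cs) by rewrite opval_lin; congr (lin _ cs); apply/funext.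
by rewrite opval_norm; exact: (single_bound fw ucs M0 hM).
Qed.

(** Split the function into 1_s f and (1 - 1_s) f. The first part is below s; the second must be a
    combination below the remaining list, term by term. Terms below s agree with their own cuts and
    drop out, which is why [rem] involves only [out]. *)
Lemma multi_bound (A : cstarAlg R) (u : gis E -> A) ss cs M : gis_family u ->
  (forall s cs M, under [:: s] cs -> 0 <= M -> @sbound R E (step cs) M -> rnorm (lin u cs) <= M) ->
  under ss cs -> 0 <= M -> @sbound R E (step cs) M -> rnorm (lin u cs) <= (size ss)%:R * M.
Proof.
move=> [_ _ u0 _] single; elim: ss cs => [|s ss IH] cs ucs M0 hM.
  rewrite mul0r /lin big1_seq ?rnorm0 // => p /= /ucs[->|[//]]; by rewrite u0 scaler0.
pose P (p : R[i] * gis E) := `[< gle p.2 s >].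
pose out := [seq p <- cs | ~~ P p]; pose inn := [seq p <- cs | P p].
pose rem := out ++ comb_scale (-1) (cut s out).
have e1 (V : lmodType R[i]) (v : gis E -> V) : lin v (cut s inn) = lin v inn.
  rewrite /lin big_map [LHS]big_seq [RHS]big_seq; apply: eq_bigr => p.
  by rewrite mem_filter => /andP[/asboolP h _] /=; rewrite gmeet_idr.
have ecs (V : lmodType R[i]) (v : gis E -> V) : lin v cs = lin v inn + lin v out.
  by rewrite -lin_cat; apply: perm_big; rewrite perm_sym; apply/permPl; exact: perm_filterC.
have ecut (V : lmodType R[i]) (v : gis E -> V) :
    lin v (cut s cs) = lin v (cut s inn) + lin v (cut s out).
  by rewrite /lin !big_map; exact: (ecs V (fun t => v (gmeet s t))).
have e2 (V : lmodType R[i]) (v : gis E -> V) : lin v cs = lin v (cut s cs) + lin v rem.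
  by rewrite ecs ecut e1 lin_sub -addrA; congr (_ + _); rewrite addrC subrK.
have ind01 x : ind R s x = 0 \/ ind R s x = 1.
  by have [h|h] := pselect (cyl s x); [right; rewrite indT|left; rewrite indF].
have scut x : step cs x = ind R s x * step cs x + step rem x.
  by rewrite -step_cut; exact: (congr1 (fun f : pg_Cc R E => f x) (e2 _ (@ind R E))).
have urem : under ss rem.
  have uout : under ss out.
    move=> p; rewrite mem_filter => /andP[np /ucs[->|[r]]]; first by left.
    rewrite inE => /orP[/eqP -> h|rss h]; last by right; exists r.
    by case/negP: np; apply/asboolP.
  by apply: under_cat => //; apply: under_scale; exact: under_cut_ss.
rewrite e2 mulrSr [(_ + 1) * _]mulrDl mul1r [leRHS]addrC; apply: le_trans (rnormD _ _) _; apply: lerD.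
  apply: (single s) => //; first exact: under_cut.
  move=> x; rewrite step_cut; case: (ind01 x) => ->; first by rewrite mul0r cabs0.
  by rewrite mul1r.
apply: IH => // x; move: (scut x); case: (ind01 x) => ->; first by rewrite mul0r add0r => <-.
rewrite mul1r -[LHS]addr0 => /addrI <-; by rewrite cabs0.
Qed.

Definition sup_bounded (A : cstarAlg R) (u : gis E -> A) := forall ss cs M,
  supp_in ss (step cs) -> 0 <= M -> @sbound R E (step cs) M -> rnorm (lin u cs) <= (size ss)%:R * M.

(** Passes from term by term support to the support of the function. *)
Lemma single_sup_bounded (A : cstarAlg R) (u : gis E -> A) : gis_family u ->
  (forall s cs M, under [:: s] cs -> 0 <= M -> @sbound R E (step cs) M -> rnorm (lin u cs) <= M) ->
  sup_bounded u.
Proof.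
move=> fu single ss cs M scs M0 hM; have [_ _ u0 _] := fu.
have ec x : step (cuts ss cs) x = step cs x.
  have [h|n] := pselect (exists2 s, s \in ss & cyl s x); first exact: step_cuts.
  have -> : step cs x = 0 by apply: contrapT => /scs.
  by apply: contrapT => /(under_supp (@under_cuts R E ss cs)).
(* The two combinations have the same function; the difference has function 0, and the bound with M
   = 0 annihilates its value. *)
have -> : lin u cs = lin u (cuts ss cs).
  apply/eqP; rewrite -subr_eq0 -lin_sub; apply/eqP/rnorm0_eq/eqP.
  rewrite eq_le rnorm_ge0 andbT; set ds := cs ++ _.
  rewrite -[leRHS](mulr0 (size [seq p.2 | p <- ds])%:R); apply: multi_bound => //.
    move=> p pds; have [->|/eqP n] := eqVneq p.2 None; first by left.
    by right; exists p.2; [apply/mapP; exists p|exact: gle_refl].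
  by move=> x; rewrite step_cat step_scale ec mulN1r subrr cabs0.
apply: multi_bound => //; first exact: under_cuts.
by move=> x; rewrite ec.
Qed.

Lemma univ_sup_bounded (A : cstarAlg R) (u : gis E -> A) : univ u -> sup_bounded u.
Proof.
move=> uu; have [fu _ _ _] := uu.
by apply: single_sup_bounded => // s cs M; exact: single_bound_univ.
Qed.

Lemma op_sup_bounded (H : hilbertType R) (w : gis E -> opalg H) : gis_family w -> sup_bounded w.
Proof. by move=> fw; apply: single_sup_bounded => // s cs M; exact: single_bound. Qed.

End FamilyBound.

(** * Extension of a family to C_c(G) *)

Section Kappa.
Variables (R : realType) (E : digraph) (D : cstarAlg R) (u : gis E -> D).
Local Notation comb := (comb R E).
Local Notation Cc := (pg_Cc R E).
Implicit Types (cs ds : comb) (s t : gis E) (ss ts : seq (gis E)) (f g : Cc) (x y k : pgroupoid E).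
Hypothesis fu : gis_family u.
Hypothesis bu : sup_bounded u.

(* The value at f of the extension of u by linearity and continuity. *)
Definition Lim f (l : D) : Prop := exists ss, exists2 C : R, 0 <= C &
  forall e : R, 0 < e -> exists cs, [/\ supp_in ss (step cs), sbound (f - step cs) (C * e)
    & rnorm (lin u cs - l) <= C * e].

Lemma supp_catl ss ts f : supp_in ss f -> supp_in (ss ++ ts) f.
Proof. by apply: supp_sub => s h; rewrite mem_cat h. Qed.
Lemma supp_catr ss ts f : supp_in ts f -> supp_in (ss ++ ts) f.
Proof. by apply: supp_sub => s h; rewrite mem_cat h orbT. Qed.

Lemma Lim_capprox f l : Lim f l -> exists ss, capprox ss f.
Proof.
move=> [ss [C C0 h]]; exists ss => e e0; have C1 : 0 < C + 1 by rewrite ltr_wpDl.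
have [cs [h1 h2 _]] := h (e / (C + 1)) (divr_gt0 e0 C1).
exists cs => // x; apply: le_trans (h2 x) _.
by rewrite mulrCA ler_piMr ?ltW // ltr_pdivrMr // mul1r ltrDl.
Qed.

Lemma Lim_dom f l : Lim f l -> sa_dom f.
Proof. by case/Lim_capprox => ss; exact: capprox_dom. Qed.

Lemma Lim_step cs : Lim (step cs) (lin u cs).
Proof.
exists [seq p.2 | p <- cs], 0 => // e e0; exists cs; rewrite mul0r; split.
- exact: self_supp.
- by move=> x; rewrite Cc_sub subrr cabs0.
by rewrite subrr rnorm0.
Qed.

Lemma sboundB f g h M N : sbound (f - g) M -> sbound (f - h) N -> sbound (g - h) (M + N).
Proof.
move=> h1 h2 x; have := h1 x; have := h2 x; rewrite !Cc_sub => a b.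
have -> : g x - h x = (f x - h x) - (f x - g x) by rewrite opprB [RHS]addrC addrA subrK.
by apply: le_trans (cabsD _ _) _; rewrite cabsN addrC lerD.
Qed.

Lemma step_diff_bound ss ts cs ds M : supp_in ss (step cs) -> supp_in ts (step ds) ->
  0 <= M -> sbound (step cs - step ds) M -> rnorm (lin u cs - lin u ds) <= (size (ss ++ ts))%:R * M.
Proof.
move=> h1 h2 M0 hM; rewrite -lin_sub.
have e : step (cs ++ comb_scale (-1) ds) = step cs - step ds by rewrite /step lin_sub.
apply: bu => //; rewrite e //; apply: supp_B; [exact: supp_catl|exact: supp_catr].
Qed.

Lemma Lim_uniq f l m : Lim f l -> Lim f m -> l = m.
Proof.
move=> [ss [C C0 h]] [ts [C' C0' h']]; apply: rnorm_lt_eq => e e0.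
pose K := C + C' + (size (ss ++ ts))%:R * (C + C') + 1.
have K0 : 0 < K by rewrite ltr_wpDl // !addr_ge0 // mulr_ge0 // addr_ge0.
have d0 : 0 < e / K by exact: divr_gt0.
have [cs [s1 b1 l1]] := h _ d0; have [ds [s2 b2 l2]] := h' _ d0.
have d' := ltW d0.
have b3 : 0 <= C * (e / K) + C' * (e / K) by exact: addr_ge0 (mulr_ge0 C0 d') (mulr_ge0 C0' d').
have l3 := step_diff_bound s1 s2 b3 (sboundB b1 b2).
have ee : e = K * (e / K) by rewrite mulrC divfK ?gt_eqF.
have := rnorm_tri (lin u cs) l m; have := rnorm_tri (lin u ds) (lin u cs) m.
rewrite (rnormC l (lin u cs)); move: l1 l2 l3 => l1 l2 l3 t1 t2.
have {}ee : e = C * (e / K) + C' * (e / K) + (size (ss ++ ts))%:R * (C * (e / K) + C' * (e / K)) + e / K.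
  by rewrite {1}ee {1}/K; ring.
lra.
Qed.

Lemma Lim_ex f : sa_dom f -> exists l, Lim f l.
Proof.
case/dom_capprox => ss h; pose n : R := (size (ss ++ ss))%:R.
pose P (e : R) w := exists cs, [/\ supp_in ss (step cs), sbound (f - step cs) e & w = lin u cs].
have [|||l hl] := @approx_limit R D P n (@seq_completeP R D).
- by [].
- by move=> e e0; have [cs h1 h2] := h e e0; exists (lin u cs), cs.
- move=> d e _ _ d0 e0 [cs [s1 b1 ->]] [ds [s2 b2 ->]].
  by apply: step_diff_bound => //; [rewrite addr_ge0 ?ltW|exact: sboundB b1 b2].
exists l, ss, (n + 1) => [|e e0]; first by rewrite addr_ge0.
have [cs h1 h2] := h e e0; exists cs; split => //.
  by move=> x; apply: le_trans (h2 x) _; rewrite ler_peMl ?(ltW e0) // lerDr.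
have := hl e (lin u cs) e0 (ex_intro _ cs (And3 h1 h2 erefl)).
by move=> hh; apply: le_trans hh _; rewrite ler_wpM2r ?ltW // ltrDl.
Qed.

Lemma Lim_lin (c : R[i]) f g l m : Lim f l -> Lim g m -> Lim (c *: f + g) (c *: l + m).
Proof.
move=> [ss [C C0 h]] [ts [C' C0' h']]; exists (ss ++ ts), (cabs c * C + C').
  by rewrite addr_ge0 ?mulr_ge0.
move=> e e0; have [cs [s1 b1 l1]] := h e e0; have [ds [s2 b2 l2]] := h' e e0.
exists (comb_scale c cs ++ ds).
have es : step (comb_scale c cs ++ ds) = c *: step cs + step ds.
  by rewrite /step lin_cat lin_scale.
split.
- by rewrite es; apply: supp_lin; [exact: supp_catl|exact: supp_catr].
- move=> x; rewrite es [X in cabs X](_ : _ = c * (f - step cs) x + (g - step ds) x).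
    apply: le_trans (cabsD _ _) _; rewrite cabsM mulrDl -mulrA; apply: lerD; last exact: b2.
    by rewrite ler_wpM2l.
  by rewrite !Cc_sub !Cc_lin mulrBr opprD addrACA.
rewrite lin_cat lin_scale [X in rnorm X](_ : _ = c *: (lin u cs - l) + (lin u ds - m)).
  apply: le_trans (rnormD _ _) _; rewrite rnormZ mulrDl -mulrA; apply: lerD => //.
  by rewrite ler_wpM2l.
by rewrite scalerBr opprD addrACA.
Qed.

Definition mul_list ss ts := [seq gis_mul s t | s <- ss, t <- ts].

Lemma supp_mul ss ts f g : supp_in ss f -> supp_in ts g -> supp_in (mul_list ss ts) (sa_mul f g).
Proof.
move=> hf hg k; have [L [_ pL _ h]] := conv_list R ss k; rewrite h // => n0.
apply: contrapT => n; apply: n0; rewrite big1_seq // => p /= /pL[pk _].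
apply: contrapT => n0; apply: n.
have f0 : f p.1 <> 0 by move=> e; apply: n0; rewrite e mul0r.
have g0 : g p.2 <> 0 by move=> e; apply: n0; rewrite e mulr0.
have [s sss sp] := hf _ f0; have [t tts tp] := hg _ g0.
exists (gis_mul s t); first by apply/allpairsP; exists (s, t).
by apply/cyl_mul; exists p.1, p.2.
Qed.

Lemma Lim_mul f g l m : Lim f l -> Lim g m -> Lim (sa_mul f g) (cs_mul l m).
Proof.
move=> Lf Lg; have [ss0 af] := Lim_capprox Lf; have [ts0 ag] := Lim_capprox Lg.
have [M M0 fM] := capprox_bound af; have [N N0 gN] := capprox_bound ag.
move: Lf Lg => [ss1 [C C0 h]] [ts [C' C0' h']].
pose ss := ss0 ++ ss1; pose n : R := (size ss)%:R.
have sf : supp_in ss f by apply: supp_catl; exact: capprox_supp af.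
(* The first two summands account for the uniform error of the convolution, the last two for the
   norm error of the product in D. *)
exists (mul_list ss ts), (n * (C * N) + n * ((M + C) * C') + C * rnorm m + (rnorm l + C) * C').
  by rewrite !addr_ge0 // !mulr_ge0 ?addr_ge0.
(* With e <= 1 the approximations of f and l stay within M + C and |l| + C, so the errors are linear
   in e. *)
move=> e0 e00; pose e := Num.min e0 1.
have e1 : 0 < e by rewrite lt_min e00 ltr01.
have e2 : e <= 1 by rewrite ge_min lexx orbT.
have e3 : e <= e0 by rewrite ge_min lexx.
have [cs [s1' b1 l1]] := h e e1; have [ds [s2 b2 l2]] := h' e e1.
have s1 : supp_in ss (step cs) by exact: supp_catr.
have Ce : 0 <= C * e by exact: mulr_ge0 C0 (ltW e1).
have Ce' : 0 <= C' * e by exact: mulr_ge0 C0' (ltW e1).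
have CeC : C * e <= C by rewrite ler_piMr.
exists (comb_mul cs ds); split.
- by rewrite -conv_step; apply: supp_mul.
- have -> : sa_mul f g - step (comb_mul cs ds) =
      1 *: sa_mul (f - step cs) g + sa_mul (step cs) (g - step ds).
    have a1 := @conv_linl R E ss (-1) _ _ g s1 sf.
    have a2 := @conv_linr R E ss (-1) (step cs) (step ds) g s1.
    move: a1 a2; rewrite !scaleN1r ![- _ + _]addrC => -> ->.
    by rewrite scale1r -conv_step addrA subrK.
  move=> x; rewrite Cc_lin mul1r; apply: le_trans (cabsD _ _) _.
  have k1 : cabs (sa_mul (f - step cs) g x) <= n * (C * e * N).
    by apply: conv_bound => //; exact: supp_B.
  have stM : sbound (step cs) (M + C).
    move=> z; have -> : step cs z = f z - (f - step cs) z by rewrite Cc_sub subKr.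
    apply: le_trans (cabsD _ _) _; rewrite cabsN lerD ?fM //.
    by apply: le_trans (b1 z) _.
  have k2 : cabs (sa_mul (step cs) (g - step ds) x) <= n * ((M + C) * (C' * e)).
    by apply: conv_bound => //; rewrite addr_ge0.
  have n0 : 0 <= n by [].
  apply: le_trans (lerD k1 k2) _.
  have q1 : 0 <= n * (C * N) by rewrite !mulr_ge0.
  have q2 : 0 <= n * ((M + C) * C') by rewrite !mulr_ge0 // addr_ge0.
  have q3 : 0 <= C * rnorm m by rewrite mulr_ge0.
  have q4 : 0 <= (rnorm l + C) * C' by rewrite mulr_ge0 ?addr_ge0.
  have -> : n * (C * e * N) + n * ((M + C) * (C' * e)) = (n * (C * N) + n * ((M + C) * C')) * e by ring.
  apply: ler_pM => //; [by rewrite addr_ge0|exact: ltW|].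
  by rewrite -addrA lerDl addr_ge0.
rewrite (lin_mul fu).
have -> : cs_mul (lin u cs) (lin u ds) - cs_mul l m =
    cs_mul (lin u cs - l) m + cs_mul (lin u cs) (lin u ds - m).
  by rewrite cs_mulBl cs_mulBr [RHS]addrC addrA subrK.
apply: le_trans (rnormD _ _) _.
have lb : rnorm (lin u cs) <= rnorm l + C.
  by rewrite -[lin u cs](subrK l) addrC; apply: le_trans (rnormD _ _) _; rewrite lerD2l (le_trans l1).
have k1 : rnorm (cs_mul (lin u cs - l) m) <= C * e * rnorm m.
  by apply: le_trans (cs_rnormM _ _) _; rewrite ler_wpM2r.
have k2 : rnorm (cs_mul (lin u cs) (lin u ds - m)) <= (rnorm l + C) * (C' * e).
  by apply: le_trans (cs_rnormM _ _) _; rewrite ler_pM.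
have n0 : 0 <= n by [].
have q1 : 0 <= n * (C * N) by rewrite !mulr_ge0.
have q2 : 0 <= n * ((M + C) * C') by rewrite !mulr_ge0 // addr_ge0.
have q3 : 0 <= C * rnorm m by rewrite mulr_ge0.
have q4 : 0 <= (rnorm l + C) * C' by rewrite mulr_ge0 ?addr_ge0.
apply: le_trans (lerD k1 k2) _.
have -> : C * e * rnorm m + (rnorm l + C) * (C' * e) = (C * rnorm m + (rnorm l + C) * C') * e by ring.
apply: ler_pM => //; [by rewrite addr_ge0|exact: ltW|].
by rewrite -[leRHS]addrA lerDr addr_ge0.
Qed.

Lemma Lim_star f l : Lim f l -> Lim (sa_star f) (cs_star l).
Proof.
move=> [ss [C C0 h]]; exists [seq gis_star s | s <- ss], C => // e e0.
have [cs [s1 b1 l1]] := h e e0; exists (comb_star cs); split.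
- rewrite -star_step => x n0; have : step cs (pg_inv x) <> 0.
    by move=> z; apply: n0; rewrite /= z rmorph0.
  case/s1 => s sss /cyl_inv hs; exists (gis_star s) => //; exact: map_f.
- move=> x; rewrite -star_step Cc_sub /= -rmorphB cabsJ; exact: (b1 (pg_inv x)).
by rewrite (lin_star fu) -cs_starB cs_rnorm_star.
Qed.

Definition kappa f : D := xget 0 [set l | Lim f l].

Lemma kappaP f : sa_dom f -> Lim f (kappa f).
Proof. by move/Lim_ex => [l hl]; apply: (xgetPex 0 (P := [set l | Lim f l])); exists l. Qed.

Lemma kappa_eq f l : Lim f l -> kappa f = l.
Proof. by move=> h; apply: Lim_uniq (h); apply: kappaP; exact: Lim_dom h. Qed.

Lemma kappa_step cs : kappa (step cs) = lin u cs.
Proof. exact/kappa_eq/Lim_step. Qed.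

Lemma kappa_ind s : kappa (ind R s) = u s.
Proof. by have := kappa_step [:: (1, s)]; rewrite /step !lin1. Qed.

Lemma kappa_hom : star_hom kappa.
Proof.
split.
- by move=> c f g df dg; apply/kappa_eq/Lim_lin; exact: kappaP.
- by move=> f g df dg; apply/kappa_eq/Lim_mul; exact: kappaP.
by move=> f df; apply/kappa_eq/Lim_star; exact: kappaP.
Qed.

End Kappa.

(** * Representations of the groupoid algebra *)

Section IndVfin.
Variables (R : realType) (E : digraph).

(** At a finite emitter the cylinder of v is the disjoint union of the cylinders of its edges:
    points continue by an edge, and distinct edges give cylinders that are not nested. *)
Lemma ind_vfin v : Vfin v -> ind R (gpair (pvert v) (pvert v)) =
  step [seq (1, gpair (pedge e) (pedge e)) | e <- fset_set (@out_edges E v)].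
Proof.
move=> fv; apply/funext => g; rewrite stepE big_map.
pose V := pvert v.
have eV e : src e = v -> pcat V (pedge e) = pedge e by move=> h; rewrite vert_pcat.
have [gv|ngv] := pselect (cyl (gpair V V) g); last first.
  rewrite indF // big1_seq // => e /= ; rewrite in_fset_set // inE => se.
  rewrite indF ?mulr0 // => ge; apply: ngv; apply: cyl_le ge.
  by exists V, V, (pedge e); split; rewrite ?eV ?psrc_pedge ?se.
have [e0 se0 ge0] := cyl_vfin (erefl (prng V)) fv gv.
rewrite indT // (bigD1_seq e0) ?fset_uniq //=; last by rewrite in_fset_set // inE.
rewrite eV // in ge0; rewrite indT // mulr1 big1_seq ?addr0 // => e /andP[ne].
rewrite in_fset_set // inE => se; rewrite indF ?mulr0 // => ge; case/eqP: ne.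
have [|a [b [m [ab am e1 e2]]]] := cyl_nest ge ge0; first by rewrite !glen_pair.
have [ea _] := gpair_inj (erefl (prng (pedge e))) ab e1.
have hm : prng (pcat a m) = prng (pcat b m) by rewrite !prng_pcat // -ab.
have [ea' _] := gpair_inj (erefl (prng (pedge e0))) hm e2.
have := congr1 (@pedges E) ea'; rewrite pedges_pcat // -ea /=.
by case.
Qed.

Lemma cyl_source s (p q : pgroupoid E) x n m y z :
  cyl s p -> cyl s q -> pg_val p = (x, n, y) -> pg_val q = (x, m, z) -> p = q.
Proof.
case: (gisP s) => // a b ab /(cylP _ ab)[c [_ sc e]] /(cylP _ ab)[c' [_ sc' e']].
rewrite e e' => -[xc _ _] [xc' _ _]; apply: pg_val_inj; rewrite e e'.
by rewrite (@xcat_inj _ a c c') // xc xc'.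
Qed.

End IndVfin.

Section Domain.
Variables (R : realType) (E : digraph).
Local Notation Cc := (pg_Cc R E).
Implicit Types (f g : Cc).

(** A value under [Lim] certifies membership in C_c(G), and [Lim] respects the operations. One
    family with values for all of C_c(G) therefore gives closure under the operations. *)
Lemma dom_Lim : exists (A : cstarAlg R) (u : gis E -> A),
  gis_family u /\ forall f, sa_dom f -> exists l, Lim u f l.
Proof.
have [A [u [uu _]]] := univ_exists R E; have [fu _ _ _] := uu.
by exists A, u; split => // f; exact/Lim_ex/univ_sup_bounded.
Qed.

Lemma dom_lin (c : R[i]) f g : sa_dom f -> sa_dom g -> sa_dom (c *: f + g).
Proof.
have [A [u [_ h]]] := dom_Lim => /h[l hl] /h[m hm]; exact: Lim_dom (Lim_lin c hl hm).
Qed.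
Lemma dom_mul f g : sa_dom f -> sa_dom g -> sa_dom (sa_mul f g).
Proof.
have [A [u [fu h]]] := dom_Lim => /h[l hl] /h[m hm]; exact: Lim_dom (Lim_mul fu hl hm).
Qed.
Lemma dom_star f : sa_dom f -> sa_dom (sa_star f).
Proof. have [A [u [fu h]]] := dom_Lim => /h[l hl]; exact: Lim_dom (Lim_star fu hl). Qed.
Lemma dom_sub f g : sa_dom f -> sa_dom g -> sa_dom (f - g).
Proof. by move=> df dg; have := dom_lin (-1) dg df; rewrite scaleN1r addrC. Qed.
Lemma dom0 : sa_dom (0 : Cc).
Proof. by have := @step_dom R E [::]; rewrite /step lin_nil. Qed.

End Domain.

Section PiRep.
Variables (R : realType) (E : digraph) (H : hilbertType R).
Local Notation comb := (comb R E).
Local Notation Cc := (pg_Cc R E).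
Implicit Types (cs ds : comb) (s t : gis E) (ss ts : seq (gis E)) (f g : Cc).

Variable pi : Cc -> H -> H.
Hypothesis hpi : star_rep pi.

Lemma pi0 x : pi 0 x = 0.
Proof.
have [_ pL _ _] := hpi; have := pL (-1) 0 0 x (dom0 R E) (dom0 R E).
by rewrite scaler0 addr0 scaleN1r addNr.
Qed.

Lemma piZ c f x : sa_dom f -> pi (c *: f) x = c *: pi f x.
Proof.
move=> df; have [_ pL _ _] := hpi.
by have := pL c f 0 x df (dom0 R E); rewrite addr0 pi0 addr0.
Qed.

Lemma piD f g x : sa_dom f -> sa_dom g -> pi (f + g) x = pi f x + pi g x.
Proof.
move=> df dg; have [_ pL _ _] := hpi.
by have := pL 1 f g x df dg; rewrite !scale1r.
Qed.

Lemma pi_step cs x : pi (step cs) x = \sum_(p <- cs) p.1 *: pi (ind R p.2) x.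
Proof.
have [_ pL _ _] := hpi; elim: cs => [|p cs IH]; first by rewrite /step lin_nil big_nil pi0.
by rewrite step_cons pL ?IH ?big_cons //; [exact: ind_dom|exact: step_dom].
Qed.

Lemma pi_family : exists2 w : gis E -> opalg H, gis_family w &
  forall s, opval (w s) = pi (ind R s).
Proof.
have [pB pL pM pS] := hpi; have di s := @ind_dom R E s.
have ad s : adjointable (pi (ind R s)).
  split; [exact/pB/di|exists (pi (sa_star (ind R s))); last exact/pS/di].
  by apply: pB; exact: dom_star.
pose w s : opalg H := @SB R (op_subBanach H) _ (ad s).
exists w => //; split.
- move=> s t; apply: opval_ext => x.
  have -> : opval (w (gis_mul s t)) = pi (sa_mul (ind R s) (ind R t)) by rewrite conv_ind.
  exact: pM.
- move=> s; apply/esym/opval_star_eq.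
  have -> : opval (w (gis_star s)) = pi (sa_star (ind R s)) by rewrite star_ind.
  exact: pS (di s).
- apply: opval_ext => x; rewrite -[RHS](pi0 x).
  have -> : (0 : Cc) = ind R None by apply/funext => g; rewrite indF.
  by [].
move=> v fv; apply: opval_ext => x; rewrite opval_sum.
have -> : opval (w (gpair (pvert v) (pvert v))) = pi (ind R (gpair (pvert v) (pvert v))) by [].
rewrite ind_vfin // pi_step big_map; apply: eq_bigr => e _.
by rewrite scale1r.
Qed.

Lemma pi_lin (w : gis E -> opalg H) cs : (forall s, opval (w s) = pi (ind R s)) ->
  opval (lin w cs) = pi (step cs).
Proof.
move=> hw; apply/funext => x; rewrite opval_lin lin_fctE pi_step.
by apply: eq_bigr => p _; rewrite hw.
Qed.

Lemma pi_sq f x : sa_dom f ->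
  hdot x (pi (sa_mul (sa_star f) f) x) = (rnorm (pi f x) ^+ 2)%:C.
Proof.
move=> df; have [_ _ pM pS] := hpi.
by rewrite -hdotxx pS // -pM //; exact: dom_star.
Qed.

(* On the cylinder, [|f|^2 + |cocyl s M f|^2 = M^2]. *)
Definition cocyl s (M : R) f : Cc :=
  fun x : pgroupoid E => ind R s x * (Num.sqrt (M ^+ 2 - cabs (f x) ^+ 2))%:C.

Lemma dom_sqrt s f M : 0 <= M -> sa_dom f -> sbound f M ->
  sa_dom (cocyl s M f).
Proof.
move=> M0 [cf _] fM; split; last first.
  apply: (supp_compact (ss := [:: s])) => g n0; exists s; rewrite ?mem_head //.
  by apply: contrapT => h; apply: n0; rewrite /cocyl indF // mul0r.
apply/cts_rnorm => g e e0.
(* From |sqrt p - sqrt q|^2 <= |p - q| and | |f h|^2 - |f g|^2 | <= 2 M |f h - f g|; the added 1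
   covers M = 0. *)
have d0 : 0 < e ^+ 2 / (2 * M + 1) by rewrite divr_gt0 ?exprn_gt0 // ltr_wpDl // mulr_ge0.
move/cts_rnorm: cf => /(_ g _ d0) cf.
apply: filterS (filterI (nbhs_cylI s g) cf) => h [/= hs hf].
rewrite /cocyl.
have -> : ind R s h = ind R s g by rewrite /ind; congr (_%:R); congr nat_of_bool; exact: asbool_equiv_eq.
rewrite -mulrBr; change (cabs (ind R s g * ((Num.sqrt (M ^+ 2 - cabs (f h) ^+ 2))%:C -
  (Num.sqrt (M ^+ 2 - cabs (f g) ^+ 2))%:C)) < e).
have [sg|nsg] := pselect (cyl s g); last by rewrite indF // mul0r cabs0.
rewrite indT // mul1r -rmorphB cabsR.
have sq z : Num.sqrt (M ^+ 2 - cabs (f z) ^+ 2) ^+ 2 = M ^+ 2 - cabs (f z) ^+ 2.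
  by rewrite sqr_sqrtr // subr_ge0 ler_pXn2r ?nnegrE.
have s0 z : 0 <= Num.sqrt (M ^+ 2 - cabs (f z) ^+ 2) by exact: sqrtr_ge0.
move: (sq h) (sq g) (s0 h) (s0 g); set a := Num.sqrt _; set b := Num.sqrt _ => ea eb a0 b0.
have k1 : `|a - b| ^+ 2 <= `|a ^+ 2 - b ^+ 2|.
  rewrite subr_sqr normrM expr2 ler_wpM2l //.
  rewrite [leRHS]ger0_norm ?addr_ge0 //; apply: le_trans (ler_normB _ _) _.
  by rewrite !ger0_norm.
have k2 : `|a ^+ 2 - b ^+ 2| <= cabs (f h - f g) * (2 * M).
  rewrite ea eb opprB addrC addrA subrK subr_sqr normrM ler_pM //.
    have t1 := cabsD (f h - f g) (f g); have t2 := cabsD (f g - f h) (f h).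
    rewrite !subrK in t1 t2; rewrite (cabsC (f g)) in t2.
    by rewrite ler_norml; apply/andP; split; lra.
  by rewrite ger0_norm ?addr_ge0 // mulr2n mulrDl mul1r lerD.
rewrite -(@ltr_pXn2r _ 2) ?nnegrE ?(ltW e0) //.
have hf' : cabs (f h - f g) < e ^+ 2 / (2 * M + 1) by [].
have M1 : 0 < 2 * M + 1 by rewrite ltr_wpDl // mulr_ge0.
rewrite ltr_pdivlMr // in hf'.
have := cabs_ge0 (f h - f g); nra.
Qed.

(** On a bisection f* f + k* k = M^2 1_s* 1_s, where k is the complementary root. Applied to x, this
    gives |pi(f) x|^2 <= M^2 |pi(1_s) x|^2, a bound that presupposes no continuity of pi. *)
Lemma pi_bound1 s f M x : 0 <= M -> sa_dom f -> supp_in [:: s] f -> sbound f M ->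
  rnorm (pi f x) <= M * rnorm x.
Proof.
move=> M0 df sf fM; have dk := dom_sqrt s M0 df fM; set k := cocyl s M f in dk.
have di := @ind_dom R E s.
have [w fw hw] := pi_family.
have nw : rnorm (pi (ind R s) x) <= rnorm x.
  rewrite -hw; apply: le_trans (op_rnormP _ _) _.
  by rewrite -[leRHS]mul1r ler_wpM2r // (family_norm s fw).
have sk : supp_in [:: s] k.
  by move=> g n0; exists s; rewrite ?mem_head //; apply: contrapT => h; apply: n0; rewrite /k /cocyl indF // mul0r.
have key : sa_mul (sa_star f) f + sa_mul (sa_star k) k =
    (M ^+ 2)%:C *: sa_mul (sa_star (ind R s)) (ind R s).
  (* Through the cylinder of s* there is at most one factorization of g, so every convolution in the
     identity is a single product. *)
  apply/funext => g; have [L [sL pL _ h]] := conv_list R [:: gis_star s] g.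
  have star_supp f' : supp_in [:: s] f' -> supp_in [:: gis_star s] (sa_star f').
    move=> sf' y n0; have : f' (pg_inv y) <> 0 by move=> z; apply: n0; rewrite /= z rmorph0.
    case/sf' => r; rewrite inE => /eqP -> /cyl_inv hs; by exists (gis_star s); rewrite ?mem_head.
  rewrite [LHS](_ : _ = sa_mul (sa_star f) f g + sa_mul (sa_star k) k g) //.
  rewrite [RHS](_ : _ = (M ^+ 2)%:C * sa_mul (sa_star (ind R s)) (ind R s) g) //.
  have si := @ind_supp R E s.
  rewrite !h; try exact: star_supp.
  case: L sL pL {h} => [|p [|q L]] // _ pL; first by rewrite !big_nil mulr0 addr0.
  rewrite !big_seq1 /=; have [pg [r]] := pL p (mem_head _ _).
  rewrite inE => /eqP -> /cyl_inv s1.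
  have [s2|n2] := pselect (cyl s p.2); last first.
    have out f' : supp_in [:: s] f' -> f' p.2 = 0.
      by move=> sf'; apply: contrapT => /sf'[r']; rewrite inE => /eqP ->.
    by rewrite !out // !mulr0 addr0.
  (* Both points lie in the cylinder of s and share their first component, so the product is a
     square modulus. *)
  have e12 : pg_inv p.1 = p.2.
    move: pg => [y1 [n1 [y2 [m1 [y3 [e1 e2 _]]]]]].
    by apply: (cyl_source s1 s2 _ e2); rewrite /= e1.
  rewrite e12 /k /cocyl indT // !mul1r conjC1 !mulr1.
  rewrite mulrC -cabs2 [X in _ + X]mulrC -cabs2 cabsR ger0_norm ?sqrtr_ge0 //.
  rewrite sqr_sqrtr ?subr_ge0 ?ler_pXn2r ?nnegrE // -rmorphD; congr (_%:C).
  by rewrite addrC subrK.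
have := pi_sq x df; have := pi_sq x dk; have := pi_sq x di => hi hk hf.
have dsf : sa_dom (sa_mul (sa_star f) f) by apply: dom_mul => //; exact: dom_star.
have dsk : sa_dom (sa_mul (sa_star k) k) by apply: dom_mul => //; exact: dom_star.
have dsi : sa_dom (sa_mul (sa_star (ind R s)) (ind R s)) by apply: dom_mul => //; exact: dom_star.
have : hdot x (pi (sa_mul (sa_star f) f) x) + hdot x (pi (sa_mul (sa_star k) k) x) =
    (M ^+ 2 * rnorm (pi (ind R s) x) ^+ 2)%:C.
  rewrite -hdotDr -piD // key piZ // hdotZr hi (rmorphM _ (M ^+ 2)) /=; congr (_ * _).
  by rewrite conj_Creal // complex_real.
rewrite hf hk -rmorphD => /complexI e.
rewrite -(@ler_pXn2r _ 2) ?nnegrE ?mulr_ge0 // exprMn.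
apply: (@le_trans _ _ (M ^+ 2 * rnorm (pi (ind R s) x) ^+ 2)); first by rewrite -e lerDl sqr_ge0.
by rewrite ler_wpM2l ?sqr_ge0 // ler_pXn2r ?nnegrE.
Qed.

(** Multiplication by [ind s] splits off a part supported in one cylinder, at a cost of M each time;
    the rest keeps the bound M and is supported in the shorter list. *)
Lemma pi_bound ss f M x : 0 <= M -> sa_dom f -> supp_in ss f -> sbound f M ->
  rnorm (pi f x) <= (size ss)%:R * M * rnorm x.
Proof.
move=> M0; elim: ss f => [|s ss IH] f df sf fM.
  have -> : f = 0 by apply/funext => g; apply: contrapT => /sf[].
  by rewrite pi0 rnorm0 !mul0r.
have ind01 (g : pgroupoid E) : ind R s g = 0 \/ ind R s g = 1.
  by have [h|h] := pselect (cyl s g); [right; rewrite indT|left; rewrite indF].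
pose f1 : Cc := fun g : pgroupoid E => ind R s g * f g.
have sf1 : supp_in [:: s] f1.
  move=> g n0; exists s; rewrite ?mem_head //; apply: contrapT => h; apply: n0.
  by rewrite /f1 indF // mul0r.
have df1 : sa_dom f1.
  have [ts h] := dom_capprox df; apply: (@capprox_dom R E [:: s]) => e e0.
  have [cs _ hcs] := h e e0; exists (cut s cs); first exact: under_supp (@under_cut R E s cs).
  move=> g; rewrite Cc_sub step_cut /f1 -mulrBr; case: (ind01 g) => ->.
    by rewrite mul0r cabs0 ltW.
  by rewrite mul1r; exact: hcs.
have ef : f = f1 + (f - f1) by rewrite addrC subrK.
have d2 := dom_sub df df1.
rewrite ef piD //; apply: le_trans (rnormD _ _) _.
rewrite /= mulrSr [(_ + 1) * _]mulrDl mul1r mulrDl [leRHS]addrC; apply: lerD.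
  apply: (@pi_bound1 s) => // g; rewrite /f1; case: (ind01 g) => ->; first by rewrite mul0r cabs0.
  by rewrite mul1r.
apply: IH => // g; rewrite Cc_sub /f1; case: (ind01 g) (@indT R E s g) => e it.
- rewrite e mul0r subr0 => /[dup] n0 /sf[r]; rewrite inE => /orP[/eqP ->|rss rg]; last by exists r.
  by move/it; rewrite e => /eqP; rewrite eq_sym oner_eq0.
- by rewrite e mul1r subrr.
- by rewrite e mul0r subr0.
by rewrite e mul1r subrr cabs0.
Qed.

End PiRep.

(** * The universal property of the groupoid algebra *)

Section PgUniv.
Variables (R : realType) (E : digraph).
Local Notation comb := (comb R E).
Local Notation Cc := (pg_Cc R E).
Implicit Types (cs ds : comb) (s t : gis E) (ss ts : seq (gis E)) (f g : Cc).

Lemma pg_rep_ex (H : hilbertType R) (Pi : gis E -> H -> H) : gis_rep Pi ->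
  exists2 pi : Cc -> H -> H, pg_Cc_rep pi & forall cs, pi (step cs) = lin Pi cs.
Proof.
move=> rPi; have [_ _ _ nd _] := rPi; have [w fw hw] := gis_rep_family rPi.
have bw := op_sup_bounded fw; have [kL kM kS] := kappa_hom fw bw.
pose pi f := opval (kappa w f).
exists pi; last first.
  move=> cs; rewrite /pi kappa_step // opval_lin; congr (lin _ cs); exact/funext.
split; first split.
- by move=> f _; exact: opval_bounded.
- by move=> c f g x df dg; rewrite /pi kL // opvalD opvalZ.
- by move=> f g x df dg; rewrite /pi kM.
- by move=> f df; rewrite /pi kS //; exact: opval_adj.
(* Indicators are sent to the operators of Pi, whose ranges already span a dense subspace. *)
apply/dense_rnorm => y e e0; have /dense_rnorm/(_ y e e0)[_ [n [i [x [_ ->]]]] hz] := nd.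
exists (\sum_k Pi (i k) (x k)) => //; exists n, (fun k => ind R (i k)), x; split.
  by move=> k; exact: ind_dom.
by apply: eq_bigr => k _; rewrite /pi kappa_ind // hw.
Qed.

(** The distance in the form in which [pi_bound] controls it simultaneously in all
    representations. *)
Definition near_step f cs (e : R) := exists ss, exists2 M, 0 <= M &
  [/\ supp_in ss (f - step cs), sbound (f - step cs) M & (size ss)%:R * M <= e].

Lemma pi_near (H : hilbertType R) (pi : Cc -> H -> H) f cs (e : R) : star_rep pi ->
  sa_dom f -> near_step f cs e -> opnorm (pi (f - step cs)) <= e.
Proof.
move=> rpi df [ss [M M0 [sf bf le]]]; have [pB _ _ _] := rpi.
have dd := dom_sub df (@step_dom R E cs).
apply: le_trans le; apply: opnorm_le; [exact: pB|by rewrite mulr_ge0|].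
by move=> x; exact: pi_bound.
Qed.

Lemma opnorm_near (H : hilbertType R) (pi : Cc -> H -> H) f cs (e : R) : star_rep pi ->
  sa_dom f -> near_step f cs e ->
  opnorm (pi f) <= opnorm (pi (step cs)) + e /\ opnorm (pi (step cs)) <= opnorm (pi f) + e.
Proof.
move=> rpi df nf; have he := pi_near rpi df nf; have [pB _ _ _] := rpi.
have ds := @step_dom R E cs; have dd := dom_sub df ds.
have bf := pB f df; have bs := pB _ ds; have bd := pB _ dd.
have e0 : 0 <= e by apply: le_trans he; exact: opnorm_ge0.
have efx x : pi f x = pi (step cs) x + pi (f - step cs) x.
  by rewrite -(piD rpi) // addrC subrK.
have bx x : rnorm (pi (f - step cs) x) <= e * rnorm x.
  by apply: le_trans (opnormP _ bd) _; rewrite ler_wpM2r.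
split; apply: opnorm_le => //; rewrite ?addr_ge0 ?opnorm_ge0 // => x.
  rewrite efx; apply: le_trans (rnormD _ _) _; rewrite mulrDl; apply: lerD => //.
  exact: opnormP.
have -> : pi (step cs) x = pi f x - pi (f - step cs) x by rewrite efx addrK.
apply: le_trans (rnormD _ _) _; rewrite rnormN mulrDl; apply: lerD => //.
exact: opnormP.
Qed.

Lemma small_size ss (C e : R) : 0 <= C -> 0 < e ->
  exists d : R, [/\ 0 < d, C * d <= e & (size ss)%:R * (C * d) <= e].
Proof.
move=> C0 e0; pose n : R := (size ss)%:R; have n0 : 0 <= n by [].
have K0 : 0 < n * C + C + 1 by rewrite ltr_wpDl // addr_ge0 // mulr_ge0.
exists (e / (n * C + C + 1)); split; first exact: divr_gt0.
  rewrite mulrA ler_pdivrMr // mulrC ler_wpM2l ?(ltW e0) //.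
  by have := mulr_ge0 n0 C0; lra.
rewrite -/n !mulrA ler_pdivrMr // mulrC ler_wpM2l ?(ltW e0) //; lra.
Qed.

Lemma dom_near f (e : R) : sa_dom f -> 0 < e -> exists cs, near_step f cs e.
Proof.
case/dom_capprox => ss af e0; have [d [d0 _ hd]] := small_size ss ler01 e0.
rewrite mul1r in hd; have [cs sc bc] := af d d0.
exists cs, ss, d; rewrite ?(ltW d0) //; split => //.
by apply: supp_B => //; exact: capprox_supp.
Qed.

Lemma Lim_near (D : cstarAlg R) (u : gis E -> D) f l (e : R) : Lim u f l -> 0 < e ->
  exists cs, near_step f cs e /\ rnorm (lin u cs - l) <= e.
Proof.
move=> Lf e0; have [ts af] := Lim_capprox Lf; move: Lf => [ss [C C0 h]].
have [d [d0 hd hd']] := small_size (ts ++ ss) C0 e0.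
have [cs [sc bc lc]] := h d d0; exists cs; split; last exact: le_trans hd.
exists (ts ++ ss), (C * d); first by rewrite mulr_ge0 ?(ltW d0).
split => //; apply: supp_B; [apply: supp_catl; exact: capprox_supp|exact: supp_catr].
Qed.

(** The exact supremum is found on step functions, where both sides are the norm of a combination.
    The number of cylinders enters only through [near_step], which can be made arbitrarily small. *)
Lemma univ_pg_cstar (A : cstarAlg R) (u : gis E -> A) : univ u -> is_pg_cstar E A.
Proof.
move=> uu; have [fu den up lo] := uu; have bu := univ_sup_bounded uu.
exists (kappa u); split; first exact: kappa_hom.
  apply/dense_rnorm => a e e0; have [cs hcs] := den a e e0.
  exists (lin u cs) => //; exists (step cs); first exact: step_dom.
  exact: kappa_step.
move=> f df; split.
  move=> _ [H [pi [[rpi _] ->]]]; apply/ler_addgt0Pr => e e0.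
  have [cs [nf lf]] := Lim_near (kappaP bu df) (divr_gt0 e0 (ltr0Sn R 1)).
  have [h1 _] := opnorm_near rpi df nf; have [w fw hw] := pi_family rpi.
  have h2 := family_rep_le fw (up cs); rewrite -opval_norm (pi_lin rpi cs hw) in h2.
  have := rnormB_ge (lin u cs) (kappa u f); lra.
move=> M ubM; apply/ler_addgt0Pr => e e0.
have [cs [nf lf]] := Lim_near (kappaP bu df) (divr_gt0 e0 (ltr0Sn R 1)).
have h3 : rnorm (lin u cs) <= M + e / 2.
  apply: lo => H Pi rPi; have [pi rpi hpi] := pg_rep_ex rPi.
  have [spi _] := rpi; have [_ h1] := opnorm_near spi df nf.
  rewrite -hpi; apply: le_trans h1 _; rewrite lerD2r; apply: ubM; by exists H, pi.
have := rnormB_ge (kappa u f) (lin u cs); rewrite rnormC; lra.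
Qed.

Lemma pg_cstar_univ (C : cstarAlg R) : is_pg_cstar E C -> exists u : gis E -> C, univ u.
Proof.
move=> [kap [[kL kM kS] den sup]]; pose u s := kap (ind R s).
have di s := @ind_dom R E s; have ds cs := @step_dom R E cs.
have d0 : sa_dom (0 : Cc) := dom0 R E.
have k0 : kap 0 = 0 by have := kL (-1) 0 0 d0 d0; rewrite scaler0 addr0 scaleN1r addNr.
have lu cs : lin u cs = kap (step cs).
  elim: cs => [|p cs IH]; first by rewrite /step !lin_nil k0.
  by rewrite step_cons lin_cons IH kL.
have i0 : ind R None = 0 :> Cc by apply/funext => g; rewrite indF.
have near f cs (e : R) : sa_dom f -> near_step f cs e -> rnorm (kap f - lin u cs) <= e.
  move=> df nf; rewrite lu.
  have -> : kap f - kap (step cs) = kap (f - step cs).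
    by have := kL (-1) _ _ (ds cs) df; rewrite !scaleN1r addrC => ->; rewrite addrC.
  have [_] := sup _ (dom_sub df (ds cs)); apply => _ [H [pi [[rpi _] ->]]]; exact: pi_near.
exists u; split.
- split.
  + by move=> s t; rewrite /u -conv_ind kM.
  + by move=> s; rewrite /u -kS // star_ind.
  + by rewrite /u i0.
  move=> v fv; rewrite /u ind_vfin // -lu /lin big_map; apply: eq_bigr => e _.
  by rewrite scale1r.
- move=> a e e0; have ep := divr_gt0 e0 (ltr0Sn R 1).
  have /dense_rnorm/(_ a _ ep)[_ [f df <-] fa] := den.
  have [cs nf] := dom_near df ep; exists cs.
  apply: le_lt_trans (rnorm_tri (kap f) _ _) _; rewrite [e]splitr ler_ltD //.
  by rewrite rnormC; exact: near.
- move=> cs H Pi rPi; have [pi rpi hpi] := pg_rep_ex rPi.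
  by rewrite lu -hpi; have [ub _] := sup _ (ds cs); apply: ub; exists H, pi.
move=> cs M h; rewrite lu; have [_] := sup _ (ds cs); apply => _ [H [pi [[rpi _] ->]]].
have [w fw hw] := pi_family rpi.
by rewrite -(pi_lin rpi cs hw) opval_norm; exact: family_rep_le.
Qed.

End PgUniv.

Theorem corollary1 (R : realType) (E : digraph) (noSinks : no_sinks E) :
  [/\ exists A : cstarAlg R, is_graph_cstar E A,
      exists B : cstarAlg R, is_gis_cstar E B,
      exists C : cstarAlg R, is_pg_cstar E C
    & forall A B C : cstarAlg R,
        is_graph_cstar E A -> is_gis_cstar E B -> is_pg_cstar E C ->
        cstar_iso A B /\ cstar_iso B C].
Proof.
have [A [u [uu [H [phi [rphi nphi]]]]]] := univ_exists R E.
split.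
- by exists A; apply: univ_graph_cstar uu rphi nphi.
- by exists A; apply: univ_gis_cstar uu.
- by exists A; apply: univ_pg_cstar uu.
move=> A1 B C /graph_cstar_univ[a ua] /gis_cstar_univ[b ub] /pg_cstar_univ[c uc].
by split; [exact: univ_iso ua ub|exact: univ_iso ub uc].
Qed.
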